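(* Let $\Sigma=(f,g)$ be a control-affine system $\dot\xi=f(\xi)+g(\xi)u$, $u\in\mathbb{R}$, on an $n$-dimensional state manifold $\mathcal{M}$ and with scalar control, and let $\xi_0\in\mathcal{M}$. Assume that the Lie algebra of infinitesimal symmetries of $\Sigma$ possesses a Lie subalgebra $\mathfrak{L}$ for which the following conditions hold at $\xi_0$: $f(\xi_0)\notin\mathcal{G}(\xi_0)$; $\mathfrak{L}$ acts transitively on $\mathcal{M}$; $\mathfrak{L}=\mathfrak{I}\rtimes\mathrm{vect}_{\mathbb{R}}\{v_0\}$ is almost abelian; its abelian ideal $\mathfrak{I}$ satisfies $\mathfrak{I}(\xi_0)\oplus\mathcal{G}(\xi_0)=T_{\xi_0}\mathcal{M}$; and the operator $\mathrm{ad}_{v_0}:\mathfrak{I}\to\mathfrak{I}$, $v\mapsto[v_0,v]$, is non-singular and diagonalisable over $\mathbb{R}$. Then $\Sigma$ is, locally around $\xi_0$, feedback equivalent to a trivial system of the form $$\Sigma_\lambda:\quad \dot x_i=\eta_i\,(w+1)^{\lambda_i},\quad 1\leq i\leq n-1,\qquad \dot w=u,\quad u\in\mathbb{R},$$ around $(x_0,0)\in\mathbb{R}^{n-1}\times\mathbb{R}$, where the $\lambda_i$'s are the eigenvalues of $\mathrm{ad}_{v_0}$ and the $\eta_i$ are constants equal to $0$ or $1$, with $\eta_1=1$.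
   Context: All objects are $C^\infty$-smooth. $\mathcal{G}=\mathrm{span}\{g\}$. Two scalar-input control-affine systems $\Sigma=(f,g)$ and $\tilde\Sigma=(\tilde f,\tilde g)$ are locally feedback equivalent at $\xi_0$ and $\tilde\xi_0=\phi(\xi_0)$ if there exist a local diffeomorphism $\phi$ and local smooth functions $\alpha$ and $\beta\neq 0$ with $\tilde f=\phi_*(f+g\alpha)$, $\tilde g=\phi_*(g\beta)$. A vector field $v$ is an infinitesimal symmetry of $\Sigma$ if its local flow $\gamma_t^v$ preserves the affine distribution $\mathcal{A}=f+\mathcal{G}$, i.e. $(\gamma^v_t)_*\mathcal{A}=\mathcal{A}$ whenever defined. The infinitesimal symmetries form a real Lie algebra. For a Lie algebra $\mathfrak{L}$ of vector fields, $\mathfrak{L}(\xi)=\{v(\xi):v\in\mathfrak{L}\}$; that $\mathfrak{L}$ acts transitively means $\mathfrak{L}(\xi)=T_\xi\mathcal{M}$. A real Lie algebra $\mathfrak{L}$ is almost abelian if it has an abelian ideal $\mathfrak{I}$ of codimension one; then $\mathfrak{L}\cong\mathfrak{I}\rtimes\mathrm{vect}_{\mathbb{R}}\{v_0\}$ for some $v_0\in\mathfrak{L}\setminus\mathfrak{I}$. Eigenvalues are listed with multiplicity, in a suitable order. *)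

(* Defs.v *)
From HB Require Import structures.
From mathcomp Require Import all_boot all_order all_algebra.
From mathcomp Require Import all_classical all_reals all_analysis.

Set Implicit Arguments.
Unset Strict Implicit.
Unset Printing Implicit Defensive.
Import Order.TTheory GRing.Theory Num.Theory.
Import numFieldNormedType.Exports.
Local Open Scope classical_set_scope.
Local Open Scope ring_scope.

(* Meant for an open set U. *)
Fixpoint Ck (R : realType) (V W : normedModType R) (k : nat) (U : set V)
    (F : V -> W) : Prop :=
  match k with
  | 0%N => forall x, U x -> {for x, continuous F}
  | k'.+1 => (forall x, U x -> differentiable F x) /\
             (forall v, Ck k' U (fun x => 'D_v F x))
  end.

Definition smooth (R : realType) (V W : normedModType R) (U : set V)
  (F : V -> W) : Prop := forall k, Ck k U F.

Lemma Ck_cst (R : realType) (V W : normedModType R) (a : W) k (U : set V) :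
  Ck k U (fun=> a).
Proof.
elim: k a => [|k IH] a /=; first by move=> x _; exact: cst_continuous.
split=> [x _|v]; first exact: differentiable_cst.
by under eq_fun do rewrite derive_cst; exact: IH.
Qed.

Lemma smooth_id (R : realType) (V : normedModType R) (U : set V) :
  smooth U (fun x : V => x).
Proof.
case=> [|k] /=; first by move=> x _.
split=> [x _|v]; first exact: ex_diff.
by under eq_fun do rewrite derive_id; exact: Ck_cst.
Qed.

Lemma second_countable_rV (R : realType) n :
  second_countable (T := 'rV[R]_n).
Proof.
pose b (p : 'rV[rat]_n * nat) : set 'rV[R]_n :=
  ball (map_mx ratr p.1 : 'rV[R]_n) (p.2.+1%:R^-1).
exists (range b).
  exact/(card_le_trans (card_image_le _ _))/countableP.
split=> [_ [p _ <-]|x V /nbhs_ballP [e /= e0 eV]]; first exact: ball_open.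
have [k _ ke] : exists2 k : nat, True & k.+1%:R^-1 < e / 2.
  have [//|k] := @ltr_add_invr R 0 (e / 2); first by rewrite divr_gt0.
  by rewrite add0r; exists k.
have k0 : (0 : R) < k.+1%:R^-1 by rewrite invr_gt0.
have /choice[q qP] : forall j : 'I_n, exists q : rat,
    `|ratr q - x 0 j| < (k.+1%:R^-1 : R).
  move=> j; have /rat_in_itvoo[q] :
    x 0 j - k.+1%:R^-1 < x 0 j + k.+1%:R^-1 by rewrite ltrD2l gtrN.
  by rewrite in_itv /= => qj; exists q; rewrite ltr_distl.
pose c := (\row_j q j, k).
have bx : b c x.
  by split=> // i j; rewrite !mxE (ord1 i); exact: qP.
exists (b c); first by split=> //; exists c.
move=> y by_; apply: eV.
apply: (@ball_splitr _ _ (map_mx ratr c.1 : 'rV[R]_n)).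
  by apply: le_ball bx; exact: ltW.
by apply: le_ball by_; exact: ltW.
Qed.

(* A chart i is a homeomorphism crd i from the open set dom i onto an open
   subset of R^n, with inverse par i.  A preferred chart is chosen around
   each point. *)
Record manifold (R : realType) (n : nat) := Manifold {
  carrier :> topologicalType ;
  chart : Type ;
  dom : chart -> set carrier ;
  crd : chart -> carrier -> 'rV[R]_n ;
  par : chart -> 'rV[R]_n -> carrier ;
  chart_at : carrier -> chart ;
  dom_open : forall i, open (dom i) ;
  crd_open : forall i, open (crd i @` dom i) ;
  crdK : forall i x, dom i x -> par i (crd i x) = x ;
  crd_continuous : forall i x, dom i x -> {for x, continuous (crd i)} ;
  par_continuous : forall i x, dom i x ->
    {for crd i x, continuous (par i)} ;
  transition_smooth : forall i j,
    smooth (crd i @` (dom i `&` dom j)) (crd j \o par i) ;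
  dom_chart_at : forall x, dom (chart_at x) x ;
  manifold_hausdorff : hausdorff_space carrier ;
  manifold_second_countable : second_countable (T := carrier) }.

Arguments dom {R n m} _ : rename.
Arguments crd {R n m} _ : rename.
Arguments par {R n m} _ : rename.
Arguments chart_at {R n} m _.

Section euclidean.
Context (R : realType) (n : nat).
Let T : topologicalType := 'rV[R]_n.

Let d (_ : unit) : set T := setT.
Let c (_ : unit) (x : T) : 'rV[R]_n := x.
Let p (_ : unit) (x : 'rV[R]_n) : T := x.

Let c_open i : open (c i @` d i).
Proof. by rewrite image_id; exact: openT. Qed.

Let t_smooth i j : smooth (c i @` (d i `&` d j)) (c j \o p i).
Proof. exact: smooth_id. Qed.

Definition euclidean : manifold R n :=
  @Manifold R n T unit d c p (fun=> tt) (fun=> openT) c_open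
    (fun _ _ _ => erefl) (fun _ x _ => @cvg_id _ (nbhs x))
    (fun _ x _ => @cvg_id _ (nbhs x)) t_smooth (fun=> I)
    (@norm_hausdorff R 'rV[R]_n) (second_countable_rV R n).

End euclidean.

(* The tangent space at x is R^n, through the preferred chart at x.  A vector
   field is thus a function assigning to x its components at x in that
   chart, and equality of vector fields is equality of functions. *)

Section maps.
Context (R : realType) (m n : nat) (M : manifold R m) (N : manifold R n).

Definition smooth_fun (U : set M) (a : M -> R) : Prop :=
  forall i, smooth (crd i @` (dom i `&` U)) (a \o par i).

Definition smooth_map (U : set M) (F : M -> N) : Prop :=
  (forall x, U x -> {for x, continuous F}) /\
  forall i j, smooth (crd i @` (dom i `&` U `&` F @^-1` dom j))
                     (crd j \o F \o par i).

Definition tangent_map (F : M -> N) (x : M) : 'rV[R]_m -> 'rV[R]_n :=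
  'd (crd (chart_at N (F x)) \o F \o par (chart_at M x))
     (crd (chart_at M x) x).

End maps.

Definition local_diffeo (R : realType) (m n : nat) (M : manifold R m)
    (N : manifold R n) (U : set M) (F : M -> N) : Prop :=
  exists (V : set N) (G : N -> M),
    [/\ open U, open V, smooth_map U F, smooth_map V G &
      (forall x, U x -> V (F x) /\ G (F x) = x) /\
      (forall y, V y -> U (G y) /\ F (G y) = y)].


Section vector_fields.
Context (R : realType) (n : nat) (M : manifold R n).
Implicit Types (v w : M -> 'rV[R]_n).

(* Components of v in the chart i, as a function of the coordinates. *)
Definition local_rep (i : chart M) v (y : 'rV[R]_n) : 'rV[R]_n :=
  let x := par i y in
  'd (crd i \o par (chart_at M x)) (crd (chart_at M x) x) (v x).

Definition smooth_vfield v : Prop :=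
  forall i, smooth (crd i @` dom i) (local_rep i v).

(* The sign is that of [v, w] h = v (w h) - w (v h). *)
Definition bracket v w : M -> 'rV[R]_n := fun x =>
  let i := chart_at M x in
  'd (local_rep i w) (crd i x) (v x) - 'd (local_rep i v) (crd i x) (w x).

Definition integral_curve v (J : set R) (c : R -> M) : Prop :=
  forall t, J t -> {for t, continuous c} /\
    is_derive t (1 : R) (crd (chart_at M (c t)) \o c) (v (c t)).

(* gam is the maximal local flow of v, with domain D. *)
Record is_flow v (D : set (R * M)) (gam : R -> M -> M) : Prop := IsFlow {
  flow_open : open D ;
  flow_dom0 : forall x, D (0, x) ;
  flow_interval : forall x, is_interval [set t | D (t, x)] ;
  flow0 : forall x, gam 0 x = x ;
  flow_integral : forall x, integral_curve v [set t | D (t, x)] (gam^~ x) ;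
  flow_continuous : forall p, D p ->
    {for p, continuous (fun q => gam q.1 q.2)} ;
  flow_smooth : forall i j,
    smooth [set q : R * 'rV[R]_n | [/\ (crd i @` dom i) q.2,
              D (q.1, par i q.2) & dom j (gam q.1 (par i q.2))]]
           (fun q : R * 'rV[R]_n => crd j (gam q.1 (par i q.2))) ;
  flow_maximal : forall x (J : set R) c, open J -> is_interval J -> J 0 ->
    c 0 = x -> integral_curve v J c -> J `<=` [set t | D (t, x)] }.

Definition line_distribution (g : M -> 'rV[R]_n) (x : M) : set 'rV[R]_n :=
  range (fun a : R => a *: g x).

Definition affine_distribution (f g : M -> 'rV[R]_n) (x : M) :
    set 'rV[R]_n :=
  range (fun a : R => f x + a *: g x).

Definition infinitesimal_symmetry (f g v : M -> 'rV[R]_n) : Prop :=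
  smooth_vfield v /\
  exists D gam, is_flow v D gam /\
    forall t x, D (t, x) ->
      tangent_map (gam t) x @` affine_distribution f g x =
      affine_distribution f g (gam t x).

Definition subspace (L : set (M -> 'rV[R]_n)) : Prop :=
  L 0 /\ forall (a : R) v w, L v -> L w -> L (a *: v + w).

Definition lie_subalgebra (L : set (M -> 'rV[R]_n)) : Prop :=
  subspace L /\ forall v w, L v -> L w -> L (bracket v w).

(* I is an abelian ideal of L, and the line of v0 is a complement of I. *)
Definition almost_abelian (L I : set (M -> 'rV[R]_n))
    (v0 : M -> 'rV[R]_n) : Prop :=
  [/\ subspace I, I `<=` L,
      (forall v w, L v -> I w -> I (bracket v w)),
      (forall v w, I v -> I w -> bracket v w = 0) &
      [/\ L v0, ~ I v0 &
        forall v, L v -> exists w (a : R), I w /\ v = w + a *: v0]].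

Definition values (L : set (M -> 'rV[R]_n)) (x : M) : set 'rV[R]_n :=
  (fun v => v x) @` L.

Definition transitive_at (L : set (M -> 'rV[R]_n)) (x : M) : Prop :=
  values L x = setT.

Definition eigenvector (I : set (M -> 'rV[R]_n)) v0 (a : R) v : Prop :=
  I v /\ bracket v0 v = a *: v.

(* I is the sum of the eigenspaces of ad_{v0} on I, which is not assumed to
   be finite-dimensional. *)
Definition ad_diagonalisable (I : set (M -> 'rV[R]_n)) v0 : Prop :=
  forall v, I v -> exists k (e : 'I_k -> M -> 'rV[R]_n) (a : 'I_k -> R),
    (forall i, eigenvector I v0 (a i) (e i)) /\ v = \sum_i e i.

Definition is_basis k (I : set (M -> 'rV[R]_n))
    (e : 'I_k -> M -> 'rV[R]_n) : Prop :=
  (forall i, I (e i)) /\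
  forall v, I v -> exists! a : 'rV[R]_k, v = \sum_i a 0 i *: e i.

Definition is_local_basis k (x0 : M) (I : set (M -> 'rV[R]_n))
    (e : 'I_k -> M -> 'rV[R]_n) : Prop :=
  (forall i, I (e i)) /\
  forall v, I v -> exists! a : 'rV[R]_k,
    \forall x \near x0, v x = (\sum_i a 0 i *: e i) x.

(* The lam i are the eigenvalues, with multiplicity, of ad_{v0} on I: there is
   a basis of I of corresponding eigenvectors.  Nothing prevents I from having
   further elements that vanish around x0 when M is disconnected or the
   symmetries are not transitive away from x0; I is then to be understood as
   an algebra of germs at x0. *)
Definition ad_eigenvalues k (x0 : M) (L I : set (M -> 'rV[R]_n)) v0
    (lam : 'I_k -> R) : Prop :=
  exists e : 'I_k -> M -> 'rV[R]_n,
    [/\ forall i, eigenvector I v0 (lam i) (e i),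
        is_local_basis x0 I e &
        connected [set: M] -> (forall x, transitive_at L x) -> is_basis I e].

End vector_fields.

Definition direct_sum (V : zmodType) (A B : set V) : Prop :=
  [set a + b | a in A & b in B] = setT /\ A `&` B = [set 0].

Definition feedback_equivalent (R : realType) (n : nat) (M N : manifold R n)
    (f g : M -> 'rV[R]_n) (x0 : M) (f' g' : N -> 'rV[R]_n) (y0 : N) : Prop :=
  exists (U : set M) (phi : M -> N) (al be : M -> R),
    [/\ U x0, local_diffeo U phi, phi x0 = y0,
        smooth_fun U al /\ smooth_fun U be &
        forall x, U x ->
          [/\ be x != 0,
              f' (phi x) = tangent_map phi x (f x + al x *: g x) &
              g' (phi x) = tangent_map phi x (be x *: g x)]].

(* The state (x_1, ..., x_n, w) is the row vector row_mx x w. *)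
Definition trivial_f (R : realType) (n : nat) (eta lam : 'I_n -> R)
    (z : euclidean R (n + 1)) : 'rV[R]_(n + 1) :=
  let w := rsubmx (z : 'rV[R]_(n + 1)) 0 0 in
  row_mx (\row_i (eta i * (w + 1) `^ lam i)) 0.

Definition trivial_g (R : realType) (n : nat) (z : euclidean R (n + 1)) :
    'rV[R]_(n + 1) :=
  row_mx 0 1.

(* Main.v *)
(* In a chart around xi0, differentiating the invariance of f + R g under the
   flows of the symmetries gives [v, f], [v, g] in R g for all v in L.  Let e_i
   be eigenvectors of ad_{v0} in I that form, together with g, a frame at xi0.
   Write v0 = sum c_i e_i + beta g and f = sum ph_i e_i + alpha g.  Modulo g, the
   brackets of these identities with e_j and v0 give
     e_j c_i = - lam_j delta_ij,  g c_i = 0,  e_j ph_i = 0,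
     beta (g ph_i) = - lam_i ph_i.
   Hence x_i = - c_i / lam_i and w = ph_1 ^ (1 / lam_1) - 1 are coordinates in
   which e_i is d/dx_i and g is a multiple of d/dw, and ph_i (w + 1) ^ (- lam_i)
   is constant; rescaling the e_i makes these constants 0 or 1.  An eigenvector in
   I that vanishes at a point where L is transitive satisfies a linear system of
   differential equations and vanishes nearby, so the e_i are a basis of I. *)

From HB Require Import structures.
Require Import Defs.
From mathcomp Require Import all_boot all_order all_algebra.
From mathcomp Require Import all_classical all_reals all_analysis.
From mathcomp Require Import perm ring lra.
Set Implicit Arguments.
Unset Strict Implicit.
Unset Printing Implicit Defensive.
Import Order.TTheory GRing.Theory Num.Theory.
Import numFieldNormedType.Exports.
Local Open Scope classical_set_scope.
Local Open Scope ring_scope.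

(** * Differential calculus *)

Section differentials.
Context {R : realType} {V W : normedModType R}.
Implicit Types (F G : V -> W) (x v : V).

(** The symmetry condition concerns flows, and the multiple of [g] that it produces at each time
    comes with no regularity in time. It is therefore eliminated by cross products before
    differentiating, and the resulting multipliers in [v, f] and [v, g] are known only point by
    point. This is enough: the coefficient equations modulo [g] are read off at one point at a time
    and never differentiate a multiplier. Several non-degeneracies have to be earned. The direct sum
    by itself would allow g(xi0) = 0 with I(xi0) the whole tangent space, so this case is excluded
    separately. If beta vanished at xi0, then L(xi0) = I(xi0) would miss g(xi0), against
    transitivity. Some ph_i is nonzero at xi0 because f(xi0) is not in G(xi0); permuting and
    rescaling makes it ph_1(xi0) = 1, so real powers of ph_1 make sense nearby and w vanishes at
    xi0. Since the ideal may be infinite-dimensional a priori, eigenvectors are first counted by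
    their values at xi0, and only afterwards shown to span the ideal, or its germs at xi0. *)

Lemma is_diff_eps F (df : {linear V -> W}) x : continuous df ->
  (forall e : R, 0 < e ->
    \forall h \near 0, `|F (h + x) - F x - df h| <= e * `|h|) ->
  is_diff x F df.
Proof.
move=> dfc H.
have E : F \o shift x = cst (F x) + df +o_ 0 id.
  apply/eqaddoP => e e0; have := H e e0.
  by apply: filterS => h /=; rewrite !fctE /= opprD addrA.
have D := diff_unique dfc E.
by apply: DiffDef => //; apply/diff_locallyP; rewrite D.
Qed.

Lemma near_eq_is_diff F G x : {near x, F =1 G} -> differentiable F x ->
  is_diff x G ('d F x).
Proof.
move=> FG dF; have FGx := nbhs_singleton FG.
apply: is_diff_eps; first exact: diff_continuous.
move=> e e0.
have /diff_locallyP[_ /eqaddoP /(_ e e0)] := dF.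
have FG0 : \forall h \near 0, F (h + x) = G (h + x).
  have : (fun h : V => h + x) @ 0 --> x.
    by rewrite -[X in _ --> X]add0r; apply: cvgD; [exact: cvg_id|exact: cvg_cst].
  by move=> /(_ _ FG).
apply: filterS2 FG0 => h FGh /=.
by rewrite !fctE /= FGh FGx opprD addrA.
Qed.

Lemma near_eq_differentiable F G x : {near x, F =1 G} ->
  differentiable F x -> differentiable G x.
Proof. by move=> FG /(near_eq_is_diff FG) /@ex_diff. Qed.

Lemma derive_linear F x a v w : differentiable F x ->
  'D_(a *: v + w) F x = a *: 'D_v F x + 'D_w F x.
Proof. by move=> dF; rewrite !deriveE// linearP. Qed.

Lemma derive_linear_sum F x n (a : 'I_n -> R) (w : 'I_n -> V) :
  differentiable F x ->
  'D_(\sum_i a i *: w i) F x = \sum_i a i *: 'D_(w i) F x.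
Proof.
move=> dF; rewrite deriveE// linear_sum; apply: eq_bigr => i _.
by rewrite linearZ/= deriveE.
Qed.

End differentials.

Section differentials_row.
Context {R : realType} {V W : normedModType R}.

Lemma derive_comp {V' : normedModType R} (G : V -> V') (F : V' -> W) x v :
  differentiable G x -> differentiable F (G x) ->
  'D_v (F \o G) x = 'D_('D_v G x) F (G x).
Proof.
move=> dG dF; rewrite !deriveE//; last exact: differentiable_comp.
by rewrite diff_comp.
Qed.

Lemma derive_row n (F : 'rV[R]_n -> W) x v : differentiable F x ->
  'D_v F x = \sum_j v 0 j *: 'D_(delta_mx 0 j) F x.
Proof.
by move=> dF; rewrite [in LHS](row_sum_delta v) derive_linear_sum.
Qed.

Lemma differentiable_entry n (F : V -> 'rV[R]_n) x j : differentiable F x ->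
  differentiable (fun y => F y 0 j) x.
Proof.
move=> dF; apply: (@differentiable_comp _ _ _ _ F (fun u : 'rV[R]_n => u 0 j)).
  by [].
exact: differentiable_coord.
Qed.

Lemma derive_entry n (F : V -> 'rV[R]_n) x v j : differentiable F x ->
  ('D_v F x) 0 j = 'D_v (fun y => F y 0 j) x.
Proof. by move=> dF; rewrite derive_mx ?mxE//; exact: diff_derivable. Qed.

Lemma differentiable_rowP n (F : V -> 'rV[R]_n) x :
  (forall j, differentiable (fun y => F y 0 j) x) -> differentiable F x.
Proof.
move=> dF.
have -> : F = \sum_j (fun y => F y 0 j *: (delta_mx 0 j : 'rV[R]_n)).
  by apply/funext => y; rewrite fct_sumE; exact: row_sum_delta.
by apply: differentiable_sum => j; exact: differentiableZl.
Qed.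

End differentials_row.

Lemma derive_powR (R : realType) (V : normedModType R) (a : V -> R) (p : R) y h :
  differentiable a y -> 0 < a y ->
  differentiable (fun z => a z `^ p) y /\
  'D_h (fun z => a z `^ p) y = p * a y `^ (p - 1) * 'D_h a y.
Proof.
move=> da a0.
have dp : differentiable (fun t : R => t `^ p) (a y).
  by apply/derivable1_diffP; apply: derivable_powR; rewrite in_itv/= a0.
split; first exact: (@differentiable_comp _ _ _ _ a (fun t => t `^ p)).
apply: (etrans (@derive_comp _ _ _ _ a (fun t => t `^ p) _ h da dp)).
rewrite -['D_h a y in LHS]mulr1 -[_ * 1]/(_ *: 1) deriveE//.
rewrite linearZ/= -(deriveE _ dp).
rewrite (@derive_val _ _ _ _ _ _ _ (is_derive1_powR p a0)).
by rewrite -[LHS]/(_ * _) mulrC.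
Qed.

(** * Closure properties of the classes [Ck] *)

Section Ck_calculus.
Context {R : realType} {V : normedModType R}.
Implicit Types (U : set V) (x v : V).

Lemma Ck_sub (W : normedModType R) k U U' (F : V -> W) : U' `<=` U ->
  Ck k U F -> Ck k U' F.
Proof.
move=> UU'; elim: k F => [|k IH] F /=; first by move=> H x /UU'; exact: H.
by move=> [dF H]; split=> [x /UU'/dF//|v]; exact: IH.
Qed.

Lemma Ck_eq (W : normedModType R) k U (F G : V -> W) : open U ->
  {in U, F =1 G} -> Ck k U F -> Ck k U G.
Proof.
move=> oU; elim: k F G => [|k IH] F G FG /=.
  move=> H x Ux; have nF : {near x, F =1 G}.
    by apply: filterS (open_nbhs_nbhs (conj oU Ux)) => y Uy; exact/FG/mem_set.
  have cF : F @ x --> F x := H x Ux.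
  rewrite /prop_for /continuous_at -(FG x (mem_set Ux)).
  by apply: cvg_trans cF; exact: near_eq_cvg.
have nF x : U x -> {near x, F =1 G}.
  move=> Ux; apply: filterS (open_nbhs_nbhs (conj oU Ux)) => y Uy.
  exact/FG/mem_set.
move=> [dF H]; split=> [x Ux|v].
  by apply: near_eq_differentiable (nF x Ux) _; exact: dF.
apply: IH (H v) => x /set_mem Ux.
by apply: near_eq_derive; exact: nF.
Qed.

Lemma CkW (W : normedModType R) k U (F : V -> W) : Ck k.+1 U F -> Ck k U F.
Proof.
elim: k F => [|k IH] F; first by move=> [dF _] x /dF/differentiable_continuous.
by move=> [dF H]; split=> // v; exact: IH.
Qed.

Lemma Ck_differentiable (W : normedModType R) k U (F : V -> W) x :
  Ck k.+1 U F -> U x -> differentiable F x.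
Proof. by move=> [+ _]; apply. Qed.

Lemma Ck_derive (W : normedModType R) k U (F : V -> W) v :
  Ck k.+1 U F -> Ck k U ('D_v F).
Proof. by move=> [_]; exact. Qed.

Lemma CkD (W : normedModType R) k U (F G : V -> W) : open U ->
  Ck k U F -> Ck k U G -> Ck k U (F + G).
Proof.
move=> oU; elim: k F G => [|k IH] F G.
  by move=> cF cG x Ux; apply: continuousD; [exact: cF|exact: cG].
move=> [dF HF] [dG HG]; split=> [x Ux|v].
  by apply: differentiableD; [exact: dF|exact: dG].
apply: Ck_eq (IH _ _ (HF v) (HG v)) => // x /set_mem Ux.
by rewrite deriveD//; apply: diff_derivable; [exact: dF|exact: dG].
Qed.

Lemma Ck_sum (W : normedModType R) k U n (F : 'I_n -> V -> W) : open U ->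
  (forall i, Ck k U (F i)) -> Ck k U (fun x => \sum_i F i x).
Proof.
move=> oU H; have -> : (fun x => \sum_i F i x) = \sum_i F i.
  by apply/funext => x; rewrite fct_sumE.
elim/big_ind : _ => [|f g|i _]; [exact: (Ck_cst (0 : W))|exact: CkD|exact: H].
Qed.

Lemma Ck_linear (W W' : normedModType R) (l : {linear W -> W'}) k U
    (F : V -> W) : continuous l -> open U -> Ck k U F -> Ck k U (l \o F).
Proof.
move=> cl oU; elim: k F => [|k IH] F.
  by move=> cF x Ux; apply: continuous_comp; [exact: cF|exact: cl].
move=> [dF H]; have dl y : differentiable l y by exact: linear_differentiable.
split=> [x Ux|v]; first by apply: differentiable_comp; [exact: dF|].
apply: Ck_eq (IH _ (H v)) => // x /set_mem Ux.
rewrite derive_comp//; last exact: dF.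
by rewrite [RHS]deriveE// diff_lin.
Qed.

Lemma CkZ (W : normedModType R) k U (a : R) (F : V -> W) : open U ->
  Ck k U F -> Ck k U (a *: F).
Proof.
by move=> oU; apply: (@Ck_linear _ _ ( *:%R a)) => //; exact: scaler_continuous.
Qed.

Lemma CkN (W : normedModType R) k U (F : V -> W) : open U ->
  Ck k U F -> Ck k U (- F).
Proof. by move=> oU /(CkZ (-1) oU); rewrite scaleN1r. Qed.

Lemma CkB (W : normedModType R) k U (F G : V -> W) : open U ->
  Ck k U F -> Ck k U G -> Ck k U (F - G).
Proof. by move=> oU cF /(CkN oU); exact: CkD. Qed.

Lemma CkM k U (F G : V -> R) : open U ->
  Ck k U F -> Ck k U G -> Ck k U (F * G).
Proof.
move=> oU; elim: k F G => [|k IH] F G.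
  by move=> cF cG x Ux; apply: continuousM; [exact: cF|exact: cG].
move=> cF cG; have [dF HF] := cF; have [dG HG] := cG.
split=> [x Ux|v]; first by apply: differentiableM; [exact: dF|exact: dG].
apply: (@Ck_eq _ _ _ (F * 'D_v G + G * 'D_v F)) => //.
  move=> x /set_mem Ux; rewrite deriveM//; apply: diff_derivable;
    [exact: dF|exact: dG].
(* Each summand pairs one factor with a derivative of the other, so the undifferentiated factor is
   weakened from class [k.+1] to [k]. *)
by apply: CkD => //; apply: IH; by [exact: CkW|exact: Ck_derive].
Qed.

Lemma Ck_prod k U n (F : 'I_n -> V -> R) : open U ->
  (forall i, Ck k U (F i)) -> Ck k U (fun x => \prod_i F i x).
Proof.
move=> oU H; have -> : (fun x => \prod_i F i x) = \prod_i F i.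
  by apply/funext => x; rewrite fct_prodE.
elim/big_ind : _ => [|f g|i _]; [exact: (Ck_cst (1 : R))|exact: CkM|exact: H].
Qed.

Lemma CkV k U (F : V -> R) : open U -> (forall x, U x -> F x != 0) ->
  Ck k U F -> Ck k U (fun x => (F x)^-1).
Proof.
move=> oU F0; elim: k => [|k IH].
  by move=> cF x Ux; apply: continuousV; [exact: F0|exact: cF].
move=> cF; have [dF HF] := cF.
split=> [x Ux|v]; first by apply: differentiableV; [exact: dF|exact: F0].
apply: (@Ck_eq _ _ _ (- ((fun x => (F x)^-1) * (fun x => (F x)^-1) * 'D_v F))).
- by [].
- move=> x /set_mem Ux; rewrite deriveV//; [|exact: F0|]; last first.
    by apply: diff_derivable; exact: dF.
  by rewrite -exprVn expr2 -[_ *: _]/(_ * _) mulNr.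
- apply: CkN => //; apply: CkM => //; last exact: Ck_derive.
  by apply: CkM => //; apply: IH; exact: CkW.
Qed.

Lemma Ck_entry n k U (F : V -> 'rV[R]_n) j : open U ->
  Ck k U F -> Ck k U (fun x => F x 0 j).
Proof.
move=> oU; elim: k F => [|k IH] F.
  move=> cF x Ux.
  apply: (@continuous_comp _ _ _ F (fun u : 'rV[R]_n => u 0 j)).
    exact: cF.
  exact: coord_continuous.
move=> [dF H]; split=> [x Ux|v]; first exact/differentiable_entry/dF.
apply: Ck_eq (IH _ (H v)) => // x /set_mem Ux.
by rewrite derive_entry//; exact: dF.
Qed.

Lemma CkP_row n k U (F : V -> 'rV[R]_n) : open U ->
  (forall j, Ck k U (fun x => F x 0 j)) -> Ck k U F.
Proof.
move=> oU; elim: k F => [|k IH] F H.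
  move=> x Ux.
  have -> : F = \sum_j (fun x => F x 0 j *: (delta_mx 0 j : 'rV[R]_n)).
    by apply/funext => y; rewrite fct_sumE; exact: row_sum_delta.
  elim/big_ind : _ => [|f g|j _]; first exact: cst_continuous.
    exact: continuousD.
  by apply: cvgZr_tmp; exact: H.
have dF x : U x -> differentiable F x.
  by move=> Ux; apply: differentiable_rowP => j; have [+ _] := H j; exact.
split=> // v; apply: IH => j; apply: Ck_eq (Ck_derive v (H j)) => //.
by move=> x /set_mem Ux; rewrite derive_entry//; exact: dF.
Qed.

Lemma Ck_powR k U p (F : V -> R) : open U -> (forall x, U x -> 0 < F x) ->
  Ck k U F -> Ck k U (fun x => F x `^ p).
Proof.
(* The exponent is generalised because differentiation lowers it to [p - 1]. *)
move=> oU F0; elim: k p => [|k IH] p cF.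
  move=> x Ux; have /differentiable_continuous cp :
      differentiable (fun t : R => t `^ p) (F x).
    by apply/derivable1_diffP; apply: derivable_powR; rewrite in_itv/= F0.
  exact: (@continuous_comp _ _ _ F (fun t => t `^ p) x (cF x Ux) cp).
have [dF _] := cF; split=> [x Ux|v].
  by have [] := derive_powR p 0 (dF x Ux) (F0 x Ux).
apply: (@Ck_eq _ _ _ (p *: ((fun x => F x `^ (p - 1)) * 'D_v F))).
- by [].
- move=> x /set_mem Ux; have [_ ->] := derive_powR p v (dF x Ux) (F0 x Ux).
  by rewrite -[RHS]mulrA.
- apply: CkZ => //; apply: CkM => //; last exact: Ck_derive.
  by apply: IH => //; exact: CkW.
Qed.

End Ck_calculus.

(** [Ck] only controls derivatives in constant directions, whereas the chain rule differentiates [F]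
    in the direction 'D_v G x, which varies with x. Expanding that direction in the standard basis
    leaves products of entries of a derivative of [G] with partial derivatives of [F] composed with
    [G], to which the induction applies. *)
Lemma Ck_comp (R : realType) (V : normedModType R) m k (U : set V)
    (U' : set 'rV[R]_m) (G : V -> 'rV[R]_m)
    (F : 'rV[R]_m -> R) : open U -> open U' -> G @` U `<=` U' ->
  Ck k U G -> Ck k U' F -> Ck k U (F \o G).
Proof.
move=> oU oU' GU; elim: k F => [|k IH] F.
  move=> cG cF x Ux; apply: continuous_comp; first exact: cG.
  by apply: cF; apply: GU; exists x.
move=> cG [dF HF]; have [dG HG] := cG.
have UG x : U x -> U' (G x) by move=> Ux; apply: GU; exists x.
split=> [x Ux|v]; first by apply: differentiable_comp; [exact: dG|exact/dF/UG].
apply: (@Ck_eq _ _ _ _ _ (fun x =>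
  \sum_j ('D_v G x 0 j * ('D_(delta_mx 0 j) F \o G) x))).
- by [].
- move=> x /set_mem Ux; rewrite [RHS]derive_comp//; [|exact: dG|exact/dF/UG].
  by rewrite derive_row//; exact/dF/UG.
- apply: Ck_sum => // j; apply: CkM => //.
    by apply: Ck_entry => //; exact: Ck_derive.
  by apply: IH; [exact: CkW|exact: Ck_derive].
Qed.

Lemma Ck_comp_row (R : realType) (V : normedModType R) m n k (U : set V)
    (U' : set 'rV[R]_m) (G : V -> 'rV[R]_m)
    (F : 'rV[R]_m -> 'rV[R]_n) : open U -> open U' -> G @` U `<=` U' ->
  Ck k U G -> Ck k U' F -> Ck k U (F \o G).
Proof.
move=> oU oU' GU cG cF; apply: CkP_row => // j.
apply: (@Ck_comp _ _ _ _ _ _ G (fun y => F y 0 j) oU oU' GU cG).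
exact: (Ck_entry j oU' cF).
Qed.

Lemma row_norm_entry (R : realType) n (u : 'rV[R]_n) j : `|u 0 j| <= `|u|.
Proof.
by rewrite [leRHS]/Num.Def.normr/= mx_normrE; exact: (le_bigmax _ _ (0, j)).
Qed.

Lemma row_norm_le (R : realType) n (u : 'rV[R]_n) (K : R) : 0 <= K ->
  (forall j, `|u 0 j| <= K) -> `|u| <= K.
Proof.
move=> K0 H; rewrite [leLHS]/Num.Def.normr/= mx_normrE.
by apply: bigmax_le => // -[i j] _ /=; rewrite (ord1 i).
Qed.

Lemma row_mul_bounded (R : realType) m n (A : 'M[R]_(m, n)) :
  exists2 C : R, 0 < C & forall u : 'rV[R]_m, `|u *m A| <= C * `|u|.
Proof.
exists (1 + \sum_i \sum_j `|A i j|).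
  by rewrite ltr_pwDl//; apply: sumr_ge0 => i _; apply: sumr_ge0.
move=> u; apply: row_norm_le => [|j].
  by rewrite mulr_ge0// addr_ge0//; apply: sumr_ge0 => i _; apply: sumr_ge0.
rewrite mxE mulrDl mul1r -[leLHS]add0r lerD// (le_trans (ler_norm_sum _ _ _))//.
rewrite mulr_suml ler_sum// => i _; rewrite normrM mulrC ler_pM//.
  by rewrite (bigD1 j)//= lerDl sumr_ge0.
exact: row_norm_entry.
Qed.

Lemma linear_bound_continuous (R : realType) (V W : normedModType R)
    (l : {linear V -> W}) (C : R) : 0 < C ->
  (forall u, `|l u| <= C * `|u|) -> continuous l.
Proof.
move=> C0 HC u; apply/cvgrPdist_lt => e e0; apply/nbhs_ballP.
exists (e / C) => [|w]; first by rewrite /= divr_gt0.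
rewrite -ball_normE /= => Hw; rewrite -linearB; apply: le_lt_trans (HC _) _.
by rewrite mulrC -ltr_pdivlMr.
Qed.

Lemma continuous_row_mul (R : realType) m n (A : 'M[R]_(m, n)) :
  continuous (mulmxr A : 'rV[R]_m -> 'rV[R]_n).
Proof.
have [C C0 HC] := row_mul_bounded A.
exact: (@linear_bound_continuous _ _ _ (mulmxr A) C).
Qed.

(** * Mean values and symmetry of second derivatives *)

Section mean_value.
Context {R : realType} {V : normedModType R}.

Lemma is_derive_line (W : normedModType R) (G : V -> W) x v (a : R) :
  differentiable G (a *: v + x) ->
  is_derive a 1 (fun b : R => G (b *: v + x)) ('D_v G (a *: v + x)).
Proof.
move=> dG.
have dl : is_diff a (fun b : R => b *: v + x) (fun b : R => b *: v).
  have -> : (fun b : R => b *: v) = (fun b : R => b *: v) + cst 0.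
    by apply/funext => b; rewrite fctE addr0.
  exact: is_diffD.
have dGl := @differentiable_comp _ _ _ _ (fun b : R => b *: v + x) G a
  (@ex_diff _ _ _ _ _ _ _ dl) dG.
apply: DeriveDef; first exact/derivable1_diffP.
rewrite [LHS](@derive_comp _ _ _ _ (fun b : R => b *: v + x) G) //.
by rewrite (deriveE _ (@ex_diff _ _ _ _ _ _ _ dl)) diff_val scale1r.
Qed.

Lemma mean_value_line (G : V -> R) x v (s : R) : 0 <= s ->
  (forall a : R, 0 <= a <= s -> differentiable G (a *: v + x)) ->
  exists2 c, 0 <= c <= s & G (s *: v + x) - G x = s * 'D_v G (c *: v + x).
Proof.
move=> s0 dG.
have dl a : 0 <= a <= s ->
    is_derive a 1 (fun b : R => G (b *: v + x)) ('D_v G (a *: v + x)).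
  by move=> /dG; exact: is_derive_line.
have Hd a : a \in `]0, s[ ->
    is_derive a 1 (fun b : R => G (b *: v + x)) ('D_v G (a *: v + x)).
  by rewrite in_itv/= => /andP[a0 as_]; apply: dl; rewrite !ltW.
have Hc : {within `[0, s], continuous (fun b : R => G (b *: v + x))}.
  apply: derivable_within_continuous => a; rewrite in_itv/= => as_.
  exact: (@ex_derive _ _ _ _ _ _ _ (dl a as_)).
have [c cs E] := MVT_segment s0 Hd Hc.
exists c; first by rewrite !(itvP cs).
by move: E; rewrite scale0r add0r subr0 mulrC.
Qed.

(** The norm is the largest modulus of an entry, so the scalar theorem suffices even though its
    intermediate point depends on the entry. *)
Lemma mean_value_le n (F : V -> 'rV[R]_n) x y (K : R) :
  (forall a : R, 0 <= a <= 1 -> differentiable F (a *: (y - x) + x)) ->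
  (forall a : R, 0 <= a <= 1 -> `|'D_(y - x) F (a *: (y - x) + x)| <= K) ->
  `|F y - F x| <= K.
Proof.
move=> dF HK; apply: row_norm_le => [|j].
  by apply: le_trans (HK 0 _) => //; rewrite lexx ler01.
have dFj a : 0 <= a <= 1 ->
    differentiable (fun z => F z 0 j) (a *: (y - x) + x).
  by move=> /dF; exact: differentiable_entry.
have [c c01] := mean_value_line ler01 dFj.
rewrite scale1r subrK mul1r !mxE => ->.
rewrite -derive_entry; last exact: dF.
by apply: le_trans (row_norm_entry _ _) _; exact: HK.
Qed.

(** The mean value theorem is applied along [v] to the increment of [F] by [s *: w], then along [w]
    to the derivative 'D_v F. The left side of the identity is symmetric in [v] and [w], while the
    right side is not. *)
Lemma second_difference (F : V -> R) (U : set V) x v w (s : R) : 0 <= s ->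
  Ck 2 U F ->
  (forall a b : R, 0 <= a <= s -> 0 <= b <= s -> U (a *: v + (b *: w + x))) ->
  exists a b : R, [/\ 0 <= a <= s, 0 <= b <= s &
    F (s *: v + (s *: w + x)) - F (s *: v + x) - F (s *: w + x) + F x =
    s * (s * 'D_w ('D_v F) (a *: v + (b *: w + x)))].
Proof.
move=> s0 cF HU.
have ss : 0 <= s <= s by rewrite ?lexx ?s0 ?lexx.
have z0 : (0 : R) <= 0 <= s by rewrite ?lexx ?s0 ?lexx.
have HU0 a : 0 <= a <= s -> U (a *: v + x).
  by move=> /HU /(_ z0); rewrite scale0r add0r.
pose G y := F (y + s *: w) - F y.
have dG y : U y -> U (y + s *: w) ->
    differentiable G y /\ 'D_v G y = 'D_v F (y + s *: w) - 'D_v F y.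
  move=> Uy Uys.
  have dF1 : differentiable F y by exact: Ck_differentiable cF Uy.
  have dF2 : differentiable F (y + s *: w) by exact: Ck_differentiable cF Uys.
  have is1 : is_diff y (fun z => z + s *: w) id.
    have -> : id = id + cst (0 : V) by apply/funext => b; rewrite fctE addr0.
    exact: is_diffD.
  have dF3 := @differentiable_comp _ _ _ _ (fun z => z + s *: w) F y
    (@ex_diff _ _ _ _ _ _ _ is1) dF2.
  split; first exact: differentiableB.
  rewrite deriveB; try exact: diff_derivable.
  rewrite [in LHS](@derive_comp _ _ _ _ (fun z => z + s *: w) F)//.
  by rewrite (deriveE _ (@ex_diff _ _ _ _ _ _ _ is1)) diff_val.
have HU' a : 0 <= a <= s -> U (a *: v + x + s *: w).
  by move=> as_; rewrite -addrA [x + _]addrC; exact: HU.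
have [a as_ Ea] := @mean_value_line G x v s s0
  (fun a as_ => (dG _ (HU0 _ as_) (HU' _ as_)).1).
have dF' b : 0 <= b <= s -> differentiable ('D_v F) (b *: w + (a *: v + x)).
  by move=> bs; apply: (Ck_differentiable (Ck_derive v cF)); rewrite addrCA; exact: HU.
have [b bs Eb] := mean_value_line s0 dF'.
exists a, b; split=> //.
rewrite [a *: v + (b *: w + x)]addrCA -Eb.
rewrite [s *: w + (a *: v + x)]addrC -(dG _ (HU0 _ as_) (HU' _ as_)).2 -Ea.
rewrite /G -[s *: v + x + s *: w]addrA [x + s *: w]addrC; ring.
Qed.

(* Both iterated derivatives are limits of the same second difference. *)
Lemma derive_swap (F : V -> R) (U : set V) x v w : open U -> U x ->
  Ck 2 U F -> 'D_v ('D_w F) x = 'D_w ('D_v F) x.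
Proof.
move=> oU Ux cF; apply/eqP; rewrite -subr_eq0 -normr_le0.
apply/ler_addgt0Pl => _/posnumP[e]; rewrite addr0.
have c1 : {for x, continuous ('D_v ('D_w F))} by
  exact: (Ck_derive v (Ck_derive w cF)).
have c2 : {for x, continuous ('D_w ('D_v F))} by
  exact: (Ck_derive w (Ck_derive v cF)).
have nU : nbhs x U by exact: open_nbhs_nbhs.
have e2 : 0 < e%:num / 2 by [].
have /cvgrPdist_le /(_ _ e2) n1 := c1.
have /cvgrPdist_le /(_ _ e2) n2 := c2.
have /nbhs_ballP[r /= r0 Hr] : nbhs x (U `&`
    ([set y | `|'D_v ('D_w F) x - 'D_v ('D_w F) y| <= e%:num / 2] `&`
     [set y | `|'D_w ('D_v F) x - 'D_w ('D_v F) y| <= e%:num / 2])).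
  exact: filterI nU (filterI n1 n2).
(* The 1 keeps the denominator positive when [v] and [w] both vanish; the 2 puts the closed
   parallelogram of side [s] strictly inside the ball. *)
pose s := r / (2 * (`|v| + `|w| + 1)).
have D0 : 0 < `|v| + `|w| + 1 by rewrite ltr_wpDl// addr_ge0.
have s0 : 0 < s by rewrite divr_gt0// mulr_gt0.
have Hs a b : 0 <= a <= s -> 0 <= b <= s -> ball x r (a *: v + (b *: w + x)).
  move=> /andP[a0 as_] /andP[b0 bs].
  rewrite -ball_normE /= addrA opprD addrCA subrr addr0 normrN.
  apply: (@le_lt_trans _ _ (s * `|v| + s * `|w|)).
    rewrite (le_trans (ler_normD _ _))// !normrZ !ger0_norm//.
    by rewrite lerD// ler_wpM2r.
  rewrite -mulrDr (@le_lt_trans _ _ (s * (`|v| + `|w| + 1)))//.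
    by rewrite ler_wpM2l ?(ltW s0)// lerDl.
  rewrite /s invfM -!mulrA mulVf ?gt_eqF// mulr1.
  by rewrite ltr_pdivrMr// ltr_pMr// ltr1n.
have Hs' a b : 0 <= a <= s -> 0 <= b <= s -> ball x r (a *: w + (b *: v + x)).
  by move=> as_ bs; rewrite addrCA; exact: Hs.
have HU1 a b : 0 <= a <= s -> 0 <= b <= s -> U (a *: v + (b *: w + x)).
  by move=> as_ bs; have [] := Hr _ (Hs a b as_ bs).
have HU2 a b : 0 <= a <= s -> 0 <= b <= s -> U (a *: w + (b *: v + x)).
  by move=> as_ bs; have [] := Hr _ (Hs' a b as_ bs).
have [a [b [as_ bs E1]]] := second_difference (ltW s0) cF HU1.
have [a' [b' [as' bs' E2]]] := second_difference (ltW s0) cF HU2.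
have E : 'D_w ('D_v F) (a *: v + (b *: w + x)) =
         'D_v ('D_w F) (a' *: w + (b' *: v + x)).
  have sn : s != 0 by rewrite gt_eqF.
  apply: (mulfI sn); apply: (mulfI sn); apply: (etrans (esym E1)).
  apply: etrans E2; congr (_ + _); rewrite addrAC; congr (F _ - _ - _).
  exact: addrCA.
have [_ [_ /= B1]] := Hr _ (Hs a b as_ bs).
have [_ [/= B2 _]] := Hr _ (Hs' a' b' as' bs').
rewrite E in B1.
set A := 'D_v _ x in B2 *; set B := 'D_w _ x in B1 *.
rewrite [e%:num]splitr.
by apply: le_trans (ler_distD _ A B) (lerD B2 _); rewrite distrC.
Qed.

End mean_value.

Lemma derive_swap_row (R : realType) (V : normedModType R) n
    (F : V -> 'rV[R]_n) (U : set V) x v w : open U -> U x ->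
  Ck 2 U F -> 'D_v ('D_w F) x = 'D_w ('D_v F) x.
Proof.
move=> oU Ux cF; apply/rowP => j.
have H a b : ('D_a ('D_b F) x) 0 j = 'D_a ('D_b (fun y => F y 0 j)) x.
  rewrite derive_entry; last exact: Ck_differentiable (Ck_derive b cF) Ux.
  apply: near_eq_derive.
  have : nbhs x U by exact: open_nbhs_nbhs.
  apply: filterS => y Uy.
  by rewrite derive_entry//; exact: Ck_differentiable cF Uy.
apply: etrans (H v w) (etrans _ (esym (H w v))).
have cFj := Ck_entry j oU cF.
exact: (@derive_swap _ _ (fun y => F y 0 j) U x v w oU Ux cFj).
Qed.

Section Ck_matrix.
Context {R : realType} {V : normedModType R}.

Lemma Ck_det n k (U : set V) (M : V -> 'M[R]_n) : open U ->
  (forall i j, Ck k U (fun x => M x i j)) -> Ck k U (fun x => \det (M x)).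
Proof.
move=> oU H.
have -> : (fun x => \det (M x)) =
    \sum_(s : 'S_n) (fun x => (-1) ^+ s * \prod_i M x i (s i)).
  by apply/funext => x; rewrite fct_sumE.
elim/big_ind : _ => [|f g|s _]; [exact: (Ck_cst (0 : R))|exact: CkD|].
apply: (@CkM _ _ _ _ (cst _) (fun x => \prod_i M x i (s i))) => //.
  exact: Ck_cst.
exact: Ck_prod.
Qed.

Lemma Ck_mulmx n p k (U : set V) (u : V -> 'rV[R]_n) (M : V -> 'M[R]_(n, p)) j :
  open U -> (forall i, Ck k U (fun x => u x 0 i)) ->
  (forall i, Ck k U (fun x => M x i j)) ->
  Ck k U (fun x => (u x *m M x) 0 j).
Proof.
move=> oU Hu HM.
have -> : (fun x => (u x *m M x) 0 j) = (fun x => \sum_i u x 0 i * M x i j).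
  by apply/funext => x; rewrite mxE.
apply: Ck_sum => // i.
exact: (@CkM _ _ _ _ (fun x => u x 0 i) (fun x => M x i j)).
Qed.

(** Cramer's rule: the entries of the inverse are polynomials in the entries of [M], divided by a
    determinant without zeros on [U]. *)
Lemma Ck_invmx n k (U : set V) (M : V -> 'M[R]_n) i j : open U ->
  (forall i j, Ck k U (fun x => M x i j)) ->
  (forall x, U x -> M x \in unitmx) ->
  Ck k U (fun x => invmx (M x) i j).
Proof.
move=> oU H HM.
apply: (@Ck_eq _ _ _ _ _
  ((fun x => (\det (M x))^-1) * (fun x => \adj (M x) i j))) => //.
  by move=> x /set_mem Ux; rewrite /invmx (HM x Ux) !mxE !fctE !mxE.
apply: CkM => //.
  apply: CkV => //; last exact: Ck_det.
  by move=> x /HM; rewrite unitmxE unitfE.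
have -> : (fun x => \adj (M x) i j) =
    (cst ((-1) ^+ (j + i))) * (fun x => \det (row' j (col' i (M x)))).
  by apply/funext => x; rewrite mxE.
apply: CkM => //; first exact: Ck_cst.
apply: Ck_det => // a b.
by under eq_fun do rewrite !mxE; exact: H.
Qed.

End Ck_matrix.

(** * The inverse function theorem *)

Lemma ball_segment (R : realType) n (x0 x y : 'rV[R]_n) (r a : R) :
  ball x0 r x -> ball x0 r y -> 0 <= a <= 1 -> ball x0 r (a *: (y - x) + x).
Proof.
rewrite -ball_normE /= => Hx Hy /andP[a0 a1].
have -> : x0 - (a *: (y - x) + x) = (1 - a) *: (x0 - x) + a *: (x0 - y).
  by apply/rowP => j; rewrite !mxE; ring.
apply: (le_lt_trans (ler_normD _ _)); rewrite !normrZ ger0_norm ?subr_ge0//.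
rewrite ger0_norm//.
(* For nonzero [a] the strict inequality is taken from the second summand, which is absent when [a]
   is 0. *)
have [->|an0] := eqVneq a 0; first by rewrite mul0r addr0 subr0 mul1r.
rewrite [ltRHS](_ : _ = (1 - a) * r + a * r); last by ring.
apply: ler_ltD; first by rewrite ler_wpM2l ?subr_ge0// ltW.
by rewrite ltr_pM2l// lt_neqAle eq_sym an0.
Qed.

Lemma differentiable_bound_eps (R : realType) (V W : normedModType R)
    (F : V -> W) x (e : R) : differentiable F x -> 0 < e ->
  exists2 d : R, 0 < d & forall y, `|y - x| < d ->
    `|F y - F x - 'd F x (y - x)| <= e * `|y - x|.
Proof.
move=> /diff_locallyP[_ /eqaddoP H] e0.
have /nbhs_ballP[d /= d0 Hd] := H e e0.
exists d => // y yd; have := Hd (y - x).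
rewrite -ball_normE/= sub0r normrN => /(_ yd).
by rewrite !fctE /= subrK opprD addrA.
Qed.

Lemma nbhs_shift0 (R : realType) (V : normedModType R) (P : set V) z :
  nbhs z P -> nbhs (0 : V) [set h | P (h + z)].
Proof.
have : (fun h : V => h + z) @ 0 --> z.
  by rewrite -[X in _ --> X]add0r; apply: cvgD; [exact: cvg_id|exact: cvg_cst].
by move=> H /H.
Qed.

Lemma nbhs_forall (T : topologicalType) (I : finType) (x : T)
    (P : I -> set T) : (forall i, nbhs x (P i)) ->
  nbhs x [set y | forall i, P i y].
Proof. by move=> H; apply: filter_forall. Qed.

Lemma continuous_nbhs_le (R : realType) (T : topologicalType) (f : T -> R) x
    (e : R) : {for x, continuous f} -> 0 < e ->
  nbhs x [set y | `|f x - f y| <= e].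
Proof. by move=> /cvgrPdist_le H /H. Qed.

Lemma contraction_half_fixed (R : realType) (X : completeNormedModType R)
    (B : set X) (T : X -> X) : closed B -> B !=set0 ->
  (forall x, B x -> B (T x)) ->
  (forall x y, B x -> B y -> `|T x - T y| <= 2^-1 * `|x - y|) ->
  exists2 x, B x & x = T x.
Proof.
move=> cB B0 TB ctr.
have half0 : (0 : R) <= 2^-1 by rewrite invr_ge0.
have ctrT : is_contraction (mkfun_fun TB).
  exists (NngNum half0); split=> /=; first by rewrite invf_lt1// ltr1n.
  by move=> [x y] /= [Bx By] /=; exact: ctr.
exact: banach_fixed_point ctrT cB B0.
Qed.

Lemma row_contraction_half_fixed (R : realType) n (B : set 'rV[R]_n)
    (T : 'rV[R]_n -> 'rV[R]_n) : closed B -> B !=set0 ->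
  (forall x, B x -> B (T x)) ->
  (forall x y, B x -> B y -> `|T x - T y| <= 2^-1 * `|x - y|) ->
  exists2 x, B x & x = T x.
Proof.
pose X : completeNormedModType R :=
  HB.pack_for (completeNormedModType R) (matrix R 1 n).
exact: (@contraction_half_fixed R X).
Qed.

Lemma sub_mx_entry (V : zmodType) m n (A B : 'M[V]_(m, n)) i j :
  (A - B) i j = A i j - B i j.
Proof. by rewrite !mxE. Qed.

Section inverse_function.
Context {R : realType} {m : nat}.
Local Notation E := 'rV[R]_m.

Lemma jacobian_entry (F : E -> E) x i j : differentiable F x ->
  jacobian F x i j = ('D_(delta_mx 0 i) F x) 0 j.
Proof. by move=> dF; rewrite deriveE// mxE. Qed.

Lemma unitmx_inj (A : 'M[R]_m) : (forall u : E, u *m A = 0 -> u = 0) ->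
  A \in unitmx.
Proof.
move=> H; rewrite -row_free_unit -kermx_eq0; apply/eqP/row_matrixP => i.
by rewrite row0; apply: H; rewrite -row_mul mulmx_ker row0.
Qed.

Lemma row_sub_mul_invmx (A B : 'M[R]_m) (v : E) : A \in unitmx ->
  v - v *m B *m invmx A = v *m (A - B) *m invmx A.
Proof. by move=> uA; rewrite mulmxBr mulmxBl mulmxK. Qed.

Lemma row_sub_invmx (A : 'M[R]_m) (u v : E) : A \in unitmx ->
  u - v *m invmx A = - ((v - u *m A) *m invmx A).
Proof. by move=> uA; rewrite mulmxBl mulmxK// opprB. Qed.

Lemma row_mul_le (B : 'M[R]_m) (e : R) (u : E) :
  (forall i j, `|B i j| <= e) -> `|u *m B| <= m%:R * e * `|u|.
Proof.
(* For [m] = 0 the hypothesis has no instance and says nothing about the sign of [e]. *)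
move=> H; have [m0|m0] := posnP m.
  have -> : m%:R = 0 :> R by rewrite m0.
  suff -> : u *m B = 0 by rewrite normr0 !mul0r.
  by apply/rowP => j; suff: (j < 0)%N by []; rewrite -[X in (_ < X)%N]m0.
have e0 : 0 <= e by apply: le_trans (H (Ordinal m0) (Ordinal m0)).
apply: row_norm_le => [|j]; first by rewrite !mulr_ge0.
rewrite mxE (le_trans (ler_norm_sum _ _ _))//.
apply: (@le_trans _ _ (\sum_(i < m) e * `|u|)).
  rewrite ler_sum// => i _; rewrite normrM mulrC ler_pM//.
  exact: row_norm_entry.
by rewrite sumr_const card_ord -mulrA mulr_natl.
Qed.

Lemma Ck_jacobian k (U : set E) (F : E -> E) i j : open U -> smooth U F ->
  Ck k U (fun x => jacobian F x i j).
Proof.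
move=> oU sF.
apply: Ck_eq (Ck_entry j oU (Ck_derive (delta_mx 0 i) (sF k.+1))) => //.
move=> x /set_mem Ux; rewrite jacobian_entry//.
exact: Ck_differentiable (sF 1) Ux.
Qed.

(** With A the inverse of the Jacobian at [y0], the map N(x) = x - F(x) A has zero derivative at
    [y0], hence is 1/2-Lipschitz on a small ball. Solving F(x) = z means finding a fixed point of N
    + z A, and the same Lipschitz bound makes [F] injective with a Lipschitz inverse. *)
Theorem inverse_function (U : set E) (F : E -> E) y0 : open U -> U y0 ->
    smooth U F -> (forall v, 'D_v F y0 = 0 -> v = 0) ->
  exists (U' V' : set E) (G : E -> E),
    [/\ open U', U' `<=` U, U' y0, open V' & smooth V' G] /\
    ((forall x, U' x -> V' (F x) /\ G (F x) = x) /\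
     (forall y, V' y -> U' (G y) /\ F (G y) = y)).
Proof.
move=> oU Uy0 sF F0.
have dF x : U x -> differentiable F x by exact: Ck_differentiable (sF 1).
pose J (x : E) : 'M[R]_m := jacobian F x.
have DF x v : U x -> 'D_v F x = v *m J x.
  by move=> Ux; rewrite deriveEjacobian//; exact: dF.
have cJ i j k : Ck k U (fun x => J x i j) by exact: Ck_jacobian.
have uJ0 : J y0 \in unitmx.
  by apply: unitmx_inj => u; rewrite -DF//; exact: F0.
pose A : 'M[R]_m := invmx (J y0).
have uA : A \in unitmx by rewrite unitmx_inv.
have [C C0 HC] := row_mul_bounded A.
pose N (x : E) : E := x - F x *m A.
have dN x : U x -> differentiable N x /\
    forall v, 'D_v N x = v *m (J y0 - J x) *m A.
  move=> Ux; have dFA : differentiable (mulmxr A \o F : E -> E) x.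
    apply: differentiable_comp; first exact: dF.
    by apply: linear_differentiable; exact: continuous_row_mul.
  split; first exact: (@differentiableB _ _ _ id (mulmxr A \o F)).
  move=> v.
  have DFA : 'D_v (mulmxr A \o F : E -> E) x = 'D_v F x *m A.
    rewrite derive_comp; [|exact: dF|]; last first.
      by apply: linear_differentiable; exact: continuous_row_mul.
    rewrite deriveE; last first.
      by apply: linear_differentiable; exact: continuous_row_mul.
    by rewrite diff_lin//; exact: continuous_row_mul.
  rewrite [LHS](@deriveB _ _ _ id (mulmxr A \o F))//; last exact: diff_derivable.
  rewrite derive_id DFA DF//.
  exact: row_sub_mul_invmx.
(* Chosen so that C m eps <= 1/2, where [C] bounds multiplication by [A] and [m] comes from summing
   the entries of a row; [m.+1] keeps it meaningful for [m] = 0. *)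
pose eps : R := (2 * C * m.+1%:R)^-1.
have eps0 : 0 < eps by rewrite invr_gt0 !mulr_gt0.
have [r r0 Hr] : exists2 r : R, 0 < r & forall x, ball y0 r x ->
    U x /\ forall i j, `|(J y0 - J x) i j| <= eps.
  have : nbhs y0 (U `&` [set x | forall i j, `|(J y0 - J x) i j| <= eps]).
    apply: filterI; first exact: open_nbhs_nbhs.
    apply: nbhs_forall => i; apply: nbhs_forall => j.
    have := continuous_nbhs_le (cJ i j 0%N y0 Uy0) eps0.
    by apply: filterS => x /=; rewrite sub_mx_entry.
  by move=> /nbhs_ballP[r /= r0 Hr]; exists r => // x /Hr[].
have DN x v : ball y0 r x -> `|'D_v N x| <= 2^-1 * `|v|.
  move=> /Hr[Ux Hx]; rewrite (dN x Ux).2 (le_trans (HC _))//.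
  apply: (@le_trans _ _ (C * (m%:R * eps * `|v|))).
    by rewrite ler_pM2l//; exact: row_mul_le.
  rewrite !mulrA ler_wpM2r// /eps.
  rewrite ler_pdivrMr ?mulr_gt0//.
  rewrite !mulrA mulVf// mul1r ler_pM2l// ler_nat.
  exact: leqnSn.
have lipN x x' : ball y0 r x -> ball y0 r x' ->
    `|N x' - N x| <= 2^-1 * `|x' - x|.
  move=> Bx Bx'; apply: mean_value_le => a a01.
    by have /Hr[/dN[]] := ball_segment Bx Bx' a01.
  by apply: DN; exact: ball_segment.
have expF x x' : ball y0 r x -> ball y0 r x' ->
    `|x' - x| <= 2 * `|(F x' - F x) *m A|.
  move=> Bx Bx'; have := lipN _ _ Bx Bx'.
  have E1 : x' - x = (N x' - N x) + (F x' - F x) *m A.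
    rewrite /N mulmxBl; set p := F x *m A; set q := F x' *m A.
    by apply/rowP => j; rewrite !mxE; ring.
  have := ler_normD (N x' - N x) ((F x' - F x) *m A); rewrite -E1.
  set a := `|x' - x|; set b := `|N x' - N x|; set c := `|_ *m A|.
  by move=> H1 H2; lra.
(* A row [u] killed by [J x] would satisfy 'D_u N x = u, whose norm is at most half that of [u]. *)
have uJ x : ball y0 r x -> J x \in unitmx.
  move=> Bx; have [Ux _] := Hr _ Bx; apply: unitmx_inj => u uJ0'.
  have := DN x u Bx; rewrite (dN x Ux).2 -row_sub_mul_invmx// uJ0' mul0mx subr0.
  have := normr_ge0 u; set a := `|u| => a0 H.
  have : a = 0 by lra.
  by move/eqP; rewrite normr_eq0 => /eqP.
pose s := r / 2.
have s0 : 0 < s by rewrite divr_gt0.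
have sr x : `|x - y0| <= s -> ball y0 r x.
  rewrite -ball_normE /= distrC => H; apply: le_lt_trans H _.
  by rewrite ltr_pdivrMr// ltr_pMr// ltr1n.
have By0 : ball y0 r y0 by exact: ballxx.
(* For z in this set the displacement of N + z A from [y0] on the closed ball of radius [s] is at
   most s/2 from [N] plus strictly less than s/2 from z. The ball is thus stable, and the fixed
   point lies in its interior. *)
pose V' : set E := [set z | `|(z - F y0) *m A| < s / 2].
pose B : set E := [set x | `|x - y0| <= s].
have Bfix z : V' z -> exists x, `|x - y0| < s /\ F x = z.
  move=> Vz; pose T (x : E) : E := N x + z *m A.
  have TE x : T x - y0 = (N x - N y0) + (z - F y0) *m A.
    rewrite /T /N mulmxBl; set p := F x *m A; set q := F y0 *m A.
    by set t := z *m A; apply/rowP => j; rewrite !mxE; ring.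
  have TB x : B x -> B (T x).
    move=> Bx; rewrite /B /= TE (le_trans (ler_normD _ _))//.
    have := lipN _ _ By0 (sr _ Bx); move: Bx Vz; rewrite /B /V' /=.
    set a := `|x - y0|; set b := `|_ *m A|; set c := `|_ - _|.
    by move=> H1 H2 H3; lra.
  have cB : closed B.
    have -> : B = closed_ball y0 s.
      apply/seteqP; split=> x; rewrite closed_ballE// /closed_ball_ /B /=;
        by rewrite distrC.
    exact: closed_ball_closed.
  have ctr x x' : B x -> B x' -> `|T x - T x'| <= 2^-1 * `|x - x'|.
    move=> Bx Bx'; rewrite /T opprD addrACA subrr addr0.
    exact: lipN (sr _ Bx') (sr _ Bx).
  have B0 : B !=set0 by exists y0; rewrite /B /= subrr normr0 ltW.
  have [x Bx xT] := row_contraction_half_fixed cB B0 TB ctr.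
  exists x; split.
    have Ex : x - y0 = (N x - N y0) + (z - F y0) *m A by rewrite -TE -xT.
    have := ler_normD (N x - N y0) ((z - F y0) *m A); rewrite -Ex.
    have := lipN _ _ By0 (sr _ Bx); move: Vz; rewrite /V' /=.
    set a := `|x - y0|; set b := `|_ *m A|; set c := `|N x - N y0|.
    by move=> H1 H2 H3; lra.
  have FA : F x *m A = z *m A.
    move: xT; rewrite /T /N -addrA -[LHS]addr0 => /addrI/esym/eqP.
    by rewrite addrC subr_eq0 => /eqP.
  by apply: (can_inj (mulmxK uA)).
pose G (z : E) : E := xget y0 [set x | `|x - y0| < s /\ F x = z].
have GP z : V' z -> `|G z - y0| < s /\ F (G z) = z.
  by move=> /Bfix[x Hx]; rewrite /G; case: xgetP => [y -> //|/(_ x)].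
have GB z : V' z -> ball y0 r (G z) by move=> /GP[H _]; exact/sr/ltW.
have GU z : V' z -> U (G z) by move=> /GB/Hr[].
have lipG z z' : V' z -> V' z' -> `|G z' - G z| <= 2 * C * `|z' - z|.
  move=> Vz Vz'; have := expF _ _ (GB _ Vz) (GB _ Vz').
  rewrite (GP _ Vz).2 (GP _ Vz').2 => H; apply: (le_trans H).
  by rewrite -mulrA ler_pM2l.
have oV' : open V'.
  have -> : V' = (mulmxr A : E -> E) @^-1` ball (F y0 *m A) (s / 2).
    apply/seteqP; split=> z; rewrite /V' -ball_normE /= mulmxBl distrC//.
  apply: open_comp; last exact: ball_open.
  by move=> z _; exact: continuous_row_mul.
(* Cutting the ball by the preimage of [V'] makes [F] map it onto [V'] exactly. *)
pose U' : set E := ball y0 s `&` F @^-1` V'.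
have U'B x : U' x -> ball y0 r x.
  by move=> [H _]; apply/sr/ltW; move: H; rewrite -ball_normE /= distrC.
have oU' : open U'.
  rewrite openE => x U'x; have [Bx Vx] := U'x; apply: filterI.
    by apply: open_nbhs_nbhs; split=> //; exact: ball_open.
  have /differentiable_continuous := dF x (Hr _ (U'B _ U'x)).1.
  by apply; apply: open_nbhs_nbhs.
have dG z : V' z -> is_diff z G (mulmxr (invmx (J (G z)))).
  move=> Vz; apply: is_diff_eps; first exact: continuous_row_mul.
  move=> e e0; set x := G z; set K : 'M[R]_m := invmx (J x).
  have [C' C'0 HC'] := row_mul_bounded K.
  (* The error of the first-order expansion of [F] at x is multiplied by the inverse Jacobian, at
     cost [C'], and measured by the increment [k] of [G], which is at most 2 C times that of z. *)
  pose e' := e / (C' * (2 * C)).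
  have e'0 : 0 < e' by rewrite divr_gt0// !mulr_gt0.
  have [d d0 Hd] := differentiable_bound_eps (dF x (GU z Vz)) e'0.
  have V'0 : nbhs (0 : E) [set h | V' (h + z)].
    by apply: nbhs_shift0; exact: open_nbhs_nbhs.
  have d1 : 0 < d / (2 * C) by rewrite divr_gt0// mulr_gt0.
  have n1 : nbhs (0 : E) (ball 0 (d / (2 * C))) by exact: nbhsx_ballx.
  apply: filterS2 V'0 n1 => h Vh; rewrite -ball_normE /= sub0r normrN => hd.
  have := lipG _ _ Vz Vh; rewrite addrK -/x => Hk.
  set k := G (h + z) - x in Hk *.
  have kd : `|k| < d.
    apply: le_lt_trans Hk _.
    by rewrite mulrC -ltr_pdivlMr// mulr_gt0.
  have := Hd _ kd; rewrite (GP _ Vh).2 (GP _ Vz).2 addrK.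
  rewrite -deriveE; last exact/dF/GU.
  rewrite DF; last exact: GU.
  rewrite -/k => Hk2.
  have -> : k - h *m K = - ((h - k *m J x) *m K).
    by apply: row_sub_invmx; exact/uJ/GB.
  rewrite normrN (le_trans (HC' _))//.
  apply: (@le_trans _ _ (C' * (e' * (2 * C * `|h|)))).
    rewrite ler_pM2l// (le_trans Hk2)// ler_pM2l//.
  rewrite /e' le_eqVlt; apply/orP; left; apply/eqP; field.
  by rewrite !gt_eqF.
(* Bootstrap: the derivative of [G] is the inverse Jacobian of [F] evaluated along [G], so it
   inherits the class already known for [G]. *)
have sG : smooth V' G.
  elim=> [|k IH]; first by move=> z /dG/@ex_diff/differentiable_continuous.
  split=> [z /dG/@ex_diff//|v].
  apply: (@Ck_eq _ _ _ _ _ (fun z => v *m invmx (J (G z)))) => //.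
    move=> z /set_mem Vz; have [dGz dGv] := dG z Vz.
    by rewrite deriveE// dGv.
  apply: CkP_row => // j.
  have oB : open (ball y0 r) by exact: ball_open.
  apply: (@Ck_comp _ _ _ _ V' (ball y0 r) G (fun x => (v *m invmx (J x)) 0 j)) => //.
    by move=> _ [z Vz <-]; exact: GB.
  apply: (@Ck_mulmx _ _ _ _ _ _ (cst v) (fun x => invmx (J x))) => // i.
    exact: Ck_cst.
  apply: Ck_invmx => // i' j'.
  by apply: Ck_sub (cJ i' j' k) => x /Hr[].
exists U', V', G; split; first split=> //.
- by move=> x /U'B/Hr[].
- by split; [exact: ballxx|rewrite /V' /= subrr mul0mx normr0 divr_gt0].
split=> [x U'x|z Vz].
  have [Bx Vx] := U'x; split=> //; apply/eqP; rewrite -subr_eq0 -normr_le0.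
  apply: le_trans (expF _ _ (U'B _ U'x) (GB _ Vx)) _.
  by rewrite (GP _ Vx).2 subrr mul0mx normr0 mulr0.
have [H1 H2] := GP _ Vz; split=> //; split; last by rewrite /= H2.
by rewrite -ball_normE /= distrC.
Qed.

End inverse_function.

(** * Vector fields in charts *)

Lemma open_subset_nbhs (T : topologicalType) (A : set T) :
  (forall x, A x -> nbhs x A) -> open A.
Proof. by move=> H; rewrite openE => x /H. Qed.

Lemma addrK_sub (V : zmodType) (p q s : V) : p + s - (q + s) = p - q.
Proof. by rewrite opprD addrACA subrr addr0. Qed.

Lemma derive_linearB (R : realType) (V W : normedModType R) (F : V -> W) x v w :
  differentiable F x -> 'D_(v - w) F x = 'D_v F x - 'D_w F x.
Proof. by move=> dF; rewrite !deriveE// linearB. Qed.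

(** A product rule for a linear map [F] that depends on the base point and is applied to a varying
    vector [W]. It serves for the derivative of a change of coordinates applied to a vector
    field. *)
Lemma derive_derive_dep (R : realType) (V : normedModType R) m n
    (W : V -> 'rV[R]_m) (F : 'rV[R]_m -> V -> 'rV[R]_n) (c : 'I_m -> V -> 'rV[R]_n)
    (z a : V) :
  (\forall y \near z, forall w : 'rV[R]_m, F w y = \sum_j w 0 j *: c j y) ->
  differentiable W z -> (forall j, differentiable (c j) z) ->
  'D_a (fun y => F (W y) y) z = F ('D_a W z) z + 'D_a (F (W z)) z.
Proof.
move=> nF dW dc.
have nF1 : \forall y \near z, F (W y) y = \sum_j W y 0 j *: c j y.
  by apply: filterS nF => y; exact.
have nF2 : \forall y \near z, F (W z) y = \sum_j W z 0 j *: c j y.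
  by apply: filterS nF => y; exact.
rewrite (near_eq_derive _ nF1) (near_eq_derive _ nF2) (nbhs_singleton nF).
have dWj j : differentiable (fun y => W y 0 j) z by exact: differentiable_entry.
have dcl j l : differentiable (fun y => c j y 0 l) z by exact: differentiable_entry.
have dWc j : differentiable (fun y => W y 0 j *: c j y) z.
  apply: differentiable_rowP => l.
  have -> : (fun y => (W y 0 j *: c j y) 0 l) =
      (fun y => W y 0 j) * (fun y => c j y 0 l).
    by apply/funext => y; rewrite mxE.
  exact: differentiableM.
have dwc j : differentiable (fun y => W z 0 j *: c j y) z.
  exact: differentiableZ.
have Es (h : 'I_m -> V -> 'rV[R]_n) :
    (fun y => \sum_j h j y) = \sum_j h j.
  by apply/funext => y; rewrite fct_sumE.
rewrite !Es !derive_sum; try by move=> j; exact: diff_derivable.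
rewrite -big_split; apply: eq_bigr => j _ /=.
apply/rowP => l.
rewrite [RHS]mxE [X in X + _]mxE derive_entry// [X in _ = X + _]mulrC.
rewrite [X in _ = _ + X]derive_entry// derive_entry//.
have -> : (fun y => (W y 0 j *: c j y) 0 l) =
      (fun y => W y 0 j) * (fun y => c j y 0 l).
  by apply/funext => y; rewrite mxE.
have -> : (fun y => (W z 0 j *: c j y) 0 l) =
      W z 0 j *: (fun y => c j y 0 l).
  by apply/funext => y; rewrite mxE.
rewrite deriveM; try exact: diff_derivable.
rewrite deriveZ; last exact: diff_derivable.
by rewrite addrC.
Qed.

Section charts.
Context {R : realType} {m : nat} {M : manifold R m}.
Local Notation E := 'rV[R]_m.
Implicit Types (i j k : chart M) (x : M) (v w : M -> E).

Lemma par_dom i (y : E) : (crd i @` dom i) y ->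
  dom i (par i y) /\ crd i (par i y) = y.
Proof. by move=> [x ix <-]; rewrite crdK. Qed.

Lemma nbhs_par i x (A : set M) : dom i x -> nbhs x A ->
  nbhs (crd i x) [set y | A (par i y)].
Proof.
move=> ix; rewrite -{1}(crdK ix) => nA.
exact: (par_continuous ix nA).
Qed.

Lemma nbhs_chart_image i x (A : set M) : dom i x -> open A -> A x ->
  nbhs (crd i x) (crd i @` (dom i `&` A)).
Proof.
move=> ix oA Ax.
have n1 : nbhs (crd i x) (crd i @` dom i).
  by apply: open_nbhs_nbhs; split; [exact: crd_open|exists x].
have n2 := nbhs_par ix (open_nbhs_nbhs (conj oA Ax)).
apply: filterS2 n1 n2 => y /par_dom[iy yE] Ay.
by exists (par i y).
Qed.

Lemma open_chart_image i (A : set M) : open A ->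
  open (crd i @` (dom i `&` A)).
Proof.
move=> oA; apply: open_subset_nbhs => _ [x [ix Ax] <-].
exact: nbhs_chart_image.
Qed.

Lemma transition_differentiable i j x : dom i x -> dom j x ->
  differentiable (crd j \o par i) (crd i x).
Proof.
move=> ix jx; have := @transition_smooth _ _ M i j 1.
by move=> /Ck_differentiable; apply; exists x.
Qed.

Lemma transition_chain i j k x (u : E) : dom i x -> dom j x -> dom k x ->
  'D_('D_u (crd j \o par i) (crd i x)) (crd k \o par j) (crd j x) =
  'D_u (crd k \o par i) (crd i x).
Proof.
move=> ix jx kx.
have dji := transition_differentiable ix jx.
have xE : crd j x = (crd j \o par i) (crd i x) by rewrite /= crdK.
have dkj : differentiable (crd k \o par j) ((crd j \o par i) (crd i x)).
  by rewrite -xE; exact: transition_differentiable.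
rewrite [X in 'D__ _ X]xE -derive_comp//; apply: near_eq_derive.
have := nbhs_chart_image ix (dom_open j) jx.
by apply: filterS => _ [x' [ix' jx'] <-] /=; rewrite crdK// crdK.
Qed.

Lemma transition_id i x (u : E) : dom i x ->
  'D_u (crd i \o par i) (crd i x) = u.
Proof.
move=> ix; rewrite -[RHS](derive_id (crd i x) u); apply: near_eq_derive.
have : nbhs (crd i x) (crd i @` dom i).
  by apply: open_nbhs_nbhs; split; [exact: crd_open|exists x].
by apply: filterS => _ [x' ix' <-] /=; rewrite crdK.
Qed.

Lemma transition_inj i j x (u : E) : dom i x -> dom j x ->
  'D_u (crd j \o par i) (crd i x) = 0 -> u = 0.
Proof.
move=> ix jx u0; have := transition_chain u ix jx ix.
rewrite u0 transition_id// => <-.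
by rewrite deriveE ?linear0//; exact: transition_differentiable.
Qed.

Lemma local_repE i v x : dom i x -> local_rep i v (crd i x) =
  'D_(v x) (crd i \o par (chart_at M x)) (crd (chart_at M x) x).
Proof.
move=> ix; rewrite /local_rep crdK// deriveE//.
by apply: transition_differentiable => //; exact: dom_chart_at.
Qed.

Lemma local_rep_chart_at v x :
  local_rep (chart_at M x) v (crd (chart_at M x) x) = v x.
Proof.
by rewrite local_repE ?transition_id//; exact: dom_chart_at.
Qed.

Lemma local_rep_change i j v x : dom i x -> dom j x ->
  local_rep j v (crd j x) =
  'D_(local_rep i v (crd i x)) (crd j \o par i) (crd i x).
Proof.
move=> ix jx; rewrite !local_repE// transition_chain//.
exact: dom_chart_at.
Qed.

Lemma local_rep_linear i (a : R) v w y :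
  local_rep i (a *: v + w) y = a *: local_rep i v y + local_rep i w y.
Proof. by rewrite /local_rep -linearP. Qed.

Lemma local_rep0 i y : local_rep i (0 : M -> E) y = 0.
Proof. by rewrite /local_rep linear0. Qed.

Lemma local_repZ i (a : R) v y : local_rep i (a *: v) y = a *: local_rep i v y.
Proof. by rewrite /local_rep -linearZ. Qed.

Lemma local_rep_eq0 i v x : dom i x ->
  local_rep i v (crd i x) = 0 <-> v x = 0.
Proof.
move=> ix; rewrite local_repE//; split=> [|->].
  by apply: transition_inj => //; exact: dom_chart_at.
rewrite deriveE ?linear0//; apply: transition_differentiable => //.
exact: dom_chart_at.
Qed.

(** [bracket] uses at each point the preferred chart of that point; this is its counterpart, with
    the same sign, inside one fixed chart. *)
Definition lie_derivative (V W : E -> E) (y : E) : E :=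
  'D_(V y) W y - 'D_(W y) V y.

(* The second derivatives of the change of coordinates cancel by symmetry. *)
Lemma local_rep_bracket i v w x : smooth_vfield v -> smooth_vfield w ->
  dom i x -> local_rep i (bracket v w) (crd i x) =
  lie_derivative (local_rep i v) (local_rep i w) (crd i x).
Proof.
move=> sv sw ix; pose k := chart_at M x.
have kx : dom k x by exact: dom_chart_at.
pose z := crd k x; pose tau := crd i \o par k.
pose Z := crd k @` (dom k `&` dom i).
have oZ : open Z by apply: open_chart_image; exact: dom_open.
have Zz : Z z by exists x.
have cT : smooth Z tau by exact: transition_smooth.
have dT y : Z y -> differentiable tau y by exact: Ck_differentiable (cT 1%N).
have tz : tau z = crd i x by rewrite /tau /= crdK.
have dl l h y : smooth_vfield h -> (crd l @` dom l) y ->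
    differentiable (local_rep l h) y.
  by move=> sh; exact: Ck_differentiable (sh l 1%N).
have lk h : local_rep k h z = h x by exact: local_rep_chart_at.
(* On the overlap, [local_rep i w1] composed with [tau] is the derivative of [tau] applied to
   [local_rep k w1]. Differentiating along [v1] gives a transported first-order term and a second
   derivative of [tau], the latter symmetric in [v1] and [w1]. *)
have key v1 w1 : smooth_vfield v1 -> smooth_vfield w1 ->
    'D_(local_rep i v1 (crd i x)) (local_rep i w1) (crd i x) =
    'D_('D_(v1 x) (local_rep k w1) z) tau z + 'D_(v1 x) ('D_(w1 x) tau) z.
  move=> sv1 sw1.
  have dw : differentiable (local_rep k w1) z by apply: dl => //; exists x.
  rewrite (local_rep_change v1 kx ix) -/z -/tau lk -tz.
  rewrite -derive_comp; [|exact: dT|]; last first.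
    by rewrite tz; apply: dl => //; exists x.
  have nE : \forall y \near z, (local_rep i w1 \o tau) y =
      'D_(local_rep k w1 y) tau y.
    apply: filterS (open_nbhs_nbhs (conj oZ Zz)) => _ [x' [kx' ix'] <-].
    by rewrite -local_rep_change// /tau /= crdK.
  rewrite (near_eq_derive _ nE).
  rewrite (@derive_derive_dep _ _ _ _ (local_rep k w1) (fun u y => 'D_u tau y)
    (fun l y => 'D_(delta_mx 0 l) tau y)).
  - by rewrite lk.
  - apply: filterS (open_nbhs_nbhs (conj oZ Zz)) => y Zy u.
    by rewrite derive_row//; exact: dT.
  - exact: dw.
  - by move=> l; exact: Ck_differentiable (Ck_derive _ (cT 2%N)) Zz.
have BE : bracket v w x =
    'D_(v x) (local_rep k w) z - 'D_(w x) (local_rep k v) z.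
  have dk h : smooth_vfield h -> differentiable (local_rep k h) z.
    by move=> sh; apply: dl => //; exists x.
  by rewrite !deriveE//; exact: dk.
rewrite (local_repE _ ix) BE /lie_derivative.
rewrite (key v w sv sw) (key w v sw sv).
rewrite (derive_swap_row (v x) (w x) oZ Zz (cT 2%N)).
apply: etrans (esym (addrK_sub _ _ _)).
exact: derive_linearB (dT z Zz).
Qed.

End charts.

(** * Flows of symmetries *)

Section derivatives_along_lines.
Context {R : realType}.

Lemma derive_line0 (V W : normedModType R) (F : V -> W) a v :
  'D_v F a = 'D_1 (fun h : R => F (h *: v + a)) 0.
Proof.
rewrite /derive; set g1 := fun h => h^-1 *: _; set g2 := fun h => h^-1 *: _.
suff -> : g1 = g2 by [].
by apply/funext => h; rewrite /g1 /g2 /= addr0 scale0r add0r [_%:A]mulr1.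
Qed.

(** A directional derivative sees only the restriction to a line, so derivatives of functions on
    different spaces can be compared. This passes between R x E, where flows live, and its two
    factors. *)
Lemma derive_along (V V' W : normedModType R) (F : V -> W) (F' : V' -> W)
    a v a' v' :
  (\forall h \near (0 : R), F (h *: v + a) = F' (h *: v' + a')) ->
  'D_v F a = 'D_v' F' a'.
Proof.
by move=> FF'; rewrite [LHS]derive_line0 [RHS]derive_line0; exact: near_eq_derive.
Qed.

Lemma eq_derive_along (V V' W : normedModType R) (F : V -> W) (F' : V' -> W)
    a v a' v' :
  (forall h : R, F (h *: v + a) = F' (h *: v' + a')) ->
  'D_v F a = 'D_v' F' a'.
Proof.
move=> FF'; rewrite [LHS]derive_line0 [RHS]derive_line0.
by congr derive; exact/funext.
Qed.

Lemma nbhs_line (V : normedModType R) (P : set V) a v : nbhs a P ->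
  nbhs (0 : R) [set h : R | P (h *: v + a)].
Proof.
have : (fun h : R => h *: v + a) @ 0 --> a.
  rewrite -[X in _ --> X]add0r; apply: cvgD; last exact: cvg_cst.
  by rewrite -(scale0r v); apply: scalel_continuous.
by move=> H /H.
Qed.

Lemma nbhs_sub (T : topologicalType) (x : T) (P Q : set T) :
  nbhs x P -> P `<=` Q -> nbhs x Q.
Proof. by move=> nP PQ; exact: filterS nP. Qed.

Lemma nbhs_pairl (T T' : topologicalType) (a : T) (b : T') (P : set (T * T')) :
  nbhs (a, b) P -> nbhs a [set t | P (t, b)].
Proof.
have : (fun t : T => (t, b)) @ a --> (a, b).
  by apply: cvg_pair; [exact: cvg_id|exact: cvg_cst].
by move=> H /H.
Qed.

Lemma nbhs_pairr (T T' : topologicalType) (a : T) (b : T') (P : set (T * T')) :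
  nbhs (a, b) P -> nbhs b [set t | P (a, t)].
Proof.
have : (fun t : T' => (a, t)) @ b --> (a, b).
  by apply: cvg_pair; [exact: cvg_cst|exact: cvg_id].
by move=> H /H.
Qed.

(* Differentiate the identities p_i q_j = p_j q_i at a zero of p. *)
Lemma parallel_derive n (p q : R -> 'rV[R]_n) : differentiable p 0 ->
  differentiable q 0 -> p 0 = 0 -> q 0 != 0 ->
  (\forall t \near (0 : R), exists a : R, p t = a *: q t) ->
  exists c : R, 'D_1 p 0 = c *: q 0.
Proof.
move=> dp dq p0 q0 pq.
have [j qj] : exists j, q 0 0 j != 0.
  apply/existsP; apply: contraR q0 => /existsPn H; apply/eqP/rowP => j.
  by rewrite mxE; apply/eqP; have := H j; rewrite negbK.
have dpl l : derivable (fun t => p t 0 l) 0 1.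
  by apply: diff_derivable; exact: differentiable_entry.
have dql l : derivable (fun t => q t 0 l) 0 1.
  by apply: diff_derivable; exact: differentiable_entry.
have key l : ('D_1 p 0) 0 l * q 0 0 j = ('D_1 p 0) 0 j * q 0 0 l.
  have E : 'D_1 ((fun t => p t 0 l) * (fun t => q t 0 j)) 0 =
           'D_1 ((fun t => p t 0 j) * (fun t => q t 0 l)) 0.
    apply: near_eq_derive; apply: filterS pq => t [a pa].
    by rewrite !fctE pa !mxE; ring.
  have z l' : p 0 0 l' = 0 by rewrite p0 mxE.
  rewrite !deriveM// !z !scale0r !add0r in E.
  by rewrite !derive_entry// [LHS]mulrC [RHS]mulrC.
exists (('D_1 p 0) 0 j / q 0 0 j); apply/rowP => l; rewrite mxE.
by apply: (mulIf qj); rewrite key mulrAC divfK.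
Qed.

End derivatives_along_lines.

Section flows.
Context {R : realType} {m : nat} {M : manifold R m}.
Local Notation E := 'rV[R]_m.
Variables (v : M -> E) (D : set (R * M)) (gam : R -> M -> M).
Hypothesis gamP : is_flow v D gam.
Implicit Types (i k : chart M) (x : M).

(** Spelled as the domain in [flow_smooth] with both charts equal to [i], so that smoothness of
    [flow_chart] is an instance of that field. *)
Definition flow_chart_dom i : set (R * E) := [set q | [/\ (crd i @` dom i) q.2,
  D (q.1, par i q.2) & dom i (gam q.1 (par i q.2))]].

Definition flow_chart i (q : R * E) : E := crd i (gam q.1 (par i q.2)).

Lemma flow_chart_dom0 i (y : E) : (crd i @` dom i) y -> flow_chart_dom i (0, y).
Proof.
move=> Yy; have [iy _] := par_dom Yy.
by split=> //=; [exact: flow_dom0 gamP _|rewrite (flow0 gamP)].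
Qed.

Lemma flow_chart0 i (y : E) : (crd i @` dom i) y -> flow_chart i (0, y) = y.
Proof. by move=> /par_dom[_]; rewrite /flow_chart /= (flow0 gamP). Qed.

Lemma open_flow_chart_dom i : open (flow_chart_dom i).
Proof.
apply: open_subset_nbhs => -[t y] [/= Yy Dty igam].
have [iy yE] := par_dom Yy.
have hc : (fun q : R * E => (q.1, par i q.2)) @ (t, y) --> (t, par i y).
  apply: (@cvg_pair _ _ _ _ (nbhs t) (nbhs (par i y))).
    exact: (@cvg_fst _ _ (nbhs t) (nbhs y)).
  apply: (@cvg_comp _ _ _ snd (par i)).
    exact: (@cvg_snd _ _ (nbhs t) (nbhs y)).
  by have := par_continuous iy; rewrite yE.
have n1 : nbhs (t, y) [set q : R * E | (crd i @` dom i) q.2].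
  have := @cvg_snd _ _ (nbhs t) (nbhs y) _.
  by apply; apply: open_nbhs_nbhs; split=> //; exact: crd_open.
have n2 : nbhs (t, y) [set q : R * E | D (q.1, par i q.2)].
  by apply: hc; apply: open_nbhs_nbhs; split=> //; exact: flow_open gamP.
have n3 : nbhs (t, y) [set q : R * E | dom i (gam q.1 (par i q.2))].
  have nD : nbhs (t, par i y) [set q : R * M | dom i (gam q.1 q.2)].
    have := flow_continuous gamP Dty.
    by apply; apply: open_nbhs_nbhs; split=> //; exact: dom_open.
  exact: (hc _ nD).
by apply: filterS3 n1 n2 n3 => -[t' y'] /= ? ? ?; split.
Qed.

(** An integral curve satisfies its equation in the preferred chart of each point; the transition
    map carries the velocity at time 0 into [i]. *)
Lemma flow_chart_derive0 i (y : E) : (crd i @` dom i) y ->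
  'D_(1, 0) (flow_chart i) (0, y) = local_rep i v y.
Proof.
move=> Yy; have [iy yE] := par_dom Yy; set x := par i y in iy yE *.
have -> : 'D_(1, 0) (flow_chart i) (0, y) =
    'D_1 (fun t => flow_chart i (t, y)) (0 : R).
  apply: eq_derive_along => h.
  by congr flow_chart; congr pair; rewrite /= scaler0 add0r.
have [] := flow_integral gamP (flow_dom0 gamP x).
rewrite /= (flow0 gamP); set k := chart_at M x => cc [dk Dk].
have kx : dom k x by exact: dom_chart_at.
have nE : \forall t \near (0 : R), flow_chart i (t, y) =
    ((crd i \o par k) \o (crd k \o gam^~ x)) t.
  have n1 : nbhs (0 : R) [set t | dom k (gam t x)].
    apply: cc; apply: open_nbhs_nbhs; split; first exact: dom_open.
    by rewrite (flow0 gamP).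
  by apply: (nbhs_sub n1) => t kt; rewrite /flow_chart /= -/x crdK.
rewrite (near_eq_derive _ nE) derive_comp; first last.
- rewrite /= (flow0 gamP); exact: transition_differentiable.
- exact/derivable1_diffP.
by rewrite Dk /= (flow0 gamP) -[in RHS]yE local_repE.
Qed.

(** [tangent_map] ends in the preferred chart at [gam t x], which may jump with [t]. Transported
    into the fixed chart [i], it becomes a spatial derivative of [flow_chart i], which can be
    differentiated in time. *)
Lemma flow_chart_tangent i (t : R) (y : E) (h : M -> E) :
  flow_chart_dom i (t, y) ->
  'D_(0, local_rep i h y) (flow_chart i) (t, y) =
  let x := par i y in let k := chart_at M (gam t x) in
  'D_(tangent_map (gam t) x (h x)) (crd i \o par k) (crd k (gam t x)).
Proof.
move=> [/= Yy Dty igam]; have [iy yE] := par_dom Yy.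
set x := par i y in iy yE igam Dty *; set x' := gam t x in igam *.
set k' := chart_at M x'; pose k := chart_at M x.
have kx : dom k x by exact: dom_chart_at.
have kx' : dom k' x' by exact: dom_chart_at.
pose Phi := crd k' \o gam t \o par k.
have -> : 'D_(0, local_rep i h y) (flow_chart i) (t, y) =
    'D_(local_rep i h y) (fun z => flow_chart i (t, z)) y.
  apply: eq_derive_along => s.
  by congr flow_chart; congr pair; rewrite /= scaler0 add0r.
have nE : \forall z \near y, flow_chart i (t, z) =
    ((crd i \o par k') \o (Phi \o (crd k \o par i))) z.
  have n1 : nbhs y [set z | dom k (par i z)].
    rewrite -{1}yE; apply: nbhs_par => //.
    by apply: open_nbhs_nbhs; split=> //; exact: dom_open.
  have n2 : nbhs y [set z | dom k' (gam t (par i z))].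
    rewrite -{1}yE; apply: (@nbhs_par _ _ _ _ _ [set z | dom k' (gam t z)]) => //.
    apply: (@nbhs_pairr _ _ t x [set q : R * M | dom k' (gam q.1 q.2)]).
    have := flow_continuous gamP Dty.
    by apply; apply: open_nbhs_nbhs; split=> //; exact: dom_open.
  apply: filterS2 n1 n2 => z kz kz'.
  by rewrite /flow_chart /Phi /= crdK// crdK.
rewrite (near_eq_derive _ nE).
have dB : differentiable (crd k \o par i) y.
  by rewrite -yE; exact: transition_differentiable.
have By : (crd k \o par i) y = crd k x by [].
have dPhi : differentiable Phi (crd k x).
  have := flow_smooth gamP k k' 1 => -[+ _].
  move=> /(_ (t, crd k x)); rewrite /= crdK// => dG.
  apply: (@differentiable_comp _ _ _ _ (fun z : E => (t, z))
    (fun q : R * E => crd k' (gam q.1 (par k q.2)))).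
    exact: differentiable_pair.
  by apply: dG; split=> //; exists x.
have PhiE : Phi (crd k x) = crd k' x' by rewrite /Phi /= crdK.
have dA : differentiable (crd i \o par k') (crd k' x').
  exact: transition_differentiable.
have dPB' : differentiable Phi ((crd k \o par i) y) by rewrite By.
have dPB : differentiable (Phi \o (crd k \o par i)) y.
  exact: differentiable_comp.
have PB : (Phi \o (crd k \o par i)) y = crd k' x' by exact: PhiE.
have dA' : differentiable (crd i \o par k') ((Phi \o (crd k \o par i)) y).
  by rewrite PB.
rewrite (derive_comp _ dPB dA') PB (derive_comp _ dB dPB').
have wE : 'D_(local_rep i h y) (crd k \o par i) y = h x.
  by rewrite -[in RHS]local_rep_chart_at (local_rep_change _ iy kx) yE.
rewrite wE By.
have -> : 'D_(h x) Phi (crd k x) = tangent_map (gam t) x (h x).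
  by rewrite deriveE.
by [].
Qed.

(** [p t] compares, at the point [gam t x], the vector [h x] transported by the flow with the value
    of [h] there. Transport is the spatial derivative of the flow, and the second term is [h] along
    the flow line, so the derivative at time 0 is minus [v, h]. *)
Lemma flow_lie i x (h : M -> E) : smooth_vfield h -> dom i x ->
  exists p : R -> E, [/\ differentiable p 0, p 0 = 0,
    'D_1 p 0 = - lie_derivative (local_rep i v) (local_rep i h) (crd i x) &
    \forall t \near (0 : R), [/\ D (t, x), dom i (gam t x) &
      let k := chart_at M (gam t x) in
      p t = 'D_(tangent_map (gam t) x (h x)) (crd i \o par k) (crd k (gam t x))
            - local_rep i h (crd i (gam t x))]].
Proof.
move=> sh ix; set y := crd i x; set H := local_rep i h.
have Yy : (crd i @` dom i) y by exists x.
have xE : par i y = x by exact: crdK.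
set S := flow_chart_dom i; set G := flow_chart i.
have oS : open S by exact: open_flow_chart_dom.
have S0 : S (0, y) by exact: flow_chart_dom0.
have sG : smooth S G by exact: (flow_smooth gamP).
have dpair : differentiable (fun t : R => (t, y)) 0 by exact: differentiable_pair.
pose p t := 'D_(0, H y) G (t, y) - H (G (t, y)).
have G0 : G (0, y) = y by exact: flow_chart0.
have nS : nbhs (0 : R) [set t | S (t, y)].
  by apply: nbhs_pairl; exact: open_nbhs_nbhs.
have dDG : differentiable ('D_(0, H y) G) (0, y).
  exact: Ck_differentiable (Ck_derive _ (sG 2%N)) S0.
have dG : differentiable G (0, y) by exact: Ck_differentiable (sG 1%N) S0.
have dH : differentiable H y by exact: Ck_differentiable (sh i 1%N) Yy.
have d1 : differentiable (fun t : R => 'D_(0, H y) G (t, y)) 0.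
  exact: (@differentiable_comp _ _ _ _ (fun t : R => (t, y)) ('D_(0, H y) G)).
have d2 : differentiable (fun t : R => H (G (t, y))) 0.
  apply: (@differentiable_comp _ _ _ _ (fun t : R => (t, y)) (H \o G)) => //.
  by apply: differentiable_comp => //; rewrite G0.
have nY (w : E) : \forall s \near (0 : R), (crd i @` dom i) (s *: w + y).
  by apply: nbhs_line; apply: open_nbhs_nbhs; split=> //; exact: crd_open.
have pairE (s : R) (w : E) : s *: ((0, w) : R * E) + (0, y) = (0, s *: w + y).
  by congr pair; rewrite /= scaler0 add0r.
have pairE1 (s : R) : s *: ((1, 0) : R * E) + (0, y) = (s *: 1 + 0, y).
  by congr pair; rewrite /= scaler0 add0r.
have p0 : p 0 = 0.
  rewrite /p G0; apply/eqP; rewrite subr_eq0; apply/eqP.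
  rewrite -[RHS](derive_id y); apply: derive_along.
  by apply: (nbhs_sub (nY (H y))) => s Ys; rewrite pairE; exact: flow_chart0.
exists p; split=> //; first exact: differentiableB.
  have -> : 'D_1 p 0 = 'D_1 (fun t : R => 'D_(0, H y) G (t, y)) 0 -
      'D_1 (fun t : R => H (G (t, y))) 0.
    by apply: deriveB; exact: diff_derivable.
  rewrite /lie_derivative opprB; congr (_ - _).
    have -> : 'D_1 (fun t : R => 'D_(0, H y) G (t, y)) 0 =
        'D_(1, 0) ('D_(0, H y) G) (0, y).
      apply: eq_derive_along => s.
      by rewrite pairE1.
    (* After exchanging time and space, the inner derivative is the time derivative of the flow at
       0, that is, [v] itself. *)
    rewrite (derive_swap_row _ _ oS S0 (sG 2%N)); apply: derive_along.
    apply: (nbhs_sub (nY (H y))) => s Ys.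
    by rewrite pairE; exact: flow_chart_derive0.
  have -> : 'D_1 (fun t : R => H (G (t, y))) 0 = 'D_(1, 0) (H \o G) (0, y).
    apply: eq_derive_along => s.
    by rewrite pairE1.
  rewrite derive_comp//; last by rewrite G0.
  by rewrite G0 flow_chart_derive0.
apply: (nbhs_sub nS) => t St; have [/= _ Dt it] := St; rewrite xE in Dt it.
split=> //; rewrite /p (flow_chart_tangent h St) /=.
by rewrite /G /flow_chart /= xE.
Qed.

End flows.

Section symmetries.
Context {R : realType} {m : nat} {M : manifold R m}.
Local Notation E := 'rV[R]_m.
Variables (f g v : M -> E).
Hypotheses (sf : smooth_vfield f) (sg : smooth_vfield g).
Hypothesis symv : infinitesimal_symmetry f g v.

Lemma transition_repE i (h : M -> E) x (a : R) : dom i x ->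
  'D_(h x + a *: g x) (crd i \o par (chart_at M x)) (crd (chart_at M x) x) =
  local_rep i h (crd i x) + a *: local_rep i g (crd i x).
Proof.
move=> ix; rewrite !local_repE// addrC derive_linear 1?addrC//.
by apply: transition_differentiable => //; exact: dom_chart_at.
Qed.

(** Invariance of the affine line makes the transported [h] differ from [h] by a multiple of [g]:
    directly for [f], and for [g] as the difference of the images of [f + g] and [f]. As [g x] is
    nonzero, [parallel_derive] turns this into a statement on the derivative at time 0. *)
Lemma symmetry_lie i x (h : M -> E) : h = f \/ h = g -> dom i x -> g x != 0 ->
  exists c : R, lie_derivative (local_rep i v) (local_rep i h) (crd i x) =
    c *: local_rep i g (crd i x).
Proof.
move=> hfg ix gx; have [sv [D [gam [gamP sym]]]] := symv.
have sh : smooth_vfield h by case: hfg => ->.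
have tan t : D (t, x) -> exists a : R,
    tangent_map (gam t) x (h x) = h (gam t x) + a *: g (gam t x).
  move=> Dt; have H := sym t x Dt.
  have [a _ Ea] : (affine_distribution f g (gam t x)) (tangent_map (gam t) x (f x)).
    by rewrite -H; exists (f x) => //; exists 0 => //; rewrite scale0r addr0.
  have [b _ Eb] : (affine_distribution f g (gam t x))
      (tangent_map (gam t) x (f x + g x)).
    by rewrite -H; exists (f x + g x) => //; exists 1 => //; rewrite scale1r.
  case: hfg => ->; first by exists a.
  exists (b - a - 1); rewrite !scalerBl scale1r addrC subrK.
  have : tangent_map (gam t) x (f x + g x) =
      tangent_map (gam t) x (f x) + tangent_map (gam t) x (g x).
    exact: linearD.
  rewrite -Ea -Eb -addrA => /addrI ->.
  by rewrite addrAC subrr add0r.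
have [p [dp p0 Dp np]] := flow_lie gamP sh ix.
pose q t := local_rep i g (crd i (gam t x)).
have Yx : (crd i @` dom i) (crd i x) by exists x.
have q0 : q 0 = local_rep i g (crd i x) by rewrite /q (flow0 gamP).
have qE : q = (local_rep i g \o flow_chart gam i) \o (fun t : R => (t, crd i x)).
  by apply/funext => t; rewrite /q /flow_chart /= crdK.
have dq : differentiable q 0.
  rewrite qE; apply: differentiable_comp; first exact: differentiable_pair.
  apply: differentiable_comp.
    apply: (Ck_differentiable (flow_smooth gamP i i 1)).
    exact: (flow_chart_dom0 gamP).
  rewrite (flow_chart0 gamP)//.
  exact: Ck_differentiable (sg i 1%N) Yx.
have q0n : q 0 != 0.
  by rewrite q0; apply: contra_neq gx => /(local_rep_eq0 _ ix).
have npq : \forall t \near (0 : R), exists a : R, p t = a *: q t.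
  apply: (nbhs_sub np) => t [Dt it Et]; have [a Ea] := tan t Dt.
  by exists a; rewrite Et Ea transition_repE// addrC addKr.
have [c Dc] := parallel_derive dp dq p0 q0n npq.
exists (- c); rewrite scaleNr -q0 -Dc Dp opprK.
by [].
Qed.

Lemma symmetry_lie0 i x : dom i x -> g x = 0 ->
  lie_derivative (local_rep i v) (local_rep i f) (crd i x) = 0.
Proof.
move=> ix gx; have [sv [D [gam [gamP sym]]]] := symv.
have tan t : D (t, x) -> tangent_map (gam t) x (f x) = f (gam t x).
  move=> Dt; have H := sym t x Dt.
  have : (affine_distribution f g (gam t x)) (f (gam t x)).
    by exists 0 => //; rewrite scale0r addr0.
  by rewrite -H => -[_ [a _ <-] <-]; rewrite gx scaler0 addr0.
have [p [dp p0 Dp np]] := flow_lie gamP sf ix.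
apply/eqP; rewrite -oppr_eq0 -Dp; apply/eqP.
rewrite -[RHS](derive_cst (0 : E) 0 (1 : R)); apply: near_eq_derive.
apply: (nbhs_sub np) => t [Dt it ->]; rewrite tan//.
have := transition_repE f 0 it; rewrite !scale0r !addr0 => ->.
by rewrite subrr.
Qed.

End symmetries.

(** * Uniqueness of symmetries *)

Section vanishing.
Context {R : realType} {m : nat}.
Local Notation E := 'rV[R]_m.

(** A Gronwall estimate without exponentials: within distance 1/(2 C) of [y], the mean value
    inequality from [y] to the point where the norm of [U] is largest on a segment bounds that
    maximum by half of itself. *)
Lemma gronwall_vanish (U : E -> E) (y : E) (r C : R) : 0 < r -> 0 < C ->
  (forall z, ball y r z -> differentiable U z) ->
  (forall z h, ball y r z -> `|'D_h U z| <= C * `|h| * `|U z|) ->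
  U y = 0 -> nbhs y [set z | U z = 0].
Proof.
move=> r0 C0 dU HU Uy; pose s := Num.min r (2 * C)^-1.
have s0 : 0 < s by rewrite lt_min r0 invr_gt0 mulr_gt0.
have sr : s <= r by rewrite /s ge_min lexx.
have sC : C * s <= 2^-1.
  apply: (@le_trans _ _ (C * (2 * C)^-1)).
    by rewrite ler_pM2l// /s ge_min lexx orbT.
  by rewrite invfM mulrCA mulfV ?gt_eqF// mulr1.
suff H z : ball y s z -> U z = 0.
  by apply/nbhs_ballP; exists s => //= z /H.
move=> yz.
have Bz (t : R) : 0 <= t <= 1 -> ball y s (t *: (z - y) + y).
  by move=> t01; apply: ball_segment => //; exact: ballxx.
have Bzr (t : R) : 0 <= t <= 1 -> ball y r (t *: (z - y) + y).
  by move=> /Bz; exact: le_ball.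
have cN : {within `[0, 1], continuous (fun t : R => `|U (t *: (z - y) + y)|)}.
  apply: continuous_in_subspaceT => t; rewrite inE/= in_itv/= => t01.
  apply: (@continuous_comp _ _ _ (fun t : R => U (t *: (z - y) + y)) (fun u : E => `|u|)).
    have := is_derive_line (dU _ (Bzr _ t01)) => -[dl _].
    by apply: differentiable_continuous; exact/derivable1_diffP.
  exact: norm_continuous.
have [c /itvP cI Hc] := EVT_max ler01 cN.
have c01 : 0 <= c <= 1 by rewrite !cI.
set S := `|U (c *: (z - y) + y)| in Hc.
have S0 : 0 <= S by exact: normr_ge0.
set x := c *: (z - y) + y in S S0 Hc *.
have xy : `|x - y| < s.
  by have := Bz _ c01; rewrite -ball_normE /= distrC.
have SS : S <= 2^-1 * S.
  have := @mean_value_le _ _ _ U y x (2^-1 * S).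
  rewrite Uy subr0; apply=> a /andP[a0 a1].
    rewrite /x addrK scalerA; apply/dU/Bzr; case/andP: c01 => c0 c1.
    by rewrite mulr_ge0//= mulr_ile1.
  have ac01 : 0 <= a * c <= 1.
    by case/andP: c01 => c0 c1; rewrite mulr_ge0//= mulr_ile1.
  have axE : a *: (x - y) + y = (a * c) *: (z - y) + y by rewrite /x addrK scalerA.
  rewrite axE; apply: le_trans (HU _ _ (Bzr _ ac01)) _.
  apply: ler_pM => //; first by rewrite mulr_ge0// ltW.
    by apply: le_trans sC; rewrite ler_pM2l// ltW.
  by apply: Hc; rewrite in_itv.
have S00 : S <= 0 by lra.
apply/eqP; rewrite -normr_le0; apply: le_trans S00.
have := Hc 1; rewrite scale1r subrK; apply.
by rewrite in_itv/= ler01 lexx.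
Qed.

Lemma norm_le_dist (u w N e : R) : `|u - w| <= e -> `|u| <= N -> `|w| <= N + e.
Proof.
move=> uw uN; rewrite -(subKr u w) (le_trans (ler_normB _ _))//.
exact: lerD.
Qed.

(* The derivatives along the constant frame are controlled by those along the
   nearby frame X, in which the equation bounds them by U. *)
Lemma frame_vanish (Y : set E) (X : 'I_m -> E -> E) (c : 'I_m -> R)
    (U : E -> E) (y : E) : open Y -> Y y ->
  (forall j, smooth Y (X j)) -> smooth Y U -> (forall j, X j y = delta_mx 0 j) ->
  (forall z j, Y z -> 'D_(X j z) U z = 'D_(U z) (X j) z + c j *: U z) ->
  U y = 0 -> nbhs y [set z | U z = 0].
Proof.
move=> oY Yy sX sU Xy HU Uy.
have dU z : Y z -> differentiable U z by exact: Ck_differentiable (sU 1%N).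
have dX j z : Y z -> differentiable (X j) z by exact: Ck_differentiable (sX j 1%N).
(* Then m eps <= 1/2, so after summation over [j] the error of replacing [X j z] by the constant
   vector [X j y] is at most half of [S] and can be absorbed. *)
pose eps : R := (2 * m.+1%:R)^-1.
have eps0 : 0 < eps by rewrite invr_gt0 mulr_gt0.
have [r r0 Hr] : exists2 r : R, 0 < r & forall z, ball y r z -> [/\ Y z,
    forall j l, `|X j y 0 l - X j z 0 l| <= eps &
    forall j p l, `|('D_(delta_mx 0 p) (X j) y) 0 l -
                    ('D_(delta_mx 0 p) (X j) z) 0 l| <= 1].
  have n1 : nbhs y (Y `&` ([set z | forall j l, `|X j y 0 l - X j z 0 l| <= eps]
    `&` [set z | forall j p l, `|('D_(delta_mx 0 p) (X j) y) 0 l -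
                    ('D_(delta_mx 0 p) (X j) z) 0 l| <= 1])).
    apply: filterI; first exact: open_nbhs_nbhs.
    apply: filterI.
      apply: nbhs_forall => j; apply: nbhs_forall => l.
      exact: continuous_nbhs_le (Ck_entry l oY (sX j 0%N) y Yy) eps0.
    apply: nbhs_forall => j; apply: nbhs_forall => p; apply: nbhs_forall => l.
    apply: continuous_nbhs_le ltr01.
    exact: (Ck_entry l oY (Ck_derive (delta_mx 0 p) (sX j 1%N)) y Yy).
  have /nbhs_ballP[r /= r0 Hr] := n1.
  by exists r => // z /Hr[? [? ?]]; split.
pose b j := \sum_p (`|'D_(delta_mx 0 p) (X j) y| + 1) + `|c j|.
have b0 j : 0 <= b j.
  by rewrite addr_ge0// sumr_ge0// => p _; rewrite addr_ge0.
pose C := 2 * \sum_j b j + 1.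
have C0 : 0 < C by rewrite ltr_wpDl// mulr_ge0// sumr_ge0.
apply: (@gronwall_vanish U y r C) => //.
  by move=> z /Hr[Yz _ _]; exact: dU.
move=> z h /Hr[Yz HX HdX].
pose a l := 'D_(delta_mx 0 l) U z; pose S := \sum_l `|a l|.
have Dh w : 'D_w U z = \sum_l w 0 l *: a l by rewrite derive_row//; exact: dU.
have HB j : `|'D_(U z) (X j) z + c j *: U z| <= b j * `|U z|.
  rewrite (le_trans (ler_normD _ _))// normrZ mulrDl lerD//.
  rewrite derive_row; last exact: dX.
  rewrite (le_trans (ler_norm_sum _ _ _))// mulr_suml ler_sum// => p _.
  rewrite normrZ mulrC ler_pM//; last exact: row_norm_entry.
  apply: row_norm_le => [|l]; first by rewrite addr_ge0.
  exact: norm_le_dist (HdX j p l) (row_norm_entry _ l).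
(* The direction [delta_mx 0 j], which is [X j y], is split into [X j z], where the equation
   applies, and a remainder with entries of size at most [eps]. *)
have aE j : `|a j| <= b j * `|U z| + eps * S.
  have -> : a j = 'D_(X j z) U z + 'D_(X j y - X j z) U z.
    rewrite derive_linearB; last exact: dU.
    by rewrite Xy addrC subrK.
  rewrite (le_trans (ler_normD _ _))// lerD//; first by rewrite HU.
  rewrite Dh (le_trans (ler_norm_sum _ _ _))// mulr_sumr ler_sum// => l _.
  rewrite normrZ sub_mx_entry; apply: ler_wpM2r; first exact: normr_ge0.
  exact: HX.
have Sb : S <= 2 * ((\sum_j b j) * `|U z|).
  have : S <= \sum_(j < m) (b j * `|U z| + eps * S) by apply: ler_sum => j _.
  rewrite big_split/= -mulr_suml sumr_const card_ord -mulr_natl.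
  have S0 : 0 <= S by rewrite sumr_ge0.
  have me : m%:R * (eps * S) <= 2^-1 * S.
    rewrite mulrA ler_wpM2r// /eps invfM mulrCA ler_piMr ?invr_ge0//.
    by rewrite ler_pdivrMr// mul1r ler_nat leqnSn.
  by set T := (\sum_j b j) * _; lra.
rewrite Dh (le_trans (ler_norm_sum _ _ _))//.
apply: (@le_trans _ _ (`|h| * S)).
  rewrite mulr_sumr ler_sum// => l _; rewrite normrZ.
  by apply: ler_wpM2r; [exact: normr_ge0|exact: row_norm_entry].
rewrite [C * _]mulrC -mulrA ler_wpM2l// (le_trans Sb)// mulrA ler_wpM2r//.
by rewrite lerDl.
Qed.

End vanishing.

Lemma nbhs_sub2 (T : topologicalType) (x : T) (P Q S : set T) :
  nbhs x P -> nbhs x Q -> P `&` Q `<=` S -> nbhs x S.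
Proof. by move=> nP nQ; apply: nbhs_sub; exact: filterI. Qed.

Section linear_combinations.
Context {R : realType} {V W : normedModType R}.
Variables (F G : V -> W) (y : V) (a : R) (h : V).
Hypotheses (dF : differentiable F y) (dG : differentiable G y).

Let daF : differentiable (a *: F) y.
Proof. exact: differentiableZ. Qed.

Lemma derive_linear_comb : 'D_h (a *: F + G) y = a *: 'D_h F y + 'D_h G y.
Proof.
have dFh : derivable F y h by exact: diff_derivable.
have dGh : derivable G y h by exact: diff_derivable.
have daFh : derivable (a *: F) y h by exact: diff_derivable.
by rewrite (deriveD daFh dGh) (deriveZ a dFh).
Qed.

Lemma diff_linear_comb : 'd (a *: F + G) y h = a *: 'd F y h + 'd G y h.
Proof.
have dH : differentiable (a *: F + G) y by exact: differentiableD.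
by rewrite -(deriveE h dH) -(deriveE h dF) -(deriveE h dG) derive_linear_comb.
Qed.

End linear_combinations.

Lemma sub_linear_comb (R : pzRingType) (V : lmodType R) (a : R) (p q r s : V) :
  a *: p + q - (a *: r + s) = a *: (p - r) + (q - s).
Proof. by rewrite scalerBr opprD addrACA. Qed.

Section brackets.
Context {R : realType} {m : nat} {M : manifold R m}.
Local Notation E := 'rV[R]_m.
Implicit Types (u v w : M -> E).

Lemma local_rep_differentiable (i : chart M) v x : smooth_vfield v -> dom i x ->
  differentiable (local_rep i v) (crd i x).
Proof. by move=> sv ix; apply: Ck_differentiable (sv i 1%N) _; exists x. Qed.

Lemma local_rep_linear_fun (i : chart M) (a : R) v w :
  local_rep i (a *: v + w) = a *: local_rep i v + local_rep i w.
Proof. by apply/funext => y; rewrite local_rep_linear. Qed.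

Lemma local_rep_fun0 (i : chart M) : local_rep i (0 : M -> E) = cst 0.
Proof. by apply/funext => y; exact: local_rep0. Qed.

Lemma bracket0r v : bracket v 0 = 0.
Proof.
apply/funext => x; pose i := chart_at M x.
have dc : differentiable (cst (0 : E) : E -> E) (crd i x).
  exact: differentiable_cst.
have H1 : 'd (local_rep i (0 : M -> E)) (crd i x) (v x) = 0.
  by rewrite local_rep_fun0 -deriveE// derive_cst.
have H2 : 'd (local_rep i v) (crd i x) (0 : E) = 0 by exact: linear0.
apply: (etrans (congr2 (fun p q : E => p - q) H1 H2)).
exact: subr0.
Qed.

Lemma bracket_linear u (a : R) v w :
  smooth_vfield v -> smooth_vfield w ->
  bracket u (a *: v + w) = a *: bracket u v + bracket u w.
Proof.
move=> sv sw; apply/funext => x; rewrite /bracket local_rep_linear_fun.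
set i := chart_at M x; set y := crd i x.
have ix : dom i x by exact: dom_chart_at.
have dv := local_rep_differentiable sv ix.
have dw := local_rep_differentiable sw ix.
have H1 := diff_linear_comb a (u x : E) dv dw.
have H2 : 'd (local_rep i u) y ((a *: v + w) x) =
    a *: 'd (local_rep i u) y (v x) + 'd (local_rep i u) y (w x).
  exact: linearP.
apply: (etrans (congr2 (fun p q : E => p - q) H1 H2)).
exact: sub_linear_comb.
Qed.

Lemma lie_derivative_linear (V W U : E -> E) (a : R) y : differentiable V y ->
  differentiable W y -> differentiable U y ->
  lie_derivative (a *: V + W) U y =
  a *: lie_derivative V U y + lie_derivative W U y.
Proof.
move=> dV dW dU; rewrite /lie_derivative.
have -> : 'D_((a *: V + W) y) U y = a *: 'D_(V y) U y + 'D_(W y) U y.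
  exact: derive_linear.
have -> : 'D_(U y) (a *: V + W) y = a *: 'D_(U y) V y + 'D_(U y) W y.
  exact: derive_linear_comb.
exact: sub_linear_comb.
Qed.

End brackets.

(** * Eigenvectors in the abelian ideal *)

Section almost_abelian.
Context {R : realType} {m : nat} {M : manifold R m}.
Local Notation E := 'rV[R]_m.
Implicit Types (u v w : M -> E) (i : chart M) (x : M).
Variables (f g : M -> E) (L I : set (M -> E)) (v0 : M -> E).
Hypotheses (sf : smooth_vfield f) (sg : smooth_vfield g).
Hypothesis symL : forall v, L v -> infinitesimal_symmetry f g v.
Hypothesis LI : almost_abelian L I v0.

Lemma ideal_sub v : I v -> L v.
Proof. by case: LI => _ H _ _ _; exact: H. Qed.

Lemma complement_mem : L v0.
Proof. by case: LI => _ _ _ _ []. Qed.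

Lemma symmetry_smooth v : L v -> smooth_vfield v.
Proof. by move=> /symL[]. Qed.

Lemma ideal_smooth v : I v -> smooth_vfield v.
Proof. by move=> /ideal_sub/symmetry_smooth. Qed.

Lemma ideal_linear (a : R) v w : I v -> I w -> I (a *: v + w).
Proof. by case: LI => -[_ H] _ _ _ _; exact: H. Qed.

Lemma ideal0 : I 0.
Proof. by case: LI => -[]. Qed.

Lemma idealZ (a : R) v : I v -> I (a *: v).
Proof. by move=> Iv; rewrite -[a *: v]addr0; exact: ideal_linear ideal0. Qed.

Lemma idealD v w : I v -> I w -> I (v + w).
Proof. by move=> Iv Iw; rewrite -[v]scale1r; exact: ideal_linear. Qed.

Lemma ideal_sum r (a : 'I_r -> R) (e : 'I_r -> M -> E) :
  (forall j, I (e j)) -> I (\sum_j a j *: e j).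
Proof. by move=> Ie; elim/big_ind : _ => [||j _];
  [exact: ideal0|exact: idealD|exact: idealZ]. Qed.

Lemma lie_bracketE i x v w : L v -> L w -> dom i x ->
  lie_derivative (local_rep i v) (local_rep i w) (crd i x) =
  local_rep i (bracket v w) (crd i x).
Proof. by move=> Lv Lw ix; rewrite local_rep_bracket//; exact: symmetry_smooth. Qed.

Lemma lie_abelian i x v w : I v -> I w -> dom i x ->
  lie_derivative (local_rep i v) (local_rep i w) (crd i x) = 0.
Proof.
move=> Iv Iw ix; rewrite lie_bracketE//; try exact: ideal_sub.
by case: LI => _ _ _ -> // _; rewrite local_rep0.
Qed.

Lemma lie_eigen i x (a : R) v : eigenvector I v0 a v -> dom i x ->
  lie_derivative (local_rep i v0) (local_rep i v) (crd i x) =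
  a *: local_rep i v (crd i x).
Proof.
move=> [Iv Ev] ix.
by rewrite (lie_bracketE complement_mem (ideal_sub Iv) ix) Ev local_repZ.
Qed.

(** Write X = w + a v0 with w in the ideal: w commutes with [u], so only a v0 acts, by the constant
    a mu. Hence an eigenvector for v0 is one for all of [L]. *)
Lemma eigen_lie (mu : R) u X : eigenvector I v0 mu u -> L X ->
  exists c : R, forall i x, dom i x ->
    lie_derivative (local_rep i X) (local_rep i u) (crd i x) =
    c *: local_rep i u (crd i x).
Proof.
move=> Eu LX; have [Iu _] := Eu; have [_ _ _ _ [_ _ /(_ X LX)]] := LI.
move=> [w [a [Iw XE]]]; exists (a * mu) => i x ix.
rewrite XE addrC local_rep_linear_fun lie_derivative_linear; first last.
- by apply: local_rep_differentiable => //; exact: ideal_smooth.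
- by apply: local_rep_differentiable => //; exact: ideal_smooth.
- apply: local_rep_differentiable => //.
  exact: (symmetry_smooth complement_mem).
by rewrite (lie_abelian Iw Iu ix) addr0 (lie_eigen Eu ix) scalerA.
Qed.

Lemma eigenvector_vanish_near (mu : R) u x : eigenvector I v0 mu u ->
  transitive_at L x -> u x = 0 -> nbhs x [set z | u z = 0].
Proof.
move=> Eu Lx ux; have [Iu _] := Eu.
(* Transitivity gives fields of [L] in all coordinate directions at [x]; their brackets with [u]
   determine every first derivative of [u] nearby. *)
have /choice[X HX] : forall j : 'I_m, exists v, L v /\ v x = delta_mx 0 j.
  move=> j; have : values L x (delta_mx 0 j) by rewrite Lx.
  by move=> [v Lv vE]; exists v.
have /choice[c Hc] : forall j : 'I_m, exists c : R, forall i z, dom i z ->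
    lie_derivative (local_rep i (X j)) (local_rep i u) (crd i z) =
    c *: local_rep i u (crd i z).
  by move=> j; apply: eigen_lie Eu (HX j).1.
pose i := chart_at M x; have ix : dom i x by exact: dom_chart_at.
have := @frame_vanish R m (crd i @` dom i) (fun j => local_rep i (X j)) c
  (local_rep i u) (crd i x).
move=> /(_ _ _ _ _ _ _ _)H.
have nU : nbhs (crd i x) [set z | local_rep i u z = 0].
  apply: H.
  - exact: crd_open.
  - by exists x.
  - by move=> j; have := symmetry_smooth (HX j).1; exact.
  - exact: (ideal_smooth Iu).
  - by move=> j; rewrite local_rep_chart_at (HX j).2.
  - move=> _ j [z iz <-]; have := Hc j i z iz; rewrite /lie_derivative => /eqP.
    by rewrite subr_eq => /eqP ->; rewrite addrC.
  - by rewrite local_rep_chart_at.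
have n1 : nbhs x [set z | local_rep i u (crd i z) = 0].
  exact: crd_continuous ix _ nU.
have n2 : nbhs x (dom i) by apply: open_nbhs_nbhs; split=> //; exact: dom_open.
by apply: (nbhs_sub2 n1 n2) => z [/= Hz iz]; apply/(local_rep_eq0 u iz).
Qed.

(** The zero set of [u] is closed by continuity and open by [eigenvector_vanish_near], so
    connectedness applies. *)
Lemma eigenvector_vanish (mu : R) u x : eigenvector I v0 mu u ->
  connected [set: M] -> (forall z, transitive_at L z) -> u x = 0 -> u = 0.
Proof.
move=> Eu cM Lt ux; have [Iu _] := Eu; pose Z := [set z | u z = 0].
have oZ : open Z by apply: open_subset_nbhs => z Zz; exact: eigenvector_vanish_near Eu (Lt z) Zz.
have oC : open (~` Z).
  apply: open_subset_nbhs => z uz.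
  pose i := chart_at M z; have iz : dom i z by exact: dom_chart_at.
  have dU := local_rep_differentiable (ideal_smooth Iu) iz.
  have U0 : local_rep i u (crd i z) != 0.
    by apply/eqP => /(local_rep_eq0 u iz).
  have nU : nbhs (crd i z) [set y | local_rep i u y != 0].
    have cU : {for crd i z, continuous (local_rep i u)}.
      exact: differentiable_continuous.
    have nb : nbhs (local_rep i u (crd i z)) [set y : E | y != 0].
      apply: open_nbhs_nbhs; split=> //.
      have -> : [set y : E | y != 0] = ~` [set 0].
        by apply/seteqP; split=> y /= /eqP.
      apply: closed_openC; apply: accessible_closed_set1.
      exact/hausdorff_accessible/norm_hausdorff.
    exact: (cU _ nb).
  have n1 : nbhs z [set z' | local_rep i u (crd i z') != 0].
    exact: crd_continuous iz _ nU.
  have n2 : nbhs z (dom i) by apply: open_nbhs_nbhs; split=> //; exact: dom_open.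
  apply: (nbhs_sub2 n1 n2) => z' [/= Hz' iz'] uz'; move/eqP: Hz'; apply.
  exact/(local_rep_eq0 u iz').
have ZT : Z = setT.
  apply: cM; first by exists x.
    by exists Z => //; rewrite setTI.
  by exists Z; rewrite ?setTI//; rewrite -openC.
by apply/funext => z; have : Z z by rewrite ZT.
Qed.

Variable xi0 : M.
Hypothesis LT : transitive_at L xi0.
Hypothesis IG : direct_sum (values I xi0) (line_distribution g xi0).
Hypothesis bij : set_bij I I (bracket v0).
Hypothesis diag : ad_diagonalisable I v0.

Lemma eigenvalue_neq0 (mu : R) u : eigenvector I v0 mu u -> u xi0 != 0 ->
  mu != 0.
Proof.
move=> [Iu Eu]; apply: contra_neq => mu0; rewrite mu0 scale0r in Eu.
have -> : u = 0; last by [].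
case: bij => _ inj _; apply: inj; rewrite ?inE//; first exact: ideal0.
by rewrite Eu bracket0r.
Qed.

Definition family_mx r (e : 'I_r -> M -> E) : 'M[R]_(r, m) :=
  \matrix_j e j xi0.

Lemma family_mxE r (e : 'I_r -> M -> E) (a : 'rV[R]_r) :
  a *m family_mx e = (\sum_j a 0 j *: e j) xi0.
Proof.
rewrite mulmx_sum_row fct_sumE; apply: eq_bigr => j _.
by rewrite rowK.
Qed.

(** No dimension of the ideal is available, but a family with independent values at [xi0] has at
    most [m] members. In a largest such family of eigenvectors, every other eigenvector has a
    dependent value, and diagonalisability extends this to the ideal. *)
Lemma maximal_eigenvectors : exists r (e : 'I_r -> M -> E) (lam : 'I_r -> R),
  [/\ forall j, eigenvector I v0 (lam j) (e j), row_free (family_mx e) &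
      forall v, I v -> (v xi0 <= family_mx e)%MS].
Proof.
pose P r := `[< exists (e : 'I_r -> M -> E) (lam : 'I_r -> R),
  (forall j, eigenvector I v0 (lam j) (e j)) /\ row_free (family_mx e) >].
have exP : exists r, P r.
  exists 0%N; apply/asboolP; exists (fun=> 0), (fun=> 0); split; first by case.
  by rewrite /row_free -leqn0 rank_leq_row.
have ubP r : P r -> (r <= m)%N.
  by move=> /asboolP[e [lam [_]]]; rewrite /row_free => /eqP <-; exact: rank_leq_col.
have [r /asboolP[e [lam [eP eF]]] rmax] := ex_maxnP exP ubP.
exists r, e, lam; split=> // v Iv.
have key u mu : eigenvector I v0 mu u -> (u xi0 <= family_mx e)%MS.
  move=> Eu; apply/negPn/negP => ue.
  have : P (r + 1)%N.
    apply/asboolP.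
    exists (fun k => match fintype.split k with inl j => e j | inr _ => u end).
    exists (fun k => match fintype.split k with inl j => lam j | inr _ => mu end).
    split; first by move=> k; case: (fintype.split k).
    have -> : family_mx (fun k : 'I_(r + 1) =>
        match fintype.split k with inl j => e j | inr _ => u end) =
        col_mx (family_mx e) (u xi0).
      apply/row_matrixP => k; rewrite rowK -[k]splitK.
      case: (fintype.split k) => j /=; rewrite ?(unsplitK (inl _)) ?(unsplitK (inr _)).
        by rewrite rowKu rowK.
      by rewrite rowKd; apply/rowP => l; rewrite mxE (ord1 j).
    have rk : (\rank (family_mx e) < \rank (col_mx (family_mx e) (u xi0)))%N.
      have <- : \rank (family_mx e + u xi0)%MS =
          \rank (col_mx (family_mx e) (u xi0)) by rewrite addsmxE.
      apply: rank_ltmx; rewrite ltmxE addsmxSl.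
      by apply: contra ue; exact: submx_trans (addsmxSr _ _).
    rewrite /row_free eqn_leq rank_leq_row; apply: leq_trans rk.
    by rewrite (eqP eF) addn1.
  by move=> /rmax; rewrite addn1 ltnn.
have [K [eps [a [epsP ->]]]] := diag Iv.
rewrite fct_sumE; elim/big_ind : _ => [|p q|k _].
- exact: sub0mx.
- exact: addmx_sub.
- exact: key (epsP k).
Qed.

End almost_abelian.

(** * From independent values at [xi0] to a basis of the ideal *)

Section eigenbasis.
Context {R : realType} {m : nat} {M : manifold R m}.
Local Notation E := 'rV[R]_m.
Implicit Types (u v w : M -> E) (i : chart M) (x : M).
Variables (f g : M -> E) (L I : set (M -> E)) (v0 : M -> E).
Hypotheses (sf : smooth_vfield f) (sg : smooth_vfield g).
Hypothesis symL : forall v, L v -> infinitesimal_symmetry f g v.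
Hypothesis LI : almost_abelian L I v0.
Variable xi0 : M.
Hypothesis LT : transitive_at L xi0.
Hypothesis IG : direct_sum (values I xi0) (line_distribution g xi0).
Hypothesis bij : set_bij I I (bracket v0).
Hypothesis diag : ad_diagonalisable I v0.

Let Ismooth v : I v -> smooth_vfield v.
Proof. exact: ideal_smooth symL LI _. Qed.

Let IL v : I v -> L v.
Proof. exact: ideal_sub LI _. Qed.

Let i0 := chart_at M xi0.

Let y0 := crd i0 xi0.

Let i0x : dom i0 xi0.
Proof. exact: dom_chart_at. Qed.

Let lr v := local_rep i0 v.

Let lr0 v : lr v y0 = v xi0.
Proof. exact: local_rep_chart_at. Qed.

Let dlr v : smooth_vfield v -> differentiable (lr v) y0.
Proof. by move=> sv; exact: local_rep_differentiable. Qed.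

Let lieE X Z : L X -> L Z ->
  lie_derivative (lr X) (lr Z) y0 = bracket X Z xi0.
Proof.
by move=> LX LZ; rewrite -lr0; exact: lie_bracketE symL _ _ _ _ LX LZ i0x.
Qed.

Lemma bracket_sum u r (a : 'I_r -> R) (e : 'I_r -> M -> E) :
  (forall j, I (e j)) ->
  bracket u (\sum_j a j *: e j) = \sum_j a j *: bracket u (e j).
Proof.
(* Membership in the ideal is carried along because additivity of the bracket needs smooth partial
   sums. *)
move=> Ie; suff [] : I (\sum_j a j *: e j) /\
    bracket u (\sum_j a j *: e j) = \sum_j a j *: bracket u (e j) by [].
elim/big_ind2 : _ => [|v v' w w' [Iv <-] [Iw <-]|j _].
- by split; [exact: ideal0 LI|exact: bracket0r].
- split; first exact: idealD LI _ _ Iv Iw.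
  by have := bracket_linear u 1 (Ismooth Iv) (Ismooth Iw); rewrite !scale1r.
- split; first exact: idealZ LI _ _ (Ie j).
  have := bracket_linear u (a j) (Ismooth (Ie j)) (Ismooth (ideal0 LI)).
  by rewrite bracket0r !addr0.
Qed.

Lemma decompose (h : E) : exists2 w, I w & exists b : R, h = w xi0 + b *: g xi0.
Proof.
have [+ _] := IG => /(congr1 (fun A : set E => A h)).
rewrite -[RHS]/True => HT; have : [set a + b | a in values I xi0 &
  b in line_distribution g xi0] h by rewrite HT.
by move=> [_ [w Iw <-]] [_ [b _ <-] <-]; exists w => //; exists b.
Qed.

Lemma ideal_line_eq0 w (b : R) : I w -> w xi0 = b *: g xi0 -> w xi0 = 0.
Proof.
move=> Iw wE; have [_ cap] := IG.
have : (values I xi0 `&` line_distribution g xi0) (w xi0).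
  by split; [exists w|exists b].
by rewrite cap.
Qed.

(** A basis of the space of values at [xi0] only; elements of the ideal that vanish at [xi0] are not
    yet accounted for. *)
Definition value_basis r (e : 'I_r -> M -> E) : Prop :=
  (forall c : 'rV[R]_r, (\sum_j c 0 j *: e j) xi0 = 0 -> c = 0) /\
  (forall v, I v -> exists c : 'rV[R]_r, v xi0 = (\sum_j c 0 j *: e j) xi0).

Lemma value_basis_inj r (e : 'I_r -> M -> E) (a b : 'rV[R]_r) :
  value_basis e -> (\sum_j a 0 j *: e j) xi0 = (\sum_j b 0 j *: e j) xi0 ->
  a = b.
Proof.
move=> [ind _] H; apply/eqP; rewrite -subr_eq0; apply/eqP/ind.
have -> : \sum_j (a - b) 0 j *: e j =
    \sum_j a 0 j *: e j - \sum_j b 0 j *: e j.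
  by rewrite -sumrB; apply: eq_bigr => j _; rewrite sub_mx_entry scalerBl.
have E0 (p q : M -> E) : p xi0 = q xi0 -> (p - q) xi0 = 0.
  by move=> pq; rewrite -[LHS]/(p xi0 - q xi0) pq; exact: subrr.
exact: E0.
Qed.

Lemma value_basis_neq0 r (e : 'I_r -> M -> E) j : value_basis e -> e j xi0 != 0.
Proof.
move=> [ind _]; apply/eqP => ej0.
have /(congr1 (fun c : 'rV[R]_r => c 0 j)) : delta_mx 0 j = 0 :> 'rV[R]_r.
  apply: ind; rewrite fct_sumE (bigD1 j)//= big1 => [|k kj].
    by rewrite fctE ej0 scaler0 addr0.
  by rewrite fctE mxE (negbTE kj) andbF scale0r.
by rewrite !mxE !eqxx => /eqP; rewrite oner_eq0.
Qed.

Lemma eigen_value_basis : exists r (e : 'I_r -> M -> E) (lam : 'I_r -> R),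
  [/\ forall j, eigenvector I v0 (lam j) (e j), row_free (family_mx xi0 e) &
      value_basis e].
Proof.
have [r [e [lam [eP eF eS]]]] := maximal_eigenvectors xi0 diag.
exists r, e, lam; split=> //; split=> [c|v /eS/submxP[c cE]].
  by rewrite -family_mxE => /eqP; rewrite mulmx_free_eq0// => /eqP.
by exists c; rewrite -family_mxE.
Qed.

Lemma lie_derivativeN (V W : E -> E) y :
  lie_derivative V W y = - lie_derivative W V y.
Proof. by rewrite /lie_derivative opprB. Qed.

(** The bracket multiplies the coefficients by the eigenvalues, which are nonzero because ad_{v0} is
    injective on the ideal. *)
Lemma value_basis_bracket r (e : 'I_r -> M -> E) (lam : 'I_r -> R)
    (c : 'rV[R]_r) : value_basis e ->
  (forall j, eigenvector I v0 (lam j) (e j)) ->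
  bracket v0 (\sum_j c 0 j *: e j) xi0 = 0 -> c = 0.
Proof.
move=> eB eP; have Ie j : I (e j) by have [] := eP j.
rewrite bracket_sum// => H.
have [ind _] := eB.
have cl : \row_j (c 0 j * lam j) = 0.
  apply: ind; rewrite -[RHS]H; congr (_ xi0); apply: eq_bigr => j _.
  by have [_ ->] := eP j; rewrite mxE scalerA.
apply/rowP => j; move/rowP/(_ j): cl; rewrite !mxE => /eqP.
rewrite mulf_eq0 => /orP[/eqP //|/eqP lj].
have := eigenvalue_neq0 LI bij (eP j) (value_basis_neq0 j eB).
by rewrite lj eqxx.
Qed.

(* If g vanished at xi0, then f - v, for v in I with the value of f at xi0,
   would have zero derivative there, so [v0, v] and hence v would vanish. *)
Lemma control_neq0 : ~ line_distribution g xi0 (f xi0) -> g xi0 != 0.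
Proof.
move=> fg; apply/eqP => g0.
have fn0 : f xi0 <> 0 by move=> f0; apply: fg; exists 0 => //; rewrite f0 scale0r.
have [r [e [lam [eP _ eB]]]] := eigen_value_basis.
have Ie j : I (e j) by have [] := eP j.
have all h : exists2 w, I w & h = w xi0.
  by have [w Iw [b ->]] := decompose h; exists w; rewrite // g0 scaler0 addr0.
have [w Iw fw] := all (f xi0).
have [_ /(_ w Iw)[c cE]] := eB.
set v := \sum_j c 0 j *: e j in cE.
have Iv : I v by exact: ideal_sum LI _ _ _ _.
pose D := -1 *: lr v + lr f.
have dv := dlr (Ismooth Iv); have df := dlr sf.
have dD : differentiable D y0.
  by apply: differentiableD => //; exact: differentiableZ.
have D0 : D y0 = 0.
  rewrite /D -[LHS]/(-1 *: lr v y0 + lr f y0) !lr0 scaleN1r fw -cE addrC.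
  exact: subrr.
(* Since [g xi0] is assumed zero, [X, f] vanishes at [xi0], and only - [X, v] = [v, X] is left of
   [X, f - v]. *)
have LD X : L X -> lie_derivative (lr X) D y0 =
    lie_derivative (lr v) (lr X) y0.
  move=> LX; have dX := dlr (symmetry_smooth symL LX).
  rewrite lie_derivativeN lie_derivative_linear//.
  rewrite [lie_derivative (lr f) _ _]lie_derivativeN.
  by rewrite (symmetry_lie0 sf (symL LX) i0x g0) oppr0 addr0 scaleN1r opprK.
have DX X : L X -> 'D_(lr X y0) D y0 = lie_derivative (lr v) (lr X) y0.
  move=> LX; rewrite -LD// /lie_derivative D0.
  by rewrite derive0 subr0.
have Dh h : 'D_h D y0 = 0.
  have [w' Iw' ->] := all h.
  rewrite -lr0 DX; last exact: IL.
  exact: (lie_abelian symL LI Iv Iw' i0x).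
have Lv0 := complement_mem LI.
have : bracket v0 v xi0 = 0.
  rewrite -(lieE Lv0 (IL Iv)) lie_derivativeN.
  by rewrite -DX// Dh oppr0.
move=> /(value_basis_bracket eB eP) c0; apply: fn0.
rewrite fw cE /v c0 fct_sumE big1// => j _.
by rewrite fctE mxE scale0r.
Qed.

(** As [u] vanishes at [xi0], brackets with it there are mere derivatives of [u]. These are zero
    along the ideal, by commutation, and a multiple of [g] along [g]. So [v0, u] at [xi0] lies both
    in I(xi0) and on the control line, which meet only in 0. *)
Lemma bracket_vanish u : I u -> g xi0 != 0 -> u xi0 = 0 ->
  bracket v0 u xi0 = 0.
Proof.
move=> Iu g0 u0; have U0 : lr u y0 = 0 by rewrite lr0.
have Lv0 := complement_mem LI.
have dU := dlr (Ismooth Iu).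
have DI w : I w -> 'D_(w xi0) (lr u) y0 = 0.
  move=> Iw; have H : lie_derivative (lr w) (lr u) y0 = 0.
    exact: lie_abelian symL LI _ _ _ _ Iw Iu i0x.
  by move: H; rewrite /lie_derivative U0 lr0 derive0 subr0.
have [c Hc] : exists c : R, lie_derivative (lr u) (lr g) y0 = c *: lr g y0.
  exact: symmetry_lie sf sg (symL (IL Iu)) _ _ _ (or_intror erefl) i0x g0.
rewrite /lie_derivative U0 derive0 !lr0 sub0r in Hc.
have DG : 'D_(g xi0) (lr u) y0 = - (c *: g xi0).
  by rewrite -Hc opprK.
have [w Iw [b v0E]] := decompose (v0 xi0).
apply: (@ideal_line_eq0 (bracket v0 u) (- (b * c))).
  by case: LI => _ _ H _ _; exact: H.
rewrite -(lieE Lv0 (IL Iu)) /lie_derivative U0 lr0 v0E [w xi0 + _]addrC derive_linear//.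
by rewrite (DI _ Iw) addr0 DG derive0 subr0 scalerN scalerA scaleNr.
Qed.

(** Subtract the combination with the same value at [xi0]. By [bracket_vanish] the bracket of v0
    with the difference vanishes there, which forces a_j (mu - lam_j) = 0. Only eigenvectors for
    [mu] are subtracted, and the difference is again one. *)
Lemma eigen_residual r (e : 'I_r -> M -> E) (lam : 'I_r -> R) (mu : R) v :
  g xi0 != 0 -> value_basis e -> (forall j, eigenvector I v0 (lam j) (e j)) ->
  eigenvector I v0 mu v -> exists a : 'rV[R]_r,
    eigenvector I v0 mu (v - \sum_j a 0 j *: e j) /\
    (v - \sum_j a 0 j *: e j) xi0 = 0.
Proof.
move=> g0 eB eP [Iv Ev]; have Ie j : I (e j) by have [] := eP j.
have [ind /(_ v Iv)[a aE]] := eB.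
set s := \sum_j a 0 j *: e j in aE.
have Is : I s by exact: ideal_sum LI _ _ _ _.
have uE : v - s = -1 *: s + v by rewrite scaleN1r addrC.
have Iu : I (v - s) by rewrite uE; exact: ideal_linear LI _ _ _ Is Iv.
have u0 : (v - s) xi0 = 0 by rewrite fctE /= aE; exact: subrr.
have BE : bracket v0 (v - s) = -1 *: bracket v0 s + mu *: v.
  by rewrite uE bracket_linear ?Ev//; exact: Ismooth.
have Bs : bracket v0 s = \sum_j a 0 j *: (lam j *: e j).
  by rewrite bracket_sum//; apply: eq_bigr => j _; have [_ ->] := eP j.
have al : \row_j (a 0 j * (mu - lam j)) = 0.
  apply: ind; have := bracket_vanish Iu g0 u0; rewrite BE Bs => <-.
  rewrite !fctE aE /s !fct_sumE /= !scaler_sumr -big_split/=.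
  apply: eq_bigr => j _; rewrite mxE !fctE.
  by rewrite !scalerA -scalerDl; congr (_ *: _); ring.
exists a; split=> //; split=> //.
rewrite BE Bs uE scalerDr addrC [RHS]addrC; congr (_ + _).
rewrite scalerA mulrN1 !scaler_sumr; apply: eq_bigr => j _.
rewrite !scalerA; congr (_ *: _).
move/rowP/(_ j): al; rewrite !mxE => H; lra.
Qed.

Let add_vanish (p q : M -> E) z : q z = 0 -> (p + q) z = p z.
Proof. by move=> qz; rewrite -[LHS]/(p z + q z) qz; exact: addr0. Qed.

(** Modulo the [e j], every element of the ideal is a finite sum of eigenvectors vanishing at [xi0],
    hence near it, and everywhere in the connected transitive case. Uniqueness of coefficients is
    tested at [xi0] alone. *)
Lemma value_basis_ad_eigenvalues r (e : 'I_r -> M -> E) (lam : 'I_r -> R) :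
  g xi0 != 0 -> value_basis e -> (forall j, eigenvector I v0 (lam j) (e j)) ->
  ad_eigenvalues xi0 L I v0 lam.
Proof.
move=> g0 eB eP; have Ie j : I (e j) by have [] := eP j.
have res v : I v -> exists (a : 'rV[R]_r) K (u : 'I_K -> M -> E) (mu : 'I_K -> R),
    (forall k, eigenvector I v0 (mu k) (u k) /\ u k xi0 = 0) /\
    v = \sum_j a 0 j *: e j + \sum_k u k.
  move=> Iv; have [K [eps [mu [epsP ->]]]] := diag Iv.
  have /choice[b Hb] := fun k => eigen_residual g0 eB eP (epsP k).
  exists (\sum_k b k), K, (fun k => eps k - \sum_j b k 0 j *: e j), mu.
  split; first exact: Hb.
  have -> : \sum_j (\sum_k b k) 0 j *: e j = \sum_k \sum_j b k 0 j *: e j.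
    rewrite exchange_big; apply: eq_bigr => j _.
    by rewrite summxE scaler_suml.
  by rewrite sumrB addrC subrK.
exists e; split=> //.
- split=> // v Iv; have [a [K [u [mu [uP vE]]]]] := res v Iv.
  exists a; split=> [|a' Ha'].
    have : nbhs xi0 [set z | forall k, u k z = 0].
      apply: nbhs_forall => k; have [Eu u0] := uP k.
      exact: (eigenvector_vanish_near symL LI Eu LT u0).
    move=> H; apply: (nbhs_sub H) => z Hz; rewrite vE; apply: add_vanish.
    by rewrite fct_sumE big1// => k _; exact: Hz.
  apply: (value_basis_inj eB); rewrite -(nbhs_singleton Ha') vE.
  by apply/esym/add_vanish; rewrite fct_sumE big1// => k _; have [] := uP k.
move=> cM Lt; split=> // v Iv; have [a [K [u [mu [uP vE]]]]] := res v Iv.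
have vE' : v = \sum_j a 0 j *: e j.
  rewrite vE [X in _ + X]big1 ?addr0// => k _; have [Eu u0] := uP k.
  exact: (eigenvector_vanish symL LI Eu cM Lt u0).
exists a; split=> // a' Ha'.
by apply: (value_basis_inj eB); rewrite -Ha' vE'.
Qed.

End eigenbasis.

(** * Adapted frames *)

Section normalization.
Context {R : realType} {n : nat} {M : manifold R (n + 1)}.
Local Notation E := 'rV[R]_(n + 1).
Variables (f g : M -> E) (L I : set (M -> E)) (v0 : M -> E).
Hypotheses (sf : smooth_vfield f) (sg : smooth_vfield g).
Hypothesis symL : forall v, L v -> infinitesimal_symmetry f g v.
Hypothesis LI : almost_abelian L I v0.
Variable xi0 : M.
Hypothesis IG : direct_sum (values I xi0) (line_distribution g xi0).
Hypothesis bij : set_bij I I (bracket v0).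
Hypothesis diag : ad_diagonalisable I v0.

(** Rank count: the values of [e] and [g xi0] span the tangent space, of dimension n + 1, and
    [g xi0] is outside the span of the former. *)
Lemma value_basis_size r (e : 'I_r -> M -> E) : g xi0 != 0 ->
  (forall j, I (e j)) -> row_free (family_mx xi0 e) -> value_basis I xi0 e ->
  r = n.
Proof.
move=> g0 Ie eF [_ eS]; pose A := family_mx xi0 e.
have gA : ~~ (g xi0 <= A)%MS.
  apply/negP => /submxP[c]; rewrite family_mxE => gE; move/eqP: g0; apply.
  rewrite gE; apply: (ideal_line_eq0 IG (b := 1)).
    exact: ideal_sum LI _ _ _ _.
  by rewrite -gE scale1r.
have rk1 : (r < \rank (A + g xi0)%MS)%N.
  rewrite -[X in (X < _)%N](eqP eF); apply: rank_ltmx; rewrite ltmxE addsmxSl.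
  by apply: contra gA; exact: submx_trans (addsmxSr _ _).
have rk2 : (\rank (A + g xi0)%MS <= r + 1)%N.
  by apply: leq_trans (mxrank_adds_leqif _ _) _; rewrite leq_add ?rank_leq_row.
have full : (1%:M <= A + g xi0)%MS.
  apply/row_subP => k; have [w Iw [b ->]] := decompose IG (row k 1%:M : E).
  have [c ->] := eS w Iw; rewrite -family_mxE addmx_sub//.
    exact: submx_trans (submxMl _ _) (addsmxSl _ _).
  exact: submx_trans (scalemx_sub _ (submx_refl _)) (addsmxSr _ _).
have := mxrankS full; rewrite mxrank1 => rk3.
apply/eqP; rewrite eqn_leq -ltnS -[n.+1]addn1 (leq_trans rk1) ?rank_leq_col//=.
by rewrite -ltnS -[r.+1]addn1 -[n.+1]addn1 (leq_trans rk3).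
Qed.

Lemma value_basis_rescale (e : 'I_n -> M -> E) (k : 'I_n -> R)
    (s : {perm 'I_n}) : (forall j, k j != 0) -> value_basis I xi0 e ->
  value_basis I xi0 (fun j => k j *: e (s j)).
Proof.
move=> k0 [ind span].
have sumE (c : 'rV[R]_n) : \sum_j c 0 j *: (k j *: e (s j)) =
    \sum_i (\row_i (c 0 (s^-1%g i) * k (s^-1%g i))) 0 i *: e i.
  rewrite [RHS](reindex_inj (@perm_inj _ s)); apply: eq_bigr => j _.
  by rewrite mxE permK scalerA.
split=> [c|v Iv].
  rewrite sumE => /ind H; apply/rowP => j.
  move/rowP/(_ (s j)): H; rewrite !mxE permK => /eqP.
  by rewrite mulf_eq0 (negbTE (k0 j)) orbF => /eqP.
have [c cE] := span v Iv; exists (\row_j (c 0 (s j) / k j)).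
rewrite sumE cE; congr (_ xi0); apply: eq_bigr => j _.
by rewrite !mxE permKV divfK.
Qed.

Lemma normalized_eigenbasis : ~ line_distribution g xi0 (f xi0) ->
  exists (e : 'I_n -> M -> E) (lam eta : 'I_n -> R) (a : R) (k0 : 'I_n),
  [/\ forall j, eigenvector I v0 (lam j) (e j), value_basis I xi0 e,
      forall j, eta j = 0 \/ eta j = 1, k0 = 0%N :> nat /\ eta k0 = 1 &
      f xi0 = (\sum_j eta j *: e j) xi0 + a *: g xi0].
Proof.
move=> fg; have g0 := control_neq0 sf symL LI IG bij diag fg.
have [r [e [lam [eP eF eB]]]] := eigen_value_basis xi0 diag.
have rn := value_basis_size g0 (fun j => (eP j).1) eF eB; subst r.
have [w Iw [a fE]] := decompose IG (f xi0).
have [_ /(_ w Iw)[c cE]] := eB.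
have [j cj] : exists j, c 0 j != 0.
  apply/existsP; apply: contra_notT fg => /existsPn H.
  exists a => //; rewrite fE cE fct_sumE big1 ?add0r// => j _.
  by have := H j; rewrite negbK => /eqP ->; rewrite scale0r.
have n0 : (0 < n)%N by case: j {cj} => j; case: (n).
(* The transposition brings a nonzero coefficient of [f] to the first place, so that the first [eta]
   is 1. *)
pose k0 := Ordinal n0; pose s := tperm k0 j.
(* Nonzero coefficients of [f] are absorbed into the eigenvectors; the default 1 keeps the family a
   basis. *)
pose k i := if c 0 (s i) == 0 then 1 else c 0 (s i).
exists (fun i => k i *: e (s i)), (lam \o s), (fun i => (c 0 (s i) != 0)%:R), a, k0.
split.
- move=> i; have [Ie Ei] := eP (s i); split; first exact: idealZ LI _ _ Ie.
  have := bracket_linear v0 (k i) (ideal_smooth symL LI Ie)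
    (ideal_smooth symL LI (ideal0 LI)).
  by rewrite bracket0r !addr0 => ->; rewrite Ei !scalerA mulrC.
- by apply: value_basis_rescale => // i; rewrite /k; case: ifPn.
- by move=> i; case: (c 0 (s i) == 0); [left|right].
- by split=> //; rewrite /s tpermL cj.
have SE : \sum_i c 0 i *: e i =
    \sum_i (c 0 (s i) != 0)%:R *: (k i *: e (s i)).
  rewrite [LHS](reindex_inj (@perm_inj _ s)); apply: eq_bigr => i _ /=.
  rewrite scalerA /k; case: eqP => [->|_] /=; first by rewrite mul0r !scale0r.
  by rewrite mul1r.
by rewrite fE cE SE.
Qed.

End normalization.

(** * Coefficients in a moving frame *)

Section frame.
Context {R : realType} {n : nat}.
Local Notation E := 'rV[R]_(n + 1).
Variables (W : set E) (e : 'I_n -> E -> E) (G : E -> E).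
Hypothesis oW : open W.
Hypotheses (se : forall j, smooth W (e j)) (sG : smooth W G).

Definition frame_mx (y : E) : 'M[R]_(n + 1) := col_mx (\matrix_j e j y) (G y).

Hypothesis uP : forall y, W y -> frame_mx y \in unitmx.

Definition frame_comb (a : 'I_n -> R) (b : R) (y : E) : E :=
  \sum_j a j *: e j y + b *: G y.

Lemma frame_combE a b y :
  frame_comb a b y = row_mx (\row_j a j) (b%:M : 'M[R]_1) *m frame_mx y.
Proof.
rewrite mul_row_col mul_scalar_mx mulmx_sum_row; congr (_ + _).
by apply: eq_bigr => j _; rewrite mxE rowK.
Qed.

Lemma frame_comb_inj a b a' b' y : W y ->
  frame_comb a b y = frame_comb a' b' y -> (forall j, a j = a' j) /\ b = b'.
Proof.
move=> Wy; rewrite !frame_combE => /(can_inj (mulmxK (uP Wy)))/eq_row_mx[Ha Hb].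
split=> [j|]; first by move/rowP/(_ j): Ha; rewrite !mxE.
by move/matrixP/(_ 0 0): Hb; rewrite !mxE.
Qed.

Definition frame_coef (H : E -> E) (j : 'I_n) (y : E) : R :=
  (H y *m invmx (frame_mx y)) 0 (lshift 1 j).

Definition frame_last (H : E -> E) (y : E) : R :=
  (H y *m invmx (frame_mx y)) 0 (rshift n 0).

Lemma frame_coefE H y : W y ->
  H y = frame_comb (fun j => frame_coef H j y) (frame_last H y) y.
Proof.
move=> Wy; rewrite frame_combE.
rewrite [X in X *m _](_ : _ = H y *m invmx (frame_mx y)); last first.
  rewrite -[RHS]hsubmxK; congr row_mx; apply/rowP => j; rewrite [LHS]mxE [RHS]mxE.
    by [].
  by rewrite (ord1 j) eqxx mulr1n.
by rewrite mulmxKV// uP.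
Qed.

Lemma Ck_frame_mx k i j : Ck k W (fun y => frame_mx y i j).
Proof.
rewrite -[i]splitK; case: (fintype.split i) => i' /=.
  have -> : (fun y => frame_mx y (lshift 1 i') j) = (fun y => e i' y 0 j).
    by apply/funext => y; rewrite col_mxEu mxE.
  by apply: Ck_entry => //; exact: se.
have -> : (fun y => frame_mx y (rshift n i') j) = (fun y => G y 0 j).
  by apply/funext => y; rewrite col_mxEd (ord1 i').
by apply: Ck_entry => //; exact: sG.
Qed.

Lemma Ck_frame_entry k (H : E -> E) j : smooth W H ->
  Ck k W (fun y => (H y *m invmx (frame_mx y)) 0 j).
Proof.
move=> sH.
apply: (@Ck_mulmx R _ (n + 1) (n + 1) k W H (fun y => invmx (frame_mx y))) => // i.
  by apply: Ck_entry => //; exact: sH.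
by apply: Ck_invmx => // i' j'; exact: Ck_frame_mx.
Qed.

Lemma smooth_frame_coef H j : smooth W H -> smooth W (frame_coef H j).
Proof. by move=> sH k; exact: Ck_frame_entry. Qed.

Lemma smooth_frame_last H : smooth W H -> smooth W (frame_last H).
Proof. by move=> sH k; exact: Ck_frame_entry. Qed.

Lemma derive_scale (V : normedModType R) m (a : V -> R) (U : V -> 'rV[R]_m) y h :
  differentiable a y -> differentiable U y ->
  differentiable (fun z => a z *: U z) y /\
  'D_h (fun z => a z *: U z) y = 'D_h a y *: U y + a y *: 'D_h U y.
Proof.
move=> da dU.
have E1 l : (fun z => (a z *: U z) 0 l) = a * (fun z => U z 0 l).
  by apply/funext => z; rewrite mxE.
have dUl l : differentiable (fun z => U z 0 l) y by exact: differentiable_entry.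
have daU : differentiable (fun z => a z *: U z) y.
  by apply: differentiable_rowP => l; rewrite E1; exact: differentiableM.
split=> //; apply/rowP => l; rewrite derive_entry// E1 deriveM; last 2 first.
- exact: diff_derivable.
- exact: diff_derivable.
rewrite [RHS]mxE [X in _ = X + _]mxE [X in _ = _ + X]mxE derive_entry//.
by rewrite addrC [X in X + _]mulrC.
Qed.

(** When [X] acts diagonally on the frame at [y], the Leibniz rule decouples the coefficients of
    [X, H]. Only the values of [k], [kG], [h] and [s] at the single point [y] enter, so they need
    not depend smoothly on the point. *)
Lemma frame_lie (X H : E -> E) (k : 'I_n -> R) (kG : R) (h : 'I_n -> R) (s : R)
    y : W y -> differentiable X y -> smooth W H ->
  (forall j, lie_derivative X (e j) y = k j *: e j y) ->
  lie_derivative X G y = kG *: G y ->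
  lie_derivative X H y = frame_comb h s y ->
  forall j, 'D_(X y) (frame_coef H j) y + k j * frame_coef H j y = h j.
Proof.
move=> Wy dX sH He HG HH.
have de j : differentiable (e j) y by exact: Ck_differentiable (se j 1%N) Wy.
have dG : differentiable G y by exact: Ck_differentiable (sG 1%N) Wy.
have da j : differentiable (frame_coef H j) y.
  exact: Ck_differentiable (smooth_frame_coef j sH 1%N) Wy.
have db : differentiable (frame_last H) y.
  exact: Ck_differentiable (smooth_frame_last sH 1%N) Wy.
pose Ha j z := frame_coef H j z *: e j z.
pose Hb z := frame_last H z *: G z.
have nH : \forall z \near y, H z = (\sum_j Ha j + Hb) z.
  apply: (nbhs_sub (open_nbhs_nbhs (conj oW Wy))) => z Wz.
  by rewrite [LHS]frame_coefE// fctE fct_sumE.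
have DH : 'D_(X y) H y = \sum_j ('D_(X y) (frame_coef H j) y *: e j y +
     frame_coef H j y *: 'D_(X y) (e j) y) +
    ('D_(X y) (frame_last H) y *: G y + frame_last H y *: 'D_(X y) G y).
  rewrite (near_eq_derive _ nH).
  have dHa j : derivable (Ha j) y (X y).
    by apply: diff_derivable; have [] := derive_scale (X y) (da j) (de j).
  have dHb : derivable Hb y (X y).
    by apply: diff_derivable; have [] := derive_scale (X y) db dG.
  rewrite (deriveD (derivable_sum dHa) dHb) derive_sum//.
  congr (_ + _); last by have [] := derive_scale (X y) db dG.
  by apply: eq_bigr => j _; have [] := derive_scale (X y) (da j) (de j).
have DX : 'D_(H y) X y = \sum_j frame_coef H j y *: 'D_(e j y) X y +
    frame_last H y *: 'D_(G y) X y.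
  rewrite [in LHS](frame_coefE H Wy) /frame_comb addrC derive_linear//.
  by rewrite derive_linear_sum// addrC.
have key : lie_derivative X H y = frame_comb
    (fun j => 'D_(X y) (frame_coef H j) y + k j * frame_coef H j y)
    ('D_(X y) (frame_last H) y + kG * frame_last H y) y.
  rewrite /lie_derivative DH DX opprD addrACA /frame_comb; congr (_ + _).
    rewrite -sumrB; apply: eq_bigr => j _.
    rewrite -addrA -scalerBr -/(lie_derivative X (e j) y) He scalerA.
    by rewrite -scalerDl [k j * _]mulrC.
  rewrite -addrA -scalerBr -/(lie_derivative X G y) HG scalerA.
  by rewrite -scalerDl [kG * _]mulrC.
by move: HH; rewrite key => /(frame_comb_inj Wy)[].
Qed.

End frame.

(** * The straightening coordinates *)

Section straightening.
Context {R : realType} {n : nat}.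
Local Notation E := 'rV[R]_(n + 1).
Variables (y0 : E) (r : R) (e : 'I_n -> E -> E) (G V F : E -> E).
Variables (lam eta : 'I_n -> R) (a0 : R) (k0 : 'I_n).
Let W := ball y0 r.
Hypotheses (r0 : 0 < r) (se : forall j, smooth W (e j)) (sG : smooth W G).
Hypotheses (sV : smooth W V) (sF : smooth W F).
Hypothesis uP : forall y, W y -> frame_mx e G y \in unitmx.
Hypothesis lie_ee : forall y i j, W y -> lie_derivative (e i) (e j) y = 0.
Hypothesis lie_Ve : forall y j, W y ->
  lie_derivative V (e j) y = lam j *: e j y.
Hypothesis lie_G : forall y, W y ->
  (forall j, exists k : R, lie_derivative (e j) G y = k *: G y) /\
  exists k : R, lie_derivative V G y = k *: G y.
Hypothesis lie_F : forall y, W y ->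
  (forall j, exists k : R, lie_derivative (e j) F y = k *: G y) /\
  exists k : R, lie_derivative V F y = k *: G y.
Hypothesis lam0 : forall j, lam j != 0.
Hypothesis F0 : F y0 = frame_comb e G eta a0 y0.
Hypothesis eta0 : eta k0 = 1.

Let c j := frame_coef e G V j.
Let beta := frame_last e G V.
Let ph j := frame_coef e G F j.
Let alpha := frame_last e G F.

Hypothesis beta0 : forall y, W y -> beta y != 0.
Hypothesis ph0 : forall y, W y -> 0 < ph k0 y.

Let oW : open W.
Proof. exact: ball_open. Qed.

Let Wy0 : W y0.
Proof. exact: ballxx. Qed.

Let dW (V' : normedModType R) (H : E -> V') y : smooth W H -> W y ->
  differentiable H y.
Proof. by move=> sH; exact: Ck_differentiable (sH 1%N). Qed.

Let sc j : smooth W (c j).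
Proof. exact: smooth_frame_coef. Qed.

Let sph j : smooth W (ph j).
Proof. exact: smooth_frame_coef. Qed.

Let sbeta : smooth W beta.
Proof. exact: smooth_frame_last. Qed.

Let salpha : smooth W alpha.
Proof. exact: smooth_frame_last. Qed.

Let comb0 (k : R) y : k *: G y = frame_comb e G (fun=> 0) k y.
Proof. by rewrite /frame_comb big1 ?add0r// => j _; rewrite scale0r. Qed.

Let derive_frame (V' : normedModType R) (q : E -> V') H y :
  W y -> differentiable q y ->
  'D_(H y) q y = \sum_j frame_coef e G H j y *: 'D_(e j y) q y +
    frame_last e G H y *: 'D_(G y) q y.
Proof.
move=> Wy dq; rewrite [in LHS](frame_coefE uP H Wy) /frame_comb addrC.
by rewrite derive_linear// derive_linear_sum// addrC.
Qed.

Let lie_self (H : E -> E) y : lie_derivative H H y = 0.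
Proof. exact: subrr. Qed.

Lemma derive_e_coef_F i j y : W y -> 'D_(e i y) (ph j) y = 0.
Proof.
move=> Wy; have [/(_ i)[k Hk] _] := lie_G Wy; have [/(_ i)[l Hl] _] := lie_F Wy.
rewrite comb0 in Hl.
have ee j' : lie_derivative (e i) (e j') y = 0 *: e j' y.
  by rewrite lie_ee// scale0r.
have := frame_lie oW se sG uP Wy (dW (se i) Wy) sF ee Hk Hl j.
by rewrite mul0r addr0.
Qed.

Lemma derive_V_coef_F j y : W y -> 'D_(V y) (ph j) y + lam j * ph j y = 0.
Proof.
move=> Wy; have [_ [k Hk]] := lie_G Wy; have [_ [l Hl]] := lie_F Wy.
rewrite comb0 in Hl.
exact: (frame_lie oW se sG uP Wy (dW sV Wy) sF (fun j => lie_Ve j Wy) Hk Hl j).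
Qed.

Lemma derive_e_coef_V i j y : W y ->
  'D_(e i y) (c j) y = if j == i then - lam i else 0.
Proof.
move=> Wy; have [/(_ i)[k Hk] _] := lie_G Wy.
have ee j' : lie_derivative (e i) (e j') y = 0 *: e j' y.
  by rewrite lie_ee// scale0r.
have Hl : lie_derivative (e i) V y =
    frame_comb e G (fun j => if j == i then - lam i else 0) 0 y.
  rewrite lie_derivativeN lie_Ve// /frame_comb scale0r addr0 (bigD1 i)//= eqxx.
  by rewrite big1 ?addr0 ?scaleNr// => j' /negbTE ->; rewrite scale0r.
have := frame_lie oW se sG uP Wy (dW (se i) Wy) sV ee Hk Hl j.
by rewrite mul0r addr0.
Qed.

Lemma derive_V_coef_V j y : W y -> 'D_(V y) (c j) y + lam j * c j y = 0.
Proof.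
move=> Wy; have [_ [k Hk]] := lie_G Wy.
have Hl : lie_derivative V V y = frame_comb e G (fun=> 0) 0 y.
  by rewrite lie_self -comb0 scale0r.
exact: (frame_lie oW se sG uP Wy (dW sV Wy) sV (fun j => lie_Ve j Wy) Hk Hl j).
Qed.

(** Expanding [V] in the frame in the equation V(c_j) = - lam_j c_j, the part along [e j] already
    contributes - lam_j c_j; what is left is beta G(c_j) = 0. *)
Lemma derive_G_coef_V j y : W y -> 'D_(G y) (c j) y = 0.
Proof.
move=> Wy; have := derive_V_coef_V j Wy.
rewrite derive_frame//; last exact: dW (sc j) Wy.
rewrite (bigD1 j)//= derive_e_coef_V// eqxx big1 => [|i ij]; last first.
  by rewrite derive_e_coef_V// eq_sym (negbTE ij) scaler0.
rewrite addr0 -!/(_ * _) -/(c j y) -/(beta y).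
have := beta0 Wy; set b := beta y; set D := 'D_(G y) _ _ => b0 H.
apply: (mulfI b0); rewrite mulr0.
by move: H; rewrite -[_ *: D]/(_ * D) -[_ *: _]/(_ * _) => H; lra.
Qed.

Lemma derive_G_coef_F j y : W y -> 'D_(G y) (ph j) y = - (lam j * ph j y) / beta y.
Proof.
move=> Wy; have := derive_V_coef_F j Wy.
rewrite derive_frame//; last exact: dW (sph j) Wy.
rewrite big1 => [|i _]; last by rewrite derive_e_coef_F// scaler0.
have := beta0 Wy; rewrite add0r -/(beta y).
set b := beta y; set D := 'D_(G y) _ _ => b0 H.
apply: (mulfI b0); rewrite [RHS]mulrC divfK//.
by move: H; rewrite -[_ *: D]/(_ * D) => H; lra.
Qed.

Lemma coef_F0 j : ph j y0 = eta j.
Proof.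
have H := frame_coefE uP F Wy0; rewrite F0 in H.
by have [/(_ j)-> _] := frame_comb_inj uP Wy0 H.
Qed.

(* Q is w + 1: the flow of V contracts it at unit rate, and ph j at rate lam j. *)
Let Q y := ph k0 y `^ (lam k0)^-1.

Let Q0 y : W y -> 0 < Q y.
Proof. by move=> Wy; exact/powR_gt0/ph0. Qed.

Let sQ : smooth W Q.
Proof. by move=> k; apply: Ck_powR => //; exact: sph. Qed.

Lemma derive_e_Q i y : W y -> 'D_(e i y) Q y = 0.
Proof.
move=> Wy; have [_ ->] := derive_powR (lam k0)^-1 (e i y) (dW (sph k0) Wy) (ph0 Wy).
by rewrite derive_e_coef_F// mulr0.
Qed.

Lemma powRB1 (x p : R) : 0 < x -> x `^ (p - 1) = x `^ p / x.
Proof.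
move=> x0; rewrite powRB ?powRr1 ?ltW//.
by apply/implyP => _; rewrite gt_eqF.
Qed.

Lemma derive_G_Q y : W y -> 'D_(G y) Q y = - (Q y / beta y).
Proof.
move=> Wy; have [_ ->] := derive_powR (lam k0)^-1 (G y) (dW (sph k0) Wy) (ph0 Wy).
rewrite derive_G_coef_F// powRB1 ?ph0// -/(Q y).
have := beta0 Wy; have := lam0 k0; have := ph0 Wy.
move: (ph k0 y) (Q y) (lam k0) (beta y) => p q l b p0 l0 b0; field.
by rewrite l0 b0 gt_eqF.
Qed.

(** The function [psi] is constant along every frame field: along [G], the logarithmic derivatives
    of [ph j] and [ph k0] are in the ratio lam_j : lam_k0, and the exponent [p] balances them. As
    the ball is convex, [psi] keeps its value at [y0], which is [eta j] because [ph k0 y0] is 1. *)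
Lemma coef_F_eq j y : W y -> ph j y = eta j * Q y `^ lam j.
Proof.
move=> Wy; pose p := - (lam j / lam k0).
pose psi := ph j * (fun z => ph k0 z `^ p).
have dk z (Wz : W z) h := derive_powR p h (dW (sph k0) Wz) (ph0 Wz).
have dpsi z : W z -> differentiable psi z.
  move=> Wz; apply: differentiableM; first exact: dW (sph j) Wz.
  exact: (dk z Wz 0).1.
have Dpsi h z : W z -> 'D_h psi z =
    ph j z * (p * ph k0 z `^ (p - 1) * 'D_h (ph k0) z) +
    ph k0 z `^ p * 'D_h (ph j) z.
  move=> Wz; rewrite deriveM; first last.
  - exact: diff_derivable (dk z Wz h).1.
  - exact: diff_derivable (dW (sph j) Wz).
  by rewrite (dk z Wz h).2.
have psi0 h z : W z -> 'D_h psi z = 0.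
  move=> Wz; apply: (etrans (derive_frame (fun=> h) Wz (dpsi z Wz))).
  rewrite big1 => [|i _]; last by rewrite Dpsi// !derive_e_coef_F// !mulr0 addr0 scaler0.
  rewrite add0r Dpsi// !derive_G_coef_F// powRB1 ?ph0//.
  apply/eqP; rewrite scaler_eq0; apply/orP; right; apply/eqP.
  set q := ph k0 z `^ p; rewrite /p.
  have := beta0 Wz; have := lam0 k0; have := ph0 Wz; move: q.
  move: (ph k0 z) (ph j z) (lam k0) (lam j) (beta z).
  move=> x x' l l' b q x0 l0 b0; field.
  by rewrite l0 b0 gt_eqF.
have seg (t : R) : 0 <= t <= 1 -> W (t *: (y - y0) + y0).
  by move=> t01; exact: ball_segment.
have [t t01] := mean_value_line ler01 (fun t t01 => dpsi _ (seg t t01)).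
rewrite scale1r subrK psi0 ?mulr0; last exact: seg.
move=> /eqP; rewrite subr_eq0 => /eqP; rewrite /psi !fctE !coef_F0 eta0 powR1 mulr1 => <-.
rewrite -mulrA -powRrM.
have E1 : ph k0 y `^ p * ph k0 y `^ ((lam k0)^-1 * lam j) = 1.
  rewrite -powRD; last by apply/implyP => _; rewrite gt_eqF ?ph0.
  by rewrite /p mulrC addNr powRr0.
by rewrite E1 mulr1.
Qed.

Let Phi y : E := row_mx (\row_j (- (lam j)^-1 * c j y)) ((Q y - 1)%:M : 'M[R]_1).

Let Phi_l y j : Phi y 0 (lshift 1 j) = - (lam j)^-1 * c j y.
Proof. by rewrite row_mxEl mxE. Qed.

Let Phi_r y k : Phi y 0 (rshift n k) = Q y - 1.
Proof. by rewrite row_mxEr (ord1 k) mxE eqxx mulr1n. Qed.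

Let sPhi : smooth W Phi.
Proof.
move=> k; apply: CkP_row => // j; rewrite -[j]splitK.
case: (fintype.split j) => i /=.
  under eq_fun do rewrite Phi_l.
  exact: (CkZ (- (lam i)^-1) oW (sc i k)).
under eq_fun do rewrite Phi_r.
have QE : (fun y => Q y - 1) = Q - cst 1 by apply/funext => y.
by rewrite QE; apply: CkB oW (sQ k) _; exact: (Ck_cst (1 : R)).
Qed.

Let derive_Phi h y : W y -> 'D_h Phi y =
  row_mx (\row_j (- (lam j)^-1 * 'D_h (c j) y)) (('D_h Q y)%:M : 'M[R]_1).
Proof.
move=> Wy; have dPhi := dW sPhi Wy.
apply/rowP => j; rewrite derive_entry// -[j]splitK.
case: (fintype.split j) => i /=.
  under eq_fun do rewrite Phi_l.
  rewrite row_mxEl mxE.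
  have dci : derivable (c i) y h by apply: diff_derivable; exact: dW (sc i) Wy.
  exact: (deriveZ _ dci).
under eq_fun do rewrite Phi_r.
rewrite row_mxEr (ord1 i) mxE eqxx mulr1n.
have dQ : derivable Q y h by apply: diff_derivable; exact: dW sQ Wy.
have QE : (fun z => Q z - 1) = Q - cst 1 by apply/funext => z.
by rewrite QE deriveB// derive_cst subr0.
Qed.

Let derive_e_Phi i y : W y ->
  'D_(e i y) Phi y = row_mx (delta_mx 0 i) 0.
Proof.
move=> Wy; rewrite derive_Phi// derive_e_Q//; congr row_mx.
  apply/rowP => j; rewrite !mxE derive_e_coef_V// eqxx/=.
  by case: eqP => [->|_] /=; rewrite ?mulr0// mulrNN mulVf.
by apply/matrixP => k l; rewrite !mxE mul0rn.
Qed.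

Let derive_G_Phi y : W y ->
  'D_(G y) Phi y = row_mx 0 ((- (Q y / beta y))%:M : 'M[R]_1).
Proof.
move=> Wy; rewrite derive_Phi// derive_G_Q//; congr row_mx.
by apply/rowP => j; rewrite !mxE derive_G_coef_V// mulr0.
Qed.

Let derive_comb_Phi (a : 'I_n -> R) b y : W y ->
  'D_(frame_comb e G a b y) Phi y =
  row_mx (\row_j a j) ((- (b * Q y / beta y))%:M : 'M[R]_1).
Proof.
move=> Wy; have dPhi := dW sPhi Wy.
rewrite /frame_comb addrC derive_linear// derive_linear_sum// derive_G_Phi//.
under eq_bigr do rewrite derive_e_Phi//.
have -> : \sum_j a j *: row_mx (delta_mx 0 j) 0 =
    row_mx (\row_j a j) 0 :> 'rV[R]_(n + 1).
  rewrite [in RHS](row_sum_delta (\row_j a j)).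
  rewrite (big_morph (fun u : 'rV[R]_n => row_mx u (0 : 'rV[R]_1)) (op1 := +%R)
    (id1 := 0)); last 2 first.
  - by move=> u v; rewrite add_row_mx addr0.
  - by rewrite row_mx0.
  by apply: eq_bigr => j _; rewrite scale_row_mx scaler0 mxE.
rewrite scale_row_mx scaler0 add_row_mx addr0 add0r scale_scalar_mx.
by rewrite mulrN mulrA.
Qed.

Theorem straightening :
  exists (U V' : set E) (Phi Psi : E -> E) (al be : E -> R),
  [/\ open U, U `<=` W, U y0 & open V'] /\
  [/\ smooth U Phi, smooth V' Psi, smooth U al & smooth U be] /\
  (forall y, U y -> V' (Phi y) /\ Psi (Phi y) = y) /\
  (forall z, V' z -> U (Psi z) /\ Phi (Psi z) = z) /\
  (exists x0, Phi y0 = row_mx x0 0) /\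
  (forall y, U y -> [/\ be y != 0,
      'D_(F y + al y *: G y) Phi y = trivial_f eta lam (Phi y) &
      'D_(be y *: G y) Phi y = trivial_g (Phi y)]).
Proof.
have inj v : 'D_v Phi y0 = 0 -> v = 0.
  have := frame_coefE uP (fun=> v) Wy0.
  set a := fun j => _; set b := frame_last _ _ _ _ => vE.
  rewrite [in X in X -> _]vE derive_comb_Phi// -[0 in X in X -> _]row_mx0.
  move=> /eq_row_mx[Ha Hb]; rewrite vE.
  have -> : b = 0.
    move/matrixP/(_ 0 0): Hb; rewrite !mxE eqxx mulr1n => /eqP.
    rewrite oppr_eq0 mulf_eq0 invr_eq0 (negbTE (beta0 Wy0)) orbF.
    by rewrite mulf_eq0 (gt_eqF (Q0 Wy0)) orbF => /eqP.
  rewrite /frame_comb scale0r addr0 big1// => j _.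
  by move/rowP/(_ j): Ha; rewrite !mxE => ->; rewrite scale0r.
have [U [V' [Psi [[oU UW Uy0 oV' sPsi] [UV VU]]]]] :=
  inverse_function oW Wy0 sPhi inj.
(* The feedback cancels the [G] component [alpha] of [F], and its second part inverts the factor - Q
   / beta by which [Phi] sends [G] to the last coordinate field. *)
exists U, V', Phi, Psi, (fun y => - alpha y), (fun y => - (beta y / Q y)).
split=> //; split; first split.
- by move=> k; exact: Ck_sub UW (sPhi k).
- exact: sPsi.
- by move=> k; apply: Ck_sub UW _; exact: CkN oW (salpha k).
- move=> k; apply: Ck_sub UW _; apply: (CkN oW).
  apply: (@CkM _ _ _ _ beta (fun y => (Q y)^-1) oW (sbeta k)).
  by apply: CkV oW _ (sQ k) => y /Q0; exact: lt0r_neq0.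
split=> //; split=> //; split.
  exists (\row_j (- (lam j)^-1 * c j y0)); rewrite /Phi; congr row_mx.
  have -> : Q y0 = 1.
    by rewrite /Q coef_F0 eta0 powR1.
  by rewrite subrr; apply/matrixP => k l; rewrite !mxE mul0rn.
move=> y /UW Wy; have Qn : Q y != 0 by rewrite gt_eqF ?Q0.
split.
- by rewrite oppr_eq0 mulf_neq0 ?invr_eq0 ?beta0.
- have -> : F y + - alpha y *: G y = frame_comb e G (ph^~ y) 0 y.
    rewrite {1}(frame_coefE uP F Wy) /frame_comb -addrA -scalerDl.
    by rewrite subrr.
  rewrite derive_comb_Phi// mul0r mul0r oppr0.
  rewrite /trivial_f; congr row_mx.
    apply/rowP => j; rewrite [LHS]mxE [RHS]mxE coef_F_eq//.
    by rewrite row_mxKr mxE eqxx mulr1n subrK.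
  by apply/matrixP => k l; rewrite !mxE mul0rn.
- rewrite comb0 derive_comb_Phi// /trivial_g; congr row_mx.
    by apply/rowP => j; rewrite !mxE.
  rewrite mulNr mulNr opprK mulfVK// mulfV ?beta0//.
Qed.

End straightening.

(** * Feedback equivalence *)

Section feedback_in_chart.
Context {R : realType} {m : nat} {M : manifold R m}.
Local Notation E := 'rV[R]_m.
Variables (f g : M -> E) (i : chart M) (x0 : M).
Variables (f' g' : euclidean R m -> E) (U V : set E) (Phi Psi : E -> E).
Variables (al be : E -> R).
Hypotheses (ix0 : dom i x0) (oU : open U) (Uy0 : U (crd i x0)).
Hypothesis UY : U `<=` crd i @` dom i.
Hypotheses (oV : open V) (sPhi : smooth U Phi) (sPsi : smooth V Psi).
Hypotheses (sal : smooth U al) (sbe : smooth U be).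
Hypothesis UV : forall y, U y -> V (Phi y) /\ Psi (Phi y) = y.
Hypothesis VU : forall z, V z -> U (Psi z) /\ Phi (Psi z) = z.
Hypothesis equiv : forall y, U y -> [/\ be y != 0,
  'D_(local_rep i f y + al y *: local_rep i g y) Phi y = f' (Phi y) &
  'D_(be y *: local_rep i g y) Phi y = g' (Phi y)].

Let UM : set M := dom i `&` crd i @^-1` U.

Let phi (x : M) : euclidean R m := Phi (crd i x).

Let psi (z : euclidean R m) : M := par i (Psi z).

Let oUM : open UM.
Proof.
apply: open_subset_nbhs => x [ix Ux].
have n1 : nbhs x (dom i) by apply: open_nbhs_nbhs; split=> //; exact: dom_open.
have n2 : nbhs x [set x' | U (crd i x')].
  exact: (crd_continuous ix (open_nbhs_nbhs (conj oU Ux))).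
exact: (nbhs_sub2 n1 n2).
Qed.

Let S k := crd k @` (dom k `&` UM).

Let oS k : open (S k). Proof. exact: open_chart_image. Qed.

Let S_image k : (crd i \o par k) @` S k `<=` U.
Proof. by move=> _ [_ [x [kx [ix Ux]] <-] <-]; rewrite /= crdK. Qed.

Let S_transition k : smooth (S k) (crd i \o par k).
Proof.
move=> l; apply: Ck_sub (transition_smooth k i l).
by move=> _ [x [kx [ix _]] <-]; exists x.
Qed.

Let psi_dom z : V z -> UM (psi z) /\ crd i (psi z) = Psi z.
Proof.
move=> Vz; have [Uz _] := VU Vz; have [iz iE] := par_dom (UY Uz).
by split=> //; split=> //=; rewrite iE.
Qed.

Let phi_continuous x : UM x -> {for x, continuous phi}.
Proof.
move=> [ix Ux]; apply: (@continuous_comp _ _ _ (crd i) Phi).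
  exact: crd_continuous.
exact: (sPhi 0%N).
Qed.

Let psi_continuous z : V z -> {for z, continuous psi}.
Proof.
move=> Vz; have [[iz _] iE] := psi_dom Vz.
apply: (@continuous_comp _ _ _ Psi (par i)); first exact: (sPsi 0%N).
by rewrite -iE; exact: par_continuous.
Qed.

Let phi_smooth : smooth_map UM phi.
Proof.
split=> [x|k j]; first exact: phi_continuous.
have -> : crd k @` (dom k `&` UM `&` phi @^-1` dom j) = S k.
  by congr image; apply/seteqP; split=> [x [? _]|x ?] //; split.
move=> l; apply: (@Ck_comp_row _ _ _ _ _ (S k) U (crd i \o par k) Phi) => //.
exact: S_transition.
Qed.

Let psi_smooth : smooth_map (M := euclidean R m) V psi.
Proof.
split=> [z|j k]; first exact: psi_continuous.
pose T := V `&` psi @^-1` dom k.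
have -> : crd j @` (dom j `&` V `&` psi @^-1` dom k) = T.
  apply/seteqP; split=> [_ [z [[_ Vz] kz] <-]//|z [Vz kz]].
  by exists z.
have oT : open T.
  apply: open_subset_nbhs => z [Vz kz].
  apply: filterI; first exact: open_nbhs_nbhs.
  apply: (psi_continuous Vz); apply: open_nbhs_nbhs; split=> //.
  exact: dom_open.
move=> l; apply: (@Ck_comp_row _ _ _ _ _ T (crd i @` (dom i `&` dom k)) Psi
  (crd k \o par i)) => //.
- by apply: open_chart_image; exact: dom_open.
- move=> _ [z [Vz kz] <-]; have [[iz _] iE] := psi_dom Vz.
  by exists (psi z).
- by apply: Ck_sub (sPsi l) => z [].
- exact: transition_smooth.
Qed.

Let smooth_fun_chart (a : E -> R) : smooth U a -> smooth_fun UM (a \o crd i).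
Proof.
move=> sa k l.
apply: (@Ck_comp _ _ _ _ (S k) U (crd i \o par k) a) => //.
exact: S_transition.
Qed.

Let tangent_phi (h : M -> E) x : UM x ->
  tangent_map phi x (h x) = 'D_(local_rep i h (crd i x)) Phi (crd i x).
Proof.
move=> [ix Ux]; pose k := chart_at M x; have kx : dom k x by exact: dom_chart_at.
have dT : differentiable (crd i \o par k) (crd k x).
  exact: transition_differentiable.
have TE : (crd i \o par k) (crd k x) = crd i x by rewrite /= crdK.
have dP : differentiable Phi ((crd i \o par k) (crd k x)).
  by rewrite TE; exact: Ck_differentiable (sPhi 1%N) Ux.
have dPT : differentiable (Phi \o (crd i \o par k)) (crd k x).
  exact: differentiable_comp.
rewrite local_repE// -/k -TE -(derive_comp _ dT dP) (deriveE _ dPT).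
by [].
Qed.

(** An equivalence between representatives in one chart is carried to the manifold by composing
    [Phi] with [crd i] and [Psi] with [par i]. Smoothness in the other charts comes from the
    transition maps. *)
Lemma feedback_equivalent_chart :
  feedback_equivalent f g x0 f' g' (Phi (crd i x0) : euclidean R m).
Proof.
exists UM, phi, (al \o crd i), (be \o crd i); split=> //.
- exists V, psi; split=> //; split=> [x [ix Ux]|z Vz].
    have [Vx xE] := UV Ux; split=> //.
    by rewrite /psi /phi xE crdK.
  have [UMz iE] := psi_dom Vz; split=> //.
  by rewrite /phi iE; have [_] := VU Vz.
- by split; exact: smooth_fun_chart.
move=> x UMx; have [ix Ux] := UMx; have [b0 Ef Eg] := equiv Ux; split=> //.
  rewrite -[LHS]Ef.
  have -> : f x + (al \o crd i) x *: g x = (al (crd i x) *: g + f) x.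
    by rewrite addrC.
  by rewrite tangent_phi// local_rep_linear addrC.
rewrite -[LHS]Eg.
have -> : (be \o crd i) x *: g x = (be (crd i x) *: g) x by [].
by rewrite tangent_phi// local_repZ.
Qed.

End feedback_in_chart.

Lemma continuous_nbhs_open (T T' : topologicalType) (f : T -> T') x (A : set T') :
  {for x, continuous f} -> open A -> A (f x) -> nbhs x [set y | A (f y)].
Proof. by move=> cf oA Ax; apply: cf; exact: open_nbhs_nbhs. Qed.

Section frame_at_point.
Context {R : realType} {n : nat} {M : manifold R (n + 1)}.
Local Notation E := 'rV[R]_(n + 1).
Variables (f g : M -> E) (L I : set (M -> E)) (v0 : M -> E) (xi0 : M).
Hypothesis LI : almost_abelian L I v0.
Hypothesis LT : transitive_at L xi0.
Hypothesis IG : direct_sum (values I xi0) (line_distribution g xi0).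
Hypothesis g0 : g xi0 != 0.
Variable e : 'I_n -> M -> E.
Hypotheses (Ie : forall j, I (e j)) (eB : value_basis I xi0 e).

Let i0 := chart_at M xi0.

Let y0 := crd i0 xi0.

Let le j := local_rep i0 (e j).

Let lg := local_rep i0 g.

Lemma frame_comb_at (a : 'I_n -> R) (b : R) :
  frame_comb le lg a b y0 = (\sum_j a j *: e j) xi0 + b *: g xi0.
Proof.
rewrite /frame_comb /le /lg local_rep_chart_at fct_sumE; congr (_ + _).
by apply: eq_bigr => j _; rewrite local_rep_chart_at.
Qed.

(** In a vanishing combination, the part from the ideal lies on the control line, hence is zero by
    directness; then [g0] removes the last coefficient. *)
Lemma frame_mx_unit : frame_mx le lg y0 \in unitmx.
Proof.
apply: unitmx_inj => u; rewrite -[u]hsubmxK.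
have -> : rsubmx u = (rsubmx u 0 0)%:M by exact: mx11_scalar.
have -> : lsubmx u = \row_j lsubmx u 0 j by apply/rowP => j; rewrite mxE.
rewrite -frame_combE frame_comb_at => /eqP; rewrite addr_eq0 => /eqP H.
have E0 : (\sum_j lsubmx u 0 j *: e j) xi0 = 0.
  apply: (ideal_line_eq0 IG (b := - rsubmx u 0 0)); last by rewrite scaleNr.
  exact: ideal_sum LI _ _ _ _.
have [ind _] := eB; have l0 := ind _ E0.
move: H; rewrite E0 => /eqP; rewrite eq_sym oppr_eq0 scaler_eq0 (negbTE g0) orbF.
move=> /eqP ->; rewrite l0; apply/rowP => j; rewrite !mxE.
by case: fintype.split => k; rewrite !mxE ?mul0rn.
Qed.

(** If [b] were 0, v0(xi0) would lie in I(xi0), so L(xi0) would be I(xi0), which cannot contain the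
    nonzero vector g(xi0). *)
Lemma complement_coef_neq0 (a : 'I_n -> R) (b : R) :
  local_rep i0 v0 y0 = frame_comb le lg a b y0 -> b != 0.
Proof.
rewrite local_rep_chart_at frame_comb_at => v0E; apply/eqP => b0.
rewrite b0 scale0r addr0 in v0E.
have : values L xi0 (g xi0) by rewrite LT.
move=> [v Lv vg]; have [_ _ _ _ [_ _ /(_ v Lv)[w [k [Iw vE]]]]] := LI.
have Is : I (\sum_j a j *: e j) by exact: ideal_sum LI _ _ _ _.
have Iz : I (k *: (\sum_j a j *: e j) + w) by exact: ideal_linear LI _ _ _ Is Iw.
have zE : (k *: (\sum_j a j *: e j) + w) xi0 = 1 *: g xi0.
  rewrite scale1r -vg vE -[LHS]/(k *: (\sum_j a j *: e j) xi0 + w xi0) -v0E.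
  by rewrite addrC.
have := ideal_line_eq0 IG Iz zE; rewrite zE scale1r => /eqP.
by rewrite (negbTE g0).
Qed.

End frame_at_point.


Unset Implicit Arguments.

Theorem theorem2 (R : realType) (n : nat) (M : manifold R (n + 1))
    (f g : M -> 'rV[R]_(n + 1)) (xi0 : M)
    (L I : set (M -> 'rV[R]_(n + 1))) (v0 : M -> 'rV[R]_(n + 1)) :
  smooth_vfield f -> smooth_vfield g ->
  (forall v, L v -> infinitesimal_symmetry f g v) ->
  lie_subalgebra L ->
  ~ line_distribution g xi0 (f xi0) ->
  transitive_at L xi0 ->
  almost_abelian L I v0 ->
  direct_sum (values I xi0) (line_distribution g xi0) ->
  set_bij I I (bracket v0) ->
  ad_diagonalisable I v0 ->
  exists (lam eta : 'I_n -> R) (x0 : 'rV[R]_n),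
    [/\ ad_eigenvalues xi0 L I v0 lam,
        forall i, eta i = 0 \/ eta i = 1,
        exists2 i : 'I_n, i = 0%N :> nat & eta i = 1 &
        feedback_equivalent f g xi0 (trivial_f eta lam)
          (@trivial_g R n) (row_mx x0 0 : euclidean R (n + 1))].
Proof.
move=> sf sg symL _ nf LT LI IG bij diag.
have g0 := control_neq0 sf symL LI IG bij diag nf.
have [e [lam [eta [a0 [k0 [eP eB etaP [k00 eta0] fE]]]]]] :=
  normalized_eigenbasis sf symL LI IG bij diag nf.
have Ie j : I (e j) by have [] := eP j.
have lam0 j : lam j != 0.
  exact: (eigenvalue_neq0 LI bij (eP j) (value_basis_neq0 j eB)).
pose i0 := chart_at M xi0; have i0x : dom i0 xi0 by exact: dom_chart_at.
pose y0 := crd i0 xi0; pose Y := crd i0 @` dom i0.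
have oY : open Y by exact: crd_open.
have Yy0 : Y y0 by exists xi0.
pose le j := local_rep i0 (e j); pose lg := local_rep i0 g.
pose lv := local_rep i0 v0; pose lf := local_rep i0 f.
have sle j : smooth Y (le j) by exact: (ideal_smooth symL LI (Ie j)).
have slg : smooth Y lg by exact: sg.
have slf : smooth Y lf by exact: sf.
have Lv0 := complement_mem LI.
have slv : smooth Y lv by exact: (symmetry_smooth symL Lv0).
have uP0 : frame_mx le lg y0 \in unitmx by exact: (frame_mx_unit LI IG g0 Ie eB).
have [r1 /= r10 Hr1] : exists2 r1 : R, 0 < r1 & forall y, ball y0 r1 y ->
    Y y /\ frame_mx le lg y \in unitmx.
  have cdet : {for y0, continuous (fun y => \det (frame_mx le lg y))}.
    have cd := Ck_det oY (fun i j => Ck_frame_mx oY sle slg 0 i j).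
    exact: (cd y0 Yy0).
  have d0 : \det (frame_mx le lg y0) != 0 by move: uP0; rewrite unitmxE unitfE.
  have n1 := continuous_nbhs_open cdet (@open_neq R 0) d0.
  have /nbhs_ballP[r /= r0 Hr] : nbhs y0 (Y `&`
      [set y | \det (frame_mx le lg y) != 0]).
    exact: (filterI (open_nbhs_nbhs (conj oY Yy0)) n1).
  by exists r => // y /Hr[Yy dy]; split=> //; rewrite unitmxE unitfE.
pose W1 := ball y0 r1.
have oW1 : open W1 by exact: ball_open.
have W1y0 : W1 y0 by exact: ballxx.
have W1Y : W1 `<=` Y by move=> y /Hr1[].
have uP1 y : W1 y -> frame_mx le lg y \in unitmx by move=> /Hr1[].
have sub1 (V : normedModType R) (H : 'rV[R]_(n + 1) -> V) : smooth Y H -> smooth W1 H.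
  by move=> sH k; exact: Ck_sub W1Y (sH k).
have sb := smooth_frame_last oW1 (fun j => sub1 _ _ (sle j)) (sub1 _ _ slg) uP1
  (sub1 _ _ slv).
have sp := smooth_frame_coef oW1 (fun j => sub1 _ _ (sle j)) (sub1 _ _ slg) uP1
  k0 (sub1 _ _ slf).
have lfE : lf y0 = frame_comb le lg eta a0 y0.
  by rewrite frame_comb_at -fE /lf local_rep_chart_at.
have b0 : frame_last le lg lv y0 != 0.
  apply: (complement_coef_neq0 LI LT IG g0 Ie (a := fun j => frame_coef le lg lv j y0)).
  exact: (frame_coefE uP1 lv W1y0).
have p0 : 0 < frame_coef le lg lf k0 y0.
  have H := frame_coefE uP1 lf W1y0; rewrite lfE in H.
  by have [/(_ k0)<- _] := frame_comb_inj uP1 W1y0 H; rewrite eta0.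
(* The frame coefficients are known to be continuous only where the frame is invertible, hence this
   second shrinking. The set stays a ball because the constancy argument runs along segments. *)
have [r2 /= r20 Hr2] : exists2 r2 : R, 0 < r2 & forall y, ball y0 r2 y ->
    [/\ W1 y, frame_last le lg lv y != 0 & 0 < frame_coef le lg lf k0 y].
  have n1 := continuous_nbhs_open (sb 0%N y0 W1y0) (@open_neq R 0) b0.
  have n2 := continuous_nbhs_open (sp 0%N y0 W1y0) (@open_gt R 0) p0.
  have n0 := open_nbhs_nbhs (conj oW1 W1y0).
  have /nbhs_ballP[r /= r0 Hr] : nbhs y0 (W1 `&`
      ([set y | frame_last le lg lv y != 0] `&`
       [set y | 0 < frame_coef le lg lf k0 y])).
    exact: (filterI n0 (filterI n1 n2)).
  by exists r => // y /Hr[? [? ?]].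
pose W := ball y0 r2.
have WY : W `<=` Y by move=> y /Hr2[/W1Y].
have uP y : W y -> frame_mx le lg y \in unitmx by move=> /Hr2[/uP1].
have sub (V : normedModType R) (H : 'rV[R]_(n + 1) -> V) : smooth Y H -> smooth W H.
  by move=> sH k; exact: Ck_sub WY (sH k).
(* At a zero of [g] the zero vector would have two expansions in the frame. *)
have gW x : dom i0 x -> W (crd i0 x) -> g x != 0.
  move=> ix Wx; apply/eqP => /(local_rep_eq0 g ix) gx.
  have /(frame_comb_inj uP Wx)[_ /eqP] :
      frame_comb le lg (fun=> 0) 1 (crd i0 x) =
      frame_comb le lg (fun=> 0) 0 (crd i0 x).
    by rewrite /frame_comb /lg gx !scaler0.
  by rewrite oner_eq0.
have [] := @straightening R n y0 r2 le lg lv lf lam eta a0 k0 r20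
  (fun j => sub _ _ (sle j)) (sub _ _ slg) (sub _ _ slv) (sub _ _ slf) uP.
- move=> _ i j /WY[x ix <-]; exact: (lie_abelian symL LI (Ie i) (Ie j) ix).
- by move=> _ j /WY[x ix <-]; exact: (lie_eigen symL LI (eP j) ix).
- move=> y Wy; have [x ix xE] := WY _ Wy; subst y; split=> [j|].
    exact: (symmetry_lie sf sg (symL _ (ideal_sub LI (Ie j))) (or_intror erefl) ix (gW x ix Wy)).
  exact: (symmetry_lie sf sg (symL _ Lv0) (or_intror erefl) ix (gW x ix Wy)).
- move=> y Wy; have [x ix xE] := WY _ Wy; subst y; split=> [j|].
    exact: (symmetry_lie sf sg (symL _ (ideal_sub LI (Ie j))) (or_introl erefl) ix (gW x ix Wy)).
  exact: (symmetry_lie sf sg (symL _ Lv0) (or_introl erefl) ix (gW x ix Wy)).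
- exact: lam0.
- exact: lfE.
- exact: eta0.
- by move=> y /Hr2[].
- by move=> y /Hr2[].
move=> U [V' [Phi [Psi [al [be]]]]].
move=> [[oU UW Uy0 oV] [[sPhi sPsi sal sbe] [UV [VU [[x0 PhiE] equiv]]]]].
exists lam, eta, x0; split=> //.
- exact: (value_basis_ad_eigenvalues sf sg symL LI LT IG diag g0 eB eP).
- by exists k0.
rewrite -PhiE; apply: (feedback_equivalent_chart (U := U) (V := V') (Psi := Psi)
  (al := al) (be := be) i0x) => //.
by move=> y /UW/WY.
Qed.
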